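(* Let $d\ge 1$ be an integer and let $(p,\lambda)\in\Gamma$ with $\lambda>0$. Then there exists a bounded and linear extension operator $\mathscr{E}:\mathcal{B}^{\lambda}_p(\mathbb{R}^d)\to W^{1,p}(\mathbb{R}^{d+1}_+,\mu_{p-1}^{\lambda})$ such that $\mathscr{T}\circ\mathscr{E}=\mathrm{id}$ on $\mathcal{B}^{\lambda}_p(\mathbb{R}^d)$, where $\mathrm{id}$ denotes the identity map (that is, for every $f\in\mathcal{B}^{\lambda}_p(\mathbb{R}^d)$ the trace $\mathscr{T}(\mathscr{E}f)$ exists and equals $f$ $m_d$-a.e. in $\mathbb{R}^d$).
   Context: Notation. $\mathbb{R}^{d+1}_+=\{(x,t):x\in\mathbb{R}^d,\ t>0\}$; $m_n$ is $n$-dimensional Lebesgue measure; $\log^{\lambda}s=(\log s)^{\lambda}$; $\mathbb{N}=\{0,1,2,\dots\}$. $L^p(\mathbb{R}^d)$ is taken with respect to $m_d$. Parameter set. $\Gamma=\{(p,\lambda)\in\mathbb{R}^2: p>1,\ \lambda>p-1\}\cup\{(p,\lambda)\in\mathbb{R}^2: p=1,\ \lambda\ge 0\}$. Weights and measures. For $-1<\alpha\le p-1$ and $\lambda\in\mathbb{R}$, the weight $\omega_\alpha^\lambda:\mathbb{R}^{d+1}_+\to(0,\infty)$ is $\omega_\alpha^\lambda(x_1,\dots,x_{d+1})=|x_{d+1}|^{\alpha}\log^{\lambda}\frac{4}{|x_{d+1}|}$ if $x_{d+1}\in(0,1]$ and $=\log^{\lambda}4$ if $x_{d+1}\in(1,\infty)$.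 The measure $\mu_\alpha^\lambda$ on $\mathbb{R}^{d+1}_+$ is $\mu_\alpha^\lambda(E)=\frac{1}{\log^{\lambda}4}\int_E\omega_\alpha^\lambda\,dm_{d+1}$. Here $\alpha=p-1$. Sobolev space. For $p\in[1,\infty)$, $W^{1,p}(\mathbb{R}^{d+1}_+,\mu_\alpha^\lambda)$ is the normed space of all measurable $f\in L^1_{\rm loc}(\mathbb{R}^{d+1}_+)$ whose first-order distributional derivatives, denoted $\nabla f$, belong to $L^1_{\rm loc}(\mathbb{R}^{d+1}_+)$ and such that $\|f\|_{W^{1,p}(\mathbb{R}^{d+1}_+,\mu_\alpha^\lambda)}:=\|f\|_{L^p(\mathbb{R}^{d+1}_+,\mu_\alpha^\lambda)}+\|\nabla f\|_{L^p(\mathbb{R}^{d+1}_+,\mu_\alpha^\lambda)}<\infty$. Dyadic cubes. For $k\in\mathbb{Z}$, $\mathscr{Q}_{d,k}$ is the collection of cubes $Q=2^{-k}\big((0,1]^d+m\big)$, $m\in\mathbb{Z}^d$, with edge length $\ell(Q)=2^{-k}$. For $Q\in\mathscr{Q}_{d,k}$ put $\mathscr{W}(Q)=Q\times(2^{-k},2^{-k+1}]$ and $\mathscr{N}(Q)=\{y\in\mathbb{R}^{d+1}_+:\operatorname{dist}(y,\mathscr{W}(Q))<\frac14\ell(Q)\}$. Selected neighbors. Let $j\in\mathbb{N}$ and $Q\in\mathscr{Q}_{d,2^j}$ (so $\ell(Q)=2^{-2^j}$). A dyadic cube $Q'$ is a selected neighbor of $Q$, written $Q'\asymp Q$, if $Q'\in\mathscr{Q}_{d,2^j}\cup\mathscr{Q}_{d,2^{j-1}}$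 and $\overline{Q}\cap\overline{Q'}\ne\emptyset$; by convention $\mathscr{Q}_{d,2^{-1}}:=\mathscr{Q}_{d,1}$. Besov-type space. For $p\in[1,\infty)$ and $\lambda>0$, $\mathcal{B}^{\lambda}_p(\mathbb{R}^d)$ is the normed space of all measurable $f\in L^1_{\rm loc}(\mathbb{R}^d)$ with $\|f\|_{\mathcal{B}^{\lambda}_p(\mathbb{R}^d)}:=\|f\|_{L^p(\mathbb{R}^d)}+\|f\|_{\dot{\mathcal{B}}^{\lambda}_p(\mathbb{R}^d)}<\infty$, where $\|f\|^p_{\dot{\mathcal{B}}^{\lambda}_p(\mathbb{R}^d)}:=\sum_{j=0}^{\infty}(2^j+2)^{\lambda}\sum_{Q\in\mathscr{Q}_{d,2^j}}m_d(Q)\sum_{Q'\asymp Q}|f_Q-f_{Q'}|^p$ and $f_Q=\frac{1}{m_d(Q)}\int_Qf\,dm_d$. Trace. For $f\in L^1_{\rm loc}(\mathbb{R}^{d+1}_+)$ and $k\in\mathbb{N}$ define $\mathscr{T}_kf:\mathbb{R}^d\to\mathbb{R}$ by $\mathscr{T}_kf=\sum_{Q\in\mathscr{Q}_{d,k}}\Big(\frac{1}{m_{d+1}(\mathscr{N}(Q))}\int_{\mathscr{N}(Q)}f\,dm_{d+1}\Big)\chi_Q$. The trace function is $\mathscr{T}f=\lim_{k\to\infty}\mathscr{T}_kf$, provided the (finite) limit exists $m_d$-a.e. in $\mathbb{R}^d$. *)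

(* Defs.v *)
From HB Require Import structures.
From mathcomp Require Import all_boot all_order all_algebra.
From mathcomp Require Import all_classical all_reals all_analysis.
From mathcomp Require Import measurable_realfun.

Set Implicit Arguments.
Unset Strict Implicit.
Unset Printing Implicit Defensive.

Import Order.TTheory GRing.Theory Num.Theory.
Import numFieldNormedType.Exports.

Local Open Scope classical_set_scope.
Local Open Scope ring_scope.

(* The Borel sigma-algebra of R^n, generated by the coordinates. All function   *)
(* spaces below are modulo a.e. equality; classes are given by Borel            *)
(* representatives.                                                             *)
Section measurable_rV.
Context (R : realType) (n : nat).

Let coords (i : 'I_n) (x : 'rV[R]_n) : R := x ord0 i.

Let rV_set0 : g_sigma_preimage coords set0.
Proof. exact: sigma_algebra0. Qed.

Let rV_setC A : g_sigma_preimage coords A -> g_sigma_preimage coords (~` A).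
Proof. exact: sigma_algebraC. Qed.

Let rV_bigcup (F : _^nat) : (forall i, g_sigma_preimage coords (F i)) ->
  g_sigma_preimage coords (\bigcup_i (F i)).
Proof. exact: sigma_algebra_bigcup. Qed.

HB.instance Definition _ := @isMeasurable.Build default_measure_display
  'rV[R]_n (g_sigma_preimage coords) rV_set0 rV_setC rV_bigcup.

Lemma measurable_coord (i : 'I_n) :
  measurable_fun [set: 'rV[R]_n] (fun x : 'rV[R]_n => x ord0 i).
Proof.
move=> _ Y mY; rewrite setTI; apply: sub_sigma_algebra => /=.
rewrite -bigcup_seq /=; exists i; first by rewrite /= mem_index_enum.
by exists Y => //; rewrite setTI.
Qed.

Lemma measurable_fun_coordP d (T : measurableType d) (f : T -> 'rV[R]_n) :
  (forall i, measurable_fun [set: T] (fun x => f x ord0 i)) ->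
  measurable_fun [set: T] f.
Proof.
move=> mf; apply: (@measurability _ _ _ _ setT f
  (\big[setU/set0]_(i < n) preimage_set_system setT (coords i) measurable)) => //.
move=> _ [C + <-]; rewrite -bigcup_seq => -[i _ [B mB <-]].
by rewrite setTI; exact: mf.
Qed.

End measurable_rV.

Section points.
Context (R : realType) (n : nat).

(* The point (x, t) of R^(n+1), and the projection (x, t) |-> x. *)
Definition snoc (xt : 'rV[R]_n * R) : 'rV[R]_n.+1 :=
  \row_i (if unlift ord_max i is Some j then xt.1 ord0 j else xt.2).

Definition base_pt (y : 'rV[R]_n.+1) : 'rV[R]_n :=
  \row_i y ord0 (lift ord_max i).

Definition height (y : 'rV[R]_n.+1) : R := y ord0 ord_max.

Lemma measurable_snoc : measurable_fun setT snoc.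
Proof.
apply: measurable_fun_coordP => i.
rewrite (_ : (fun x => _) = (fun xt : 'rV[R]_n * R =>
  if unlift ord_max i is Some j then xt.1 ord0 j else xt.2)); last first.
  by apply/funext => x; rewrite mxE.
case: (unlift ord_max i) => [j|]; last exact: measurable_snd.
exact: (measurableT_comp (@measurable_coord R n j) measurable_fst).
Qed.

Lemma measurable_height : measurable_fun setT height.
Proof. exact: measurable_coord. Qed.

(* The product of m (on R^n) and of Lebesgue measure on R, carried to R^(n+1). *)
Definition lebesgue_snoc (m : {measure set 'rV[R]_n -> \bar R}) :
    set 'rV[R]_n.+1 -> \bar R :=
  pushforward (m \x lebesgue_measure)%E snoc.

HB.instance Definition _ (m : {measure set 'rV[R]_n -> \bar R}) :=
  Measure.copy (lebesgue_snoc m)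
    (measure_function_pushforward__canonical__measure_function_Measure
      (m \x lebesgue_measure)%E measurable_snoc).

End points.

(* n-dimensional Lebesgue measure, by recursion on n; R^0 is a point of mass 1. *)
Fixpoint lebesgueN (R : realType) (n : nat) :
    {measure set 'rV[R]_n -> \bar R} :=
  match n return {measure set 'rV[R]_n -> \bar R} with
  | 0 => \d_ (0 : 'rV[R]_0)
  | k.+1 => lebesgue_snoc (lebesgueN R k)
  end.

Section euclidean.
Context (R : realType) (n : nat).
Implicit Types (x y : 'rV[R]_n) (A D : set 'rV[R]_n).

(* The library norm on 'rV[R]_n is the sup norm; |x| and dist are Euclidean. *)
Definition enorm x : R := Num.sqrt (\sum_i x ord0 i ^+ 2).

Definition dist x A : R := inf [set enorm (x - y) | y in A].

Definition average (A : set 'rV[R]_n) (f : 'rV[R]_n -> R) : R :=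
  (fine (lebesgueN R n A))^-1 * \int[lebesgueN R n]_(x in A) f x.

Definition loc_integrable D (f : 'rV[R]_n -> R) : Prop :=
  measurable_fun D f /\
  forall K, compact K -> K `<=` D ->
    (lebesgueN R n).-integrable K (EFin \o f).

End euclidean.

Section weak_derivatives.
Context (R : realType) (n : nat).
Implicit Types (D : set 'rV[R]_n) (f phi : 'rV[R]_n -> R).

Fixpoint C_ (k : nat) f : Prop :=
  match k with
  | 0 => continuous f
  | j.+1 => (forall x, differentiable f x) /\ forall v, C_ j (fun x => 'D_v f x)
  end.

(* phi is in C^oo_c(D) (extended by zero to R^n). *)
Definition test_function D phi : Prop :=
  (forall k, C_ k phi) /\
  compact (closure [set x | phi x != 0]) /\
  closure [set x | phi x != 0] `<=` D.

(* g is the gradient of f in the sense of distributions on D, and is in L^1_loc. *)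
Definition weak_gradient D f (g : 'rV[R]_n -> 'rV[R]_n) : Prop :=
  (forall i, loc_integrable D (fun x => g x ord0 i)) /\
  forall phi, test_function D phi -> forall i : 'I_n,
    \int[lebesgueN R n]_(x in D) (f x * 'D_(delta_mx ord0 i) phi x) =
    - \int[lebesgueN R n]_(x in D) (g x ord0 i * phi x).

End weak_derivatives.

Section weighted_sobolev.
Context (R : realType) (d : nat).

Definition halfspace : set 'rV[R]_d.+1 := [set y | 0 < height y].

Lemma measurable_halfspace : measurable halfspace.
Proof.
rewrite (_ : halfspace = setT `&` @height R d @^-1` `]0, +oo[%classic).
  by apply: measurable_height => //; exact: measurable_itv.
by rewrite setTI; apply/seteqP; split => y /=; rewrite in_itv /= andbT.
Qed.

Variables alpha lam : R.

(* The profile of the weight as a function of the last coordinate t > 0. *)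
Definition weight1 (t : R) : R :=
  if t <= 1 then `|t| `^ alpha * ln (4 / `|t|) `^ lam else ln 4 `^ lam.

Definition weight (y : 'rV[R]_d.+1) : R := weight1 (height y).

Lemma weight_ge0 y : 0 <= weight y.
Proof. by rewrite /weight /weight1; case: ifP => _; rewrite ?mulr_ge0 ?powR_ge0. Qed.

Lemma measurable_weight : measurable_fun setT weight.
Proof.
apply: (@measurableT_comp _ _ _ _ _ _ weight1); last exact: measurable_height.
have mpowR (b : R) : measurable_fun setT (fun t : R => `|t| `^ b).
  exact: (measurableT_comp (measurable_powR b) (@normr_measurable _ setT)).
apply: measurable_fun_ifT => //=; first exact: measurable_fun_ler.
apply: measurable_funM => //.
apply: (measurableT_comp (measurable_powR lam)).
apply: measurableT_comp => //.
apply: measurable_funM => //.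
rewrite (_ : (fun t => _) = (fun t : R => `|t| `^ (-1))) //.
by apply/funext => t; rewrite powR_inv1.
Qed.

(* The measure mu_alpha^lam, as a measure on R^(d+1) carried by the half-space. *)
Definition mu_weight (E : set 'rV[R]_d.+1) : \bar R :=
  (((ln 4 `^ lam)^-1)%:E *
   \int[lebesgueN R d.+1]_(y in E `&` halfspace) (weight y)%:E)%E.

Let c_ge0 : (0 <= ((ln 4 `^ lam)^-1)%:E :> \bar R)%E.
Proof. by rewrite lee_fin invr_ge0 powR_ge0. Qed.

Let mu_weight0 : mu_weight set0 = 0.
Proof. by rewrite /mu_weight set0I integral_set0 mule0. Qed.

Let mu_weight_ge0 E : (0 <= mu_weight E)%E.
Proof.
rewrite /mu_weight mule_ge0// integral_ge0// => y _.
by rewrite lee_fin weight_ge0.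
Qed.

Let mu_weight_sigma_additive : semi_sigma_additive mu_weight.
Proof.
move=> F mF tF mUF.
have mw D : measurable_fun D (fun y => (weight y)%:E).
  by apply/measurable_EFinP; apply: measurable_funTS; exact: measurable_weight.
rewrite /mu_weight setI_bigcupl ge0_integral_bigcup//=; last 3 first.
- by move=> k; apply: measurableI => //; exact: measurable_halfspace.
- by move=> y _; rewrite lee_fin weight_ge0.
- exact: trivIset_setIr.
have int_ge0 k : (0 <=
    \int[lebesgueN R d.+1]_(y in F k `&` halfspace) (weight y)%:E)%E.
  by apply: integral_ge0 => y _; rewrite lee_fin weight_ge0.
rewrite -nneseriesZl//.
by apply: is_cvg_ereal_nneg_natsum_cond => k _ _; rewrite mule_ge0.
Qed.

HB.instance Definition _ := isMeasure.Build _ _ _ mu_weight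
  mu_weight0 mu_weight_ge0 mu_weight_sigma_additive.

End weighted_sobolev.

Section sobolev_space.
Context (R : realType) (d : nat) (p alpha lam : R).

Definition weighted_Lp_norm (h : 'rV[R]_d.+1 -> R) : \bar R :=
  Lnorm (@mu_weight R d alpha lam) p%:E (EFin \o (h \_ (@halfspace R d))).

(* The weak gradient is unique a.e., so the infimum is over at most one value; *)
(* it is +oo when f has no weak gradient in L^1_loc.                           *)
Definition sobolev_norm (f : 'rV[R]_d.+1 -> R) : \bar R :=
  ereal_inf [set (weighted_Lp_norm f + weighted_Lp_norm (fun y => enorm (g y)))%E
            | g in weak_gradient (@halfspace R d) f].

Definition sobolev (f : 'rV[R]_d.+1 -> R) : Prop :=
  [/\ loc_integrable (@halfspace R d) f,
      exists g, weak_gradient (@halfspace R d) f g &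
      (sobolev_norm f < +oo)%E].

End sobolev_space.

Section dyadic_cubes.
Context (R : realType) (d : nat).
Implicit Types (k : int) (Q : set 'rV[R]_d).

(* 2^-k ((0, 1]^d + m) *)
Definition cube k (m : 'rV[int]_d) : set 'rV[R]_d :=
  [set x : 'rV[R]_d | forall i, 2 ^ (- k) * (m ord0 i)%:~R < x ord0 i
                     <= 2 ^ (- k) * ((m ord0 i)%:~R + 1)].

Definition dyadic k : set (set 'rV[R]_d) := range (cube k).

(* W(Q) and N(Q), for Q in dyadic k. *)
Definition whitney k Q : set 'rV[R]_d.+1 :=
  [set y | Q (base_pt y) /\ 2 ^ (- k) < height y <= 2 ^ (- k + 1)].

Definition whitney_nbhd k Q : set 'rV[R]_d.+1 :=
  [set y | halfspace y /\ dist y (whitney k Q) < 4^-1 * 2 ^ (- k)].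

(* The selected neighbors of Q in dyadic (2^j). As 0.-1 = 0, for j = 0 the      *)
(* second alternative is dyadic 1, which is the convention Q_{d,2^-1} = Q_{d,1}. *)
Definition selected_neighbor (j : nat) Q : set (set 'rV[R]_d) :=
  [set Q' | (dyadic (2 ^ j)%N Q' \/ dyadic (2 ^ j.-1)%N Q') /\
            closure Q `&` closure Q' !=set0].

End dyadic_cubes.

Section besov_space.
Context (R : realType) (d : nat) (p lam : R).
Implicit Types f : 'rV[R]_d -> R.

Definition besov_energy f : \bar R :=
  (\sum_(0 <= j <oo) (((2 ^+ j + 2) `^ lam)%:E *
     \esum_(Q in @dyadic R d (2 ^ j)%N)
       (lebesgueN R d Q *
        \esum_(Q' in selected_neighbor j Q)
          (`| average Q f - average Q' f | `^ p)%:E)))%E.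

Definition besov_norm f : \bar R :=
  (Lnorm (lebesgueN R d) p%:E (EFin \o f) + besov_energy f `^ p^-1)%E.

Definition besov f : Prop :=
  loc_integrable [set: 'rV[R]_d] f /\ (besov_norm f < +oo)%E.

End besov_space.

Section trace.
Context (R : realType) (d : nat).
Implicit Types f : 'rV[R]_d.+1 -> R.

Definition trace_approx f (k : nat) (x : 'rV[R]_d) : R :=
  \sum_(Q \in @dyadic R d k) average (whitney_nbhd k Q) f * \1_Q x.

Definition has_trace f : Prop :=
  {ae lebesgueN R d, forall x, cvgn (fun k => trace_approx f k x)}.

Definition trace f (x : 'rV[R]_d) : R := limn (fun k => trace_approx f k x).

End trace.

Definition Gamma (R : realType) (p lam : R) : Prop :=
  (1 < p /\ p - 1 < lam) \/ (p = 1 /\ 0 <= lam).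

(* Main.v *)
Require Import Defs.
From mathcomp Require Import all_boot all_order all_algebra.
From mathcomp Require Import all_classical all_reals all_analysis.
From mathcomp Require Import measurable_realfun ring lra zify.

Set Implicit Arguments.
Unset Strict Implicit.
Unset Printing Implicit Defensive.

Import Order.TTheory GRing.Theory Num.Theory.
Import numFieldNormedType.Exports.
Local Open Scope classical_set_scope.
Local Open Scope ring_scope.

(** Let A_j(x) be the mean of f over the dyadic cube of side 2^-(2^j) that
    contains x.  Multilinear interpolation of these means gives a continuous
    function u_j on R^d, and the height chooses the generation:

      E f (x, t) = sum_j tau_j(t) u_j(x),

    where the tau_j form a partition of unity near t = 0 and tau_j lives
    between the heights 2^-(2^(j+1)) and 2^-(2^j), up to constant factors.  One
    layer spans about 2^j dyadic scales; this is affordable because the weight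
    t^(p-1) log^lam (4/t) puts a mass of order 2^(-p 2^j) (2^j + 2)^lam, per
    unit of base volume, below the height 2^-(2^j) ([mu_strip_level]): the top
    of a layer dominates the layer.

    Boundedness.  Let g_j(x) be the l^p norm of the differences between the mean
    on the cube of x in generation 2^j and the means on its selected neighbors.
    The horizontal slope of u_j is at most a constant times 2^(2^j) g_j.
    Vertically, Abel summation turns the derivative of E f into a sum of
    cutoff'_j(t) (u_(j-1) - u_j): here cutoff'_j is of order 2^(2^j) and is
    nonzero only at the top of a layer, within a factor two, so that at most one
    term survives, and u_(j-1) - u_j is controlled by g_j and g_(j-1).  Hence
    the p-th powers of |E f| and of its gradient are bounded at each point by
    the sum, over those j for which t is below the top of layer j, of
    (|A_j| + 2^(2^j) (g_j + g_(j-1)))^p, up to a constant factor.  Integrated,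
    2^(p 2^j) g_j^p meets the mass of the strip and leaves
    (2^j + 2)^lam g_j^p, which is the j-th term of the Besov energy, while the
    |A_j|^p are controlled by Jensen's inequality and the summability of the
    masses ([major_integral], [ext_norm_le]).

    Weak gradient.  E f is locally Lipschitz and has one-sided slopes along the
    coordinate axes at every point.  For a test function phi, the product
    G = (E f) phi is Lipschitz with compact support, so by translation
    invariance its difference quotients have integral zero; dominated
    convergence passes to the limit and gives the integration by parts formula
    ([Rintegral_left_slope0], [weak_gradient_left_slope]).

    Trace.  Finite energy means that sum_j (2^j + 2)^lam g_j(x)^p is integrable
    in x.  Where it is finite, g_j(x) decays geometrically in j because lam > 0,
    so A_j(x) converges to some h(x); since E f at a point of a low Whitney
    neighborhood above x is a convex combination of means over cubes that touch
    the cubes of x, the averages which define the trace converge to h(x) as well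
    ([ext_trace]).  The same decay dominates A_j by an integrable function,
    hence h has the integral of f over every dyadic cube of generation 2^j;
    these cubes form a pi-system that generates the Borel sets, whence h = f
    almost everywhere ([local_limit_ae]). *)

(** * Dyadic cubes and Lebesgue measure on R^n *)
Section cells.
Context (R : realType) (d : nat).
Implicit Types (k : nat) (x : 'rV[R]_d) (m : 'rV[int]_d).

(** The index of the cube of generation [k] that contains [x]; the ceiling
    minus one, instead of the floor, matches cubes that are closed on the
    right.  Phrasing sums over cubes as integrals of functions of [cell k x]
    replaces double sums by integrals throughout. *)
Definition cell k x : 'rV[int]_d :=
  \row_i (Num.ceil (2 ^+ k * x ord0 i) - 1).

Lemma cubeP k m x : @cube R d k m x <->
  forall i, (m ord0 i)%:~R < 2 ^+ k * x ord0 i <= (m ord0 i)%:~R + 1.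
Proof.
have k0 : 0 < 2 ^+ k :> R by rewrite exprn_gt0.
suff E i : (2 ^ (- k%:Z) * (m ord0 i)%:~R < x ord0 i <=
    2 ^ (- k%:Z) * ((m ord0 i)%:~R + 1)) =
  ((m ord0 i)%:~R < 2 ^+ k * x ord0 i <= (m ord0 i)%:~R + 1).
  by split=> H i; have := H i; rewrite E.
have -> : (2 : R) ^ (- k%:Z) = (2 ^+ k)^-1 by rewrite -exprnN.
by rewrite mulrC ltr_pdivrMr// mulrC [in X in _ && X]mulrC ler_pdivlMr// [x _ _ * _]mulrC.
Qed.

Lemma cube_cell k x : cube k (cell k x) x.
Proof.
apply/cubeP => i; rewrite mxE.
have := ceil_itv (2 ^+ k * x ord0 i).
by rewrite !intrD !intrN /= subrK.
Qed.

Lemma cube_cellE k m x : cube k m x -> m = cell k x.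
Proof.
move=> /cubeP mx; apply/rowP => i; rewrite mxE.
have /andP[a b] := mx i.
suff -> : Num.ceil (2 ^+ k * x ord0 i) = m ord0 i + 1 by rewrite addrK.
by apply/ceil_def; rewrite addrK a intrD.
Qed.

Lemma cubeE k m : cube k m = cell k @^-1` [set m].
Proof.
apply/seteqP; split => x /=; first by move/cube_cellE.
by move=> <-; exact: cube_cell.
Qed.

Lemma cube_inj k : injective (@cube R d k).
Proof.
move=> m1 m2 E.
suff [x mx] : @cube R d k m1 !=set0.
  by rewrite (cube_cellE mx); rewrite E in mx; rewrite (cube_cellE mx).
exists (\row_i ((2 ^+ k)^-1 * ((m1 ord0 i)%:~R + 1))); apply/cubeP => i.
by rewrite mxE mulVKf ?lexx ?ltrDl ?ltr01 ?expf_neq0.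
Qed.

Lemma measurable_cube k m : measurable (@cube R d k m).
Proof.
rewrite (_ : cube _ _ = \bigcap_(i in [set: 'I_d]) ((fun x : 'rV[R]_d => 2 ^+ k * x ord0 i) @^-1`
    `](m ord0 i)%:~R, ((m ord0 i)%:~R + 1)])); last first.
  apply/seteqP; split => x /=.
    by move/cubeP => H i _; have := H i; rewrite /= in_itv.
  by move=> H; apply/cubeP => i; have := H i I; rewrite /= in_itv.
apply: fin_bigcap_measurable; first exact: finite_finset.
move=> i _; rewrite -[X in measurable X]setTI.
have : measurable_fun setT (fun x : 'rV[R]_d => 2 ^+ k * x ord0 i).
  by apply: measurable_funM => //; exact: measurable_coord.
by apply => //; exact: measurable_itv.
Qed.

Lemma measurable_bigcup_cube k (M : set 'rV[int]_d) :
  measurable (\bigcup_(m in M) @cube R d k m).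
Proof.
rewrite bigcup_mkcond; apply: countable_bigcupT_measurable => // m.
by case: ifPn => // _; exact: measurable_cube.
Qed.

(** There are countably many cubes, so a function of the cell is measurable
    whatever it is. *)
Lemma measurable_fun_cell dT (T : measurableType dT) k (c : 'rV[int]_d -> T) :
  measurable_fun setT (c \o @cell k).
Proof.
move=> _ Y mY; rewrite setTI.
rewrite (_ : _ @^-1` _ = \bigcup_(m in c @^-1` Y) @cube R d k m).
  exact: measurable_bigcup_cube.
apply/seteqP; split => [x Yx|x [m Ym /cube_cellE mx]] /=.
  by exists (cell k x) => //; exact: cube_cell.
by rewrite -mx.
Qed.

End cells.

Section snoc_facts.
Context (R : realType) (n : nat).

Lemma base_snoc (xt : 'rV[R]_n * R) : base_pt (snoc xt) = xt.1.
Proof. by apply/rowP => i; rewrite !mxE liftK. Qed.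

Lemma height_snoc (xt : 'rV[R]_n * R) : height (snoc xt) = xt.2.
Proof. by rewrite /height mxE unlift_none. Qed.

Lemma measurable_base_pt : measurable_fun setT (@base_pt R n).
Proof.
apply: measurable_fun_coordP => i.
rewrite (_ : (fun x => _) = (fun y : 'rV[R]_n.+1 => y ord0 (lift ord_max i))).
  exact: measurable_coord.
by apply/funext => y; rewrite mxE.
Qed.

Definition cyl (A : set 'rV[R]_n) (B : set R) : set 'rV[R]_n.+1 :=
  [set y | A (base_pt y) /\ B (height y)].

Lemma measurable_cyl A B : measurable A -> measurable B -> measurable (cyl A B).
Proof.
move=> mA mB; rewrite (_ : cyl A B = (@base_pt R n @^-1` A) `&` (@height R n @^-1` B)) //.
apply: measurableI; rewrite -[X in measurable X]setTI.
  exact: measurable_base_pt.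
exact: measurable_height.
Qed.

Lemma lebesgueN_cyl A B : measurable A -> measurable B ->
  lebesgueN R n.+1 (cyl A B) = (lebesgueN R n A * lebesgue_measure B)%E.
Proof.
move=> mA mB; rewrite -product_measure1E//.
rewrite /= /lebesgue_snoc /pushforward; congr (_ _).
by apply/seteqP; split => -[x t] /=; rewrite /cyl/= base_snoc height_snoc.
Qed.

End snoc_facts.

Definition box (R : realType) n (r : R) : set 'rV[R]_n :=
  [set x | forall i, `|x ord0 i| <= r].
Arguments box {R} n r.

Section lebesgueN_facts.
Context (R : realType).

(** Translating an interval keeps its length, and Lebesgue measure is
    determined by its values on intervals. *)
Lemma lebesgue_shift (s : R) (Y : set R) : measurable Y ->
  lebesgue_measure ((fun t => t + s) @^-1` Y) = lebesgue_measure Y.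
Proof.
move=> mY.
have ms : measurable_fun setT (fun t : measurableTypeR R => (t + s) : measurableTypeR R).
  exact: measurable_funD.
apply/esym.
rewrite -[RHS]/(pushforward lebesgue_measure (fun t : measurableTypeR R => (t + s) : measurableTypeR R) Y).
pose M : {measure set (measurableTypeR R) -> \bar R} :=
  measure_function_pushforward__canonical__measure_function_Measure lebesgue_measure ms.
rewrite -[RHS]/(M Y).
apply: lebesgue_measure_unique => // X [[a b] _ <-] /=.
rewrite /pushforward.
rewrite (_ : _ @^-1` _ = `]a - s, b - s]%classic); last first.
  by apply/seteqP; split => t /=; rewrite !in_itv/= ltrBlDr lerBrDr.
rewrite !lebesgue_measure_itv/= !lte_fin ltrD2r.
by case: ifP => // _; rewrite !EFinN -!EFinB; congr EFin; ring.
Qed.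

(** By induction on the dimension: translate the sections by the invariance in
    dimension one, then the base. *)
Lemma lebesgueN_shift n (c : 'rV[R]_n) (A : set 'rV[R]_n) : measurable A ->
  lebesgueN R n ((fun x => x + c) @^-1` A) = lebesgueN R n A.
Proof.
elim: n c A => [|n IH] c A mA.
  congr (_ _); apply/seteqP; split => x /=; by rewrite [x + c]thinmx0 [x]thinmx0.
rewrite /= /lebesgue_snoc /pushforward /product_measure1 /=.
set c' := base_pt c; pose sh (x : 'rV[R]_n) := x + c'.
have mS : measurable (@snoc R n @^-1` A).
  by rewrite -[X in measurable X]setTI; exact: measurable_snoc.
have mh : measurable_fun setT (fun x : 'rV[R]_n => lebesgue_measure (xsection (@snoc R n @^-1` A) x)).
  exact: measurable_fun_xsection.
transitivity (\int[lebesgueN R n]_x lebesgue_measure (xsection (@snoc R n @^-1` A) (sh x)))%E.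
  apply: eq_integral => x _.
  rewrite -(lebesgue_shift (height c) (measurable_xsection (sh x) mS)).
  congr (_ _); apply/seteqP; split => t; rewrite /= !xsectionE /=.
    suff -> : snoc (x, t) + c = snoc (x + c', t + height c) by [].
    apply/rowP => i; rewrite !mxE; case: unliftP => [j|] ->; rewrite ?mxE//.
  suff -> : snoc (x, t) + c = snoc (x + c', t + height c) by [].
  apply/rowP => i; rewrite !mxE; case: unliftP => [j|] ->; rewrite ?mxE//.
have mc : measurable_fun setT sh.
  apply: measurable_fun_coordP => i.
  rewrite (_ : (fun x => _) = (fun y : 'rV[R]_n => y ord0 i + c' ord0 i)).
    by apply: measurable_funD => //; exact: measurable_coord.
  by apply/funext => y; rewrite mxE.
have := @ge0_integral_pushforward _ _ _ _ R _ mc (lebesgueN R n) setT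
   (fun x : 'rV[R]_n => lebesgue_measure (xsection (@snoc R n @^-1` A) x)) measurableT mh.
rewrite preimage_setT => <-; last by move=> y _; exact: measure_ge0.
apply: eq_measure_integral => B mB _.
exact: IH.
Qed.

Lemma cube_cyl n (k : nat) (m : 'rV[int]_n.+1) : cube k m =
  cyl (@cube R n k (\row_i m ord0 (lift ord_max i)))
   `](2 ^+ k)^-1 * (m ord0 ord_max)%:~R, (2 ^+ k)^-1 * ((m ord0 ord_max)%:~R + 1)].
Proof.
have k0 : 0 < 2 ^+ k :> R by rewrite exprn_gt0.
have E (y : R) (j : int) : ((2 ^+ k)^-1 * j%:~R < y <= (2 ^+ k)^-1 * (j%:~R + 1)) =
   (j%:~R < 2 ^+ k * y <= j%:~R + 1).
  by rewrite !ler_pdivlMl// !ltr_pdivrMl// ler_pdivlMl.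
apply/seteqP; split => y.
  move=> /cubeP my; split.
    by apply/cubeP => i; rewrite !mxE; exact: my.
  by rewrite /= in_itv /= E; exact: my.
move=> -[/= /cubeP H1]; rewrite /= in_itv/= E => H2; apply/cubeP => i.
case: (unliftP ord_max i) => [j|] ->; last exact: H2.
by have := H1 j; rewrite !mxE.
Qed.

Lemma lebesgueN_cube n (k : nat) m : lebesgueN R n (cube k m) = (((2 ^+ k)^-1) ^+ n)%:E.
Proof.
elim: n m => [|n IH] m.
  rewrite /= diracE expr0 mem_set// => i; by case: i.
rewrite cube_cyl lebesgueN_cyl//; last exact: measurable_cube.
rewrite IH lebesgue_measure_itv/= lte_fin.
have k0 : 0 < (2 ^+ k)^-1 :> R by rewrite invr_gt0 exprn_gt0.
rewrite ltr_pM2l// ltrDl ltr01 -EFinD -EFinM exprSr; congr (_ * _)%:E.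
by rewrite mulrDr mulr1 addrC addKr.
Qed.

Lemma lebesgueN_cube_gt0 n (k : nat) m : (0 < fine (lebesgueN R n (cube k m)))%R.
Proof. by rewrite lebesgueN_cube/= exprn_gt0// invr_gt0 exprn_gt0. Qed.

Lemma box_cyl n (r : R) : box n.+1 r = cyl (box n r) `[- r, r].
Proof.
apply/seteqP; split => y.
  move=> H; split; first by move=> i; rewrite mxE.
  by rewrite /= in_itv/= -ler_norml; exact: H.
move=> [H]; rewrite /= in_itv/= -ler_norml => H2 i.
case: (unliftP ord_max i) => [j|] ->//; by have := H j; rewrite mxE.
Qed.

Lemma measurable_box n (r : R) : measurable (box n r).
Proof.
elim: n => [|n IH]; last by rewrite box_cyl; apply: measurable_cyl.
rewrite (_ : box 0 r = setT)//.
by apply/seteqP; split => // x _ i; case: i.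
Qed.

Lemma lebesgueN_box n (r : R) : (lebesgueN R n (box n r) < +oo)%E.
Proof.
elim: n => [|n IH]; first by rewrite /= diracE ltry.
rewrite box_cyl lebesgueN_cyl//; last exact: measurable_box.
apply: lte_mul_pinfty => //; first by rewrite fin_num_abs gee0_abs.
by rewrite lebesgue_measure_itv/=; case: ifP => _; rewrite ?ltry// -EFinD ltry.
Qed.
End lebesgueN_facts.

Section open_sets.
Context (R : realType).

Lemma lt_expr2 (e : R) : 0 < e -> exists N, forall k, (N <= k)%N -> (2 ^+ k)^-1 < e.
Proof.
move=> e0; exists (Num.truncn e^-1) => k Nk.
rewrite invf_plt ?posrE ?exprn_gt0//.
apply: (lt_le_trans (truncnS_gt _)).
rewrite (@le_trans _ _ k.+1%:R)// ?ler_nat//.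
by rewrite -natrX ler_nat ltn_expl.
Qed.

Lemma leq_pow22 j : (j <= 2 ^ j)%N. Proof. by rewrite ltnW// ltn_expl. Qed.

Lemma lt_expr22 (e : R) : 0 < e -> exists N, forall j, (N <= j)%N -> (2 ^+ (2 ^ j))^-1 < e.
Proof.
move=> /lt_expr2[N HN]; exists N => j Nj; apply: HN.
exact: leq_trans (leq_pow22 j).
Qed.

Lemma cube_close n (k : nat) m (x y : 'rV[R]_n) : cube k m x -> cube k m y ->
  forall i, `|x ord0 i - y ord0 i| < (2 ^+ k)^-1.
Proof.
move=> /cubeP Hx /cubeP Hy i; have /andP[a b] := Hx i; have /andP[a' b'] := Hy i.
have k0 : 0 < 2 ^+ k :> R by rewrite exprn_gt0.
rewrite -[X in _ < X]mul1r ltr_pdivlMr//.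
rewrite -[X in `|_| * X](gtr0_norm k0) -normrM ltr_norml mulrBl ![_ * 2 ^+ k]mulrC.
by apply/andP; split; lra.
Qed.

Lemma ball_rV n (x y : 'rV[R]_n) e : 0 < e ->
  (forall i, `|x ord0 i - y ord0 i| < e) -> ball x e y.
Proof. by move=> e0 H; split=> // i j; rewrite !ord1; exact: H. Qed.

(** The generations 2^j suffice because their sides tend to 0; they are the
    ones that occur in the Besov energy. *)
Lemma open_bigcup_cube n (U : set 'rV[R]_n) : open U ->
  U = \bigcup_j \bigcup_(m in [set m | cube (2 ^ j)%N m `<=` U]) cube (2 ^ j)%N m.
Proof.
move=> oU; apply/seteqP; split => [x Ux|x [j _ [m mU mx]]]; last exact: mU.
have /nbhs_ballP[e /= e0 eU] : nbhs x U by exact: open_nbhs_nbhs.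
have [N HN] := lt_expr22 e0.
exists N => //; exists (cell (2 ^ N) x); last exact: cube_cell.
move=> y Ny; apply: eU; apply: ball_rV => // i.
apply: lt_trans (HN _ (leqnn N)).
exact: (cube_close (@cube_cell R n (2 ^ N) x) Ny).
Qed.

Lemma measurable_open_rV n (U : set 'rV[R]_n) : open U -> measurable U.
Proof.
move=> oU; rewrite (open_bigcup_cube oU); apply: bigcupT_measurable => j.
exact: measurable_bigcup_cube.
Qed.

Lemma measurable_closed_rV n (U : set 'rV[R]_n) : closed U -> measurable U.
Proof.
move=> cU; rewrite -[U]setCK; apply: measurableC; apply: measurable_open_rV.
by rewrite openC.
Qed.

Lemma measurable_compact_rV n (K : set 'rV[R]_n) : compact K -> measurable K.
Proof.
move=> cK; apply: measurable_closed_rV; exact: compact_closed.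
Qed.

Lemma compact_box n (K : set 'rV[R]_n) : compact K ->
  exists2 r : R, 0 < r & K `<=` box n r.
Proof.
move=> /compact_bounded[M [Mr HM]].
exists (`|M| + 1); first by rewrite ltr_wpDl.
have {}HM := HM (`|M| + 1) (ltr_pwDr ltr01 (ler_norm _)).
move=> x Kx i; apply: le_trans (HM x Kx).
rewrite [leRHS]mx_normrE.
exact: (le_bigmax _ (fun ij : 'I_1 * 'I_n => `|x ij.1 ij.2|) (ord0, i)).
Qed.

Lemma coord_rV_continuous n (i : 'I_n) : continuous (fun x : 'rV[R]_n => x ord0 i).
Proof. exact: coord_continuous. Qed.

(** The empty set is included to make the family stable under
    intersection. *)
Definition dycubes n : set (set 'rV[R]_n) :=
  set0 |` [set Q | exists j, @dyadic R n (2 ^ j)%N Q].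

Lemma measurable_dycubes n : @measurable _ 'rV[R]_n = <<s @dycubes n >>.
Proof.
apply/seteqP; split.
  pose T : measurableType _ := g_sigma_algebraType (@dycubes n).
  apply: smallest_sub; first exact: smallest_sigma_algebra.
  rewrite -bigcup_seq => A [i _ [B mB <-]]; rewrite setTI.
  suff : measurable_fun setT ((fun x : 'rV[R]_n => x ord0 i) : T -> R).
    by move=> /(_ measurableT _ mB); rewrite setTI.
  apply: (measurability _ (RGenOInfty.measurableE R)) => // _ [_ [a ->] <-].
  rewrite setTI.
  have oU : open ((fun x : 'rV[R]_n => x ord0 i) @^-1` `]a, +oo[%classic).
    apply: open_comp; last exact: interval_open.
    by move=> x _; exact: coord_continuous.
  rewrite (open_bigcup_cube oU).
  apply: bigcupT_measurable => j; rewrite bigcup_mkcond.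
  apply: countable_bigcupT_measurable => // m.
  case: ifPn => // _; apply: sub_sigma_algebra; right; exists j; by exists m.
apply: smallest_sub; first exact: sigma_algebra_measurable.
by move=> _ [->//|[j [m _ <-]]]; exact: measurable_cube.
Qed.

End open_sets.

(** * Integration along a countable partition *)
Section countable_partition.
Local Open Scope ereal_scope.
Context dT (T : measurableType dT) (R : realType).
Variables (mu : {measure set T -> \bar R}) (I : countType) (pi : T -> I).
Hypothesis mpi : forall i, measurable (pi @^-1` [set i]).

Lemma ge0_integral_fibres (D : set T) (f : T -> \bar R) :
  measurable D -> measurable_fun D f -> (forall x, D x -> 0 <= f x) ->
  \int[mu]_(x in D) f x = \esum_(i in setT) \int[mu]_(x in D `&` pi @^-1` [set i]) f x.
Proof.
move=> mD mf f0.
pose F n := if @pickle_inv I n is Some i then D `&` pi @^-1` [set i] else set0.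
have DF : D = \bigcup_n F n.
  apply/seteqP; split => [x Dx|x [n _]]; last by rewrite /F; case: pickle_inv => // i [].
  by exists (pickle (pi x)) => //; rewrite /F pickleK_inv.
have mF n : measurable (F n).
  by rewrite /F; case: pickle_inv => // i; exact: measurableI.
rewrite [in LHS]DF ge0_integral_bigcup//; last 3 first.
- by rewrite -DF.
- by rewrite -DF.
- move=> n1 n2 _ _ [x []]; rewrite /F.
  have := @pickle_invK I n1; have := @pickle_invK I n2.
  case: (pickle_inv n2) => [i2|//] /= <-; case: (pickle_inv n1) => [i1|//] /= <-.
  by move=> [_ /= <-] [_ /= <-].
rewrite nneseries_esumT; last first.
  move=> n; apply: integral_ge0 => x; rewrite /F; case: pickle_inv => // i [Dx _]; exact: f0.
transitivity (\esum_(n in [set pickle i | i in [set: I]]) \int[mu]_(x in F n) f x).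
  rewrite [RHS]esum_mkcond; apply: eq_esum => n _; case: ifPn => // /negP nI.
  rewrite /F; case E : pickle_inv => [i|]; last by rewrite integral_set0.
  by exfalso; apply: nI; rewrite inE; exists i => //; have := @pickle_invK I n; rewrite E.
rewrite esum_image; last by move=> a b _ _ /(pcan_inj pickleK).
by apply: eq_esum => i _; rewrite /F pickleK_inv.
Qed.

Lemma ge0_integral_step (D : set T) (c : I -> \bar R) :
  measurable D -> (forall i, 0 <= c i) ->
  \int[mu]_(x in D) c (pi x) = \esum_(i in setT) (c i * mu (D `&` pi @^-1` [set i])).
Proof.
move=> mD c0; rewrite ge0_integral_fibres//.
  apply: eq_esum => i _; rewrite -integral_cst//; last exact: measurableI.
  by apply: eq_integral => x; rewrite inE => -[_ /= ->].
apply: measurable_funTS => _ Y mY; rewrite setTI.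
rewrite (_ : _ @^-1` _ = \bigcup_(i in c @^-1` Y) pi @^-1` [set i]); last first.
  apply/seteqP; split => [x Yx|x [i + /= pix]]; first by exists (pi x).
  by rewrite /= -pix.
by rewrite bigcup_mkcond; apply: countable_bigcupT_measurable => // i; case: ifP.
Qed.

End countable_partition.

(** * Integrals of one-sided slopes *)
Section left_slope.
Context (R : realType) (n : nat).
Implicit Types (G D : 'rV[R]_n -> R) (e : 'rV[R]_n).

Lemma measurable_shift (c : 'rV[R]_n) : measurable_fun setT (fun x : 'rV[R]_n => x + c).
Proof.
apply: measurable_fun_coordP => i.
rewrite (_ : (fun x => _) = (fun y : 'rV[R]_n => y ord0 i + c ord0 i)).
  by apply: measurable_funD => //; exact: measurable_coord.
by apply/funext => y; rewrite mxE.
Qed.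

Lemma integrable_shift (c : 'rV[R]_n) G :
  (lebesgueN R n).-integrable setT (EFin \o G) ->
  (lebesgueN R n).-integrable setT (EFin \o (fun x => G (x + c))).
Proof.
move=> iG; have mG : measurable_fun setT (EFin \o G) := measurable_int _ iG.
apply/integrableP; split.
  exact: (measurableT_comp mG (measurable_shift c)).
have /integrableP[_] := iG; apply: le_lt_trans.
rewrite le_eqVlt; apply/orP; left; apply/eqP.
have := @ge0_integral_pushforward _ _ _ _ R _ (measurable_shift c) (lebesgueN R n) setT
   (fun x => `|(EFin \o G) x|%E) measurableT.
rewrite preimage_setT => <-//; last exact: measurableT_comp.
apply: eq_measure_integral; first exact: measurable_shift.
by move=> msh B mB _; exact: (lebesgueN_shift c mB).
Qed.

Lemma Rintegral_shift (c : 'rV[R]_n) G :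
  (lebesgueN R n).-integrable setT (EFin \o G) ->
  \int[lebesgueN R n]_x G (x + c) = \int[lebesgueN R n]_x G x.
Proof.
move=> iG; have mG : measurable_fun setT (EFin \o G) := measurable_int _ iG.
rewrite /Rintegral; congr fine.
have := @integral_pushforward _ _ _ _ R _ (measurable_shift c) (lebesgueN R n) setT
   (EFin \o G) mG.
rewrite preimage_setT => <- //; last exact: integrable_shift.
apply: eq_measure_integral; first exact: measurable_shift.
by move=> msh B mB _; exact: (lebesgueN_shift c mB).
Qed.

Lemma integrable_cst_box (r L : R) :
  (lebesgueN R n).-integrable setT (fun x => (L * \1_(box n r) x)%:E).
Proof.
have mb := @measurable_box R n r.
rewrite (_ : (fun x => _) = (fun x => L%:E * (\1_(box n r) x)%:E)%E); last first.
  by apply/funext => x; rewrite EFinM.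
apply: integrableZl => //; apply/integrableP; split.
  by apply/measurable_EFinP; exact: measurable_indic.
under eq_integral do rewrite gee0_abs ?lee_fin//.
rewrite integral_indic// setIT; exact: lebesgueN_box.
Qed.

(** Integration by parts in embryo: by translation invariance each difference
    quotient of [G] has integral 0, and the Lipschitz bound together with the
    bounded support of [G] lets dominated convergence reach the slope [D]. *)
Lemma Rintegral_left_slope0 e G D (h0 L r : R) :
  (lebesgueN R n).-integrable setT (EFin \o G) -> 0 < h0 ->
  (forall i, `|e ord0 i| <= 1) ->
  (forall y (h : R), 0 < h <= h0 -> `|G y - G (y - h *: e)| <= L * h) ->
  (forall y, G y != 0 -> box n r y) ->
  (forall y, (fun k => k.+1%:R * (G y - G (y - k.+1%:R^-1 *: e))) @ \oo --> D y) ->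
  (lebesgueN R n).-integrable setT (EFin \o D) /\ \int[lebesgueN R n]_x D x = 0.
Proof.
move=> iG h00 e1 Glip Gbox GD.
have mG : measurable_fun setT G by apply/measurable_EFinP; exact: measurable_int iG.
pose f k (y : 'rV[R]_n) := k.+1%:R * (G y - G (y - k.+1%:R^-1 *: e)).
have mf k : measurable_fun setT (f k).
  apply: measurable_funM => //; apply: measurable_funB => //.
  exact: (measurableT_comp mG (measurable_shift _)).
have f0 k : \int[lebesgueN R n]_x f k x = 0.
  rewrite /f RintegralZl//; last first.
    apply: (integrableB measurableT iG (integrable_shift (- (k.+1%:R^-1 *: e)) iG)).
  rewrite RintegralB//; last exact: integrable_shift.
  by rewrite Rintegral_shift// subrr mulr0.
have [N HN] : exists N, forall k, (N <= k)%N -> k.+1%:R^-1 <= h0.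
  exists (Num.truncn h0^-1) => k Nk.
  rewrite invf_ple ?posrE//; apply: ltW; apply: (lt_le_trans (truncnS_gt _)).
  by rewrite ler_nat.
have bf k y : `|f (k + N)%N y| <= L * \1_(box n (r + h0)) y.
  have k0 : 0 < (k + N).+1%:R :> R by [].
  have hk : (k + N).+1%:R^-1 <= h0 by apply: HN; rewrite leq_addl.
  have L0 : 0 <= L.
    rewrite -(pmulr_lge0 _ h00); apply: le_trans (Glip y h0 _); first exact: normr_ge0.
    by rewrite h00 lexx.
  rewrite indicE; case: (boolP (y \in _)) => [_|/negP yb]; rewrite ?mulr1 ?mulr0.
    rewrite /f normrM gtr0_norm// -ler_pdivlMl// mulrC.
    by apply: Glip; rewrite invr_gt0 k0.
  have nb : ~ box n (r + h0) y by move=> H; apply: yb; rewrite inE.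
  rewrite /f; have -> : G y = 0.
    apply/eqP/negPn/negP => /Gbox H; apply: nb => i.
    by apply: le_trans (H i) _; rewrite lerDl ltW.
  have -> : G (y - (k + N).+1%:R^-1 *: e) = 0.
    apply/eqP/negPn/negP => /Gbox H; apply: nb => i.
    have := H i; rewrite !mxE => Hi.
    have -> : y ord0 i = y ord0 i - (k + N).+1%:R^-1 * e ord0 i + (k + N).+1%:R^-1 * e ord0 i.
      by rewrite subrK.
    apply: le_trans (ler_normD _ _) _; apply: lerD => //.
    rewrite normrM gtr0_norm ?invr_gt0//.
    apply: le_trans hk; rewrite ler_piMr// ltW// invr_gt0//.
  by rewrite subrr mulr0 normr0.
have cvf y : (fun k => (f (k + N)%N y)%:E) @ \oo --> (D y)%:E.
  apply: cvg_EFin; first exact: nearW.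
  by move: (GD y); rewrite -(cvg_shiftn N).
have := @dominated_convergence _ _ R (lebesgueN R n) setT measurableT
  (fun k y => (f (k + N)%N y)%:E) (EFin \o D) (fun x => (L * \1_(box n (r + h0)) x)%:E).
case.
- by move=> k; apply/measurable_EFinP.
- apply/measurable_EFinP; apply: (@measurable_fun_cvg _ _ _ setT (fun k y => f (k + N)%N y) D) => //.
  by move=> y _; move: (GD y); rewrite -(cvg_shiftn N).
- by apply: aeW => y _; exact: cvf.
- exact: integrable_cst_box.
- by apply: aeW => y k _; rewrite abse_EFin lee_fin; exact: bf.
move=> iD _ cD; split => //.
have E : (fun k => \int[lebesgueN R n]_x (f (k + N)%N x)%:E)%E = cst 0%E.
  apply/funext => k /=.
  have ik : (lebesgueN R n).-integrable setT (EFin \o f (k + N)%N).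
    apply: (le_integrable measurableT _ _ (integrable_cst_box (r + h0) L)).
      by apply/measurable_EFinP.
    move=> y _; rewrite !abse_EFin lee_fin.
    exact: le_trans (bf k y) (ler_norm _).
  by rewrite -(fineK (integrable_fin_num measurableT ik)) -/(Rintegral _ _ _) f0.
have : (fun k => \int[lebesgueN R n]_x (f (k + N)%N x)%:E)%E @ \oo --> (\int[lebesgueN R n]_x (D x)%:E)%E by [].
rewrite E => /cvg_lim; rewrite lim_cst// => H.
by rewrite /Rintegral -H.
Qed.

End left_slope.

(** * Weak gradients from one-sided slopes *)
Section test_functions.
Context (R : realType) (n : nat).
Implicit Types (f phi : 'rV[R]_n -> R) (y e : 'rV[R]_n).

Lemma measurable_continuous_rV f : continuous f -> measurable_fun setT f.
Proof.
move=> cf; apply: (measurability _ (RGenOInfty.measurableE R)) => // _ [_ [a ->] <-].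
rewrite setTI; apply: measurable_open_rV; apply: open_comp; last exact: interval_open.
by move=> x _; exact: cf.
Qed.

Lemma compact_bounded_fun f (K : set 'rV[R]_n) : compact K -> continuous f ->
  exists M : R, 0 <= M /\ forall y, K y -> `|f y| <= M.
Proof.
move=> cK cf; have [K0|K0] := pselect (K !=set0); last first.
  by exists 0; split => // y Ky; exfalso; apply: K0; exists y.
have cn : {within K, continuous (fun y => `|f y|)}.
  by apply: continuous_subspaceT => y; apply: continuous_comp; [exact: cf|exact: norm_continuous].
have [c cKc Hc] := compact_EVT_max K0 cK cn.
by exists `|f c|; split=> // y Ky; apply: Hc; rewrite inE.
Qed.

(** The left difference quotients tend to the directional derivative itself,
    since (f y - f (y - h e)) / h is the quotient of step -h. *)
Lemma left_slope_derive f y e : derivable f y e ->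
  (fun k => k.+1%:R * (f y - f (y - k.+1%:R^-1 *: e))) @ \oo --> 'D_e f y.
Proof.
move=> df; have /cvgr_dnbhsP/(_ (fun k => - k.+1%:R^-1)) H :
  (fun h : R => h^-1 *: ((f \o shift y) (h *: e) - f y)) @ 0^' --> 'D_e f y by exact: df.
have : (fun k : nat => (- k.+1%:R^-1)^-1 *: ((f \o shift y) ((- k.+1%:R^-1) *: e) - f y)) @ \oo --> 'D_e f y.
  apply: H; split => [k|]; first by rewrite oppr_eq0 invr_eq0.
  rewrite -[X in _ --> X]oppr0; apply: cvgN; exact: cvg_harmonic.
apply: cvg_trans; apply: near_eq_cvg; apply: nearW => k /=.
by rewrite invrN invrK [LHS]mulNr -mulrN opprB scaleNr [- _ + y]addrC.
Qed.

Lemma derive_lipschitz f e (M : R) : (forall y, derivable f y e) ->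
  (forall y, `|'D_e f y| <= M) ->
  forall y (h : R), 0 < h -> `|f y - f (y - h *: e)| <= M * h.
Proof.
move=> df bM y h h0.
pose psi (s : R) := f ((y - h *: e) + s *: e).
have dpsi (s : R) : is_derive s 1 psi ('D_e f ((y - h *: e) + s *: e)).
  have E : (fun r : R => r^-1 *: ((psi \o shift s) (r *: 1) - psi s)) =
           (fun r : R => r^-1 *: ((f \o shift (y - h *: e + s *: e)) (r *: e) - f (y - h *: e + s *: e))).
    apply/funext => r; rewrite /psi/= /shift/=; congr (_ *: (f _ - _)).
    have -> : r%:A = r :> R by rewrite [LHS]mulr1.
    by rewrite scalerDl addrCA.
  by apply: DeriveDef; rewrite /derivable /derive E//; exact: df.
have [c _] : exists2 c, c \in `]0, h[%R &
    psi h - psi 0 = 'D_e f ((y - h *: e) + c *: e) * (h - 0).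
  apply: (@MVT _ psi (fun s => 'D_e f ((y - h *: e) + s *: e))) => //.
  apply: derivable_within_continuous => x _.
  by have [] := dpsi x.
rewrite /psi subrK scale0r addr0 subr0 => ->.
by rewrite normrM (gtr0_norm h0) ler_wpM2r// ltW.
Qed.

Section one_test.
Variables (D : set 'rV[R]_n) (phi : 'rV[R]_n -> R).
Hypothesis tphi : test_function D phi.
Let K := closure [set x | phi x != 0].

Lemma test_continuous : continuous phi. Proof. by have [/(_ 0%N)] := tphi. Qed.

Lemma test_derivable y e : derivable phi y e.
Proof. by have [/(_ 1%N)[dphi _] _] := tphi; apply: diff_derivable. Qed.

Lemma test_derive_continuous e : continuous (fun y => 'D_e phi y).
Proof. by have [/(_ 1%N)[_ /(_ e)]] := tphi. Qed.

Lemma test_compact : compact K. Proof. by have [_ []] := tphi. Qed.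
Lemma test_sub : K `<=` D. Proof. by have [_ []] := tphi. Qed.

Lemma test_supp y : ~ K y -> phi y = 0.
Proof.
by move=> nK; apply/eqP/negPn/negP => p0; apply: nK; exact: subset_closure.
Qed.

Lemma test_derive_supp e y : ~ K y -> 'D_e phi y = 0.
Proof.
move=> nK; rewrite (@near_eq_derive _ _ _ phi (cst 0)) ?derive_cst//.
have : nbhs y (~` K).
  by apply: open_nbhs_nbhs; split => //; apply: closed_openC; exact: closed_closure.
by apply: filterS => x; exact: test_supp.
Qed.

Lemma test_bounded : exists M : R, 0 <= M /\ forall y, `|phi y| <= M.
Proof.
have [M [M0 HM]] := compact_bounded_fun test_compact test_continuous.
exists M; split => // y; have [/HM//|/test_supp->] := pselect (K y).
by rewrite normr0.
Qed.

Lemma test_derive_bounded e : exists M : R, 0 <= M /\ forall y, `|'D_e phi y| <= M.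
Proof.
have [M [M0 HM]] := compact_bounded_fun test_compact (@test_derive_continuous e).
exists M; split => // y; have [/HM//|/test_derive_supp->] := pselect (K y).
by rewrite normr0.
Qed.

End one_test.
End test_functions.

Section weak_gradient_left_slope.
Context (R : realType) (d : nat).
Local Notation H := (@halfspace R d).
Local Notation e_ i := (delta_mx ord0 i : 'rV[R]_d.+1).

Lemma compact_height (K : set 'rV[R]_d.+1) : compact K -> K `<=` H ->
  exists2 eps : R, 0 < eps & forall y, K y -> eps <= height y.
Proof.
move=> cK KH; have [K0|K0] := pselect (K !=set0); last first.
  by exists 1 => // y Ky; exfalso; apply: K0; exists y.
have ch : {within K, continuous (@height R d)}.
  by apply: continuous_subspaceT => y; exact: coord_continuous.
have [c cKc Hc] := compact_EVT_min K0 cK ch.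
exists (height c); first by apply: KH; rewrite inE in cKc.
by move=> y Ky; apply: Hc; rewrite inE.
Qed.

Variables (F : 'rV[R]_d.+1 -> R) (g : 'rV[R]_d.+1 -> 'rV[R]_d.+1).
Hypothesis mF : measurable_fun setT F.
Hypothesis F0 : forall y, ~ H y -> F y = 0.
Hypothesis Floc : forall eps r : R, 0 < eps -> 0 < r -> exists L : R, forall y, box d.+1 r y ->
  eps <= height y -> `|F y| <= L /\
  forall (i : 'I_d.+1) (h : R), 0 < h <= eps / 2 -> `|F y - F (y - h *: e_ i)| <= L * h.
Hypothesis Fg : forall y, H y -> forall i,
  (fun k => k.+1%:R * (F y - F (y - k.+1%:R^-1 *: e_ i))) @ \oo --> g y ord0 i.

Lemma delta_le1 (i j : 'I_d.+1) : `|e_ i ord0 j| <= 1.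
Proof. by rewrite mxE/= normr_nat; case: eqP; rewrite /= ?lexx ?ler01. Qed.

Lemma height_shift y h i : height y - `|h| <= height (y - h *: e_ i).
Proof.
rewrite /height !mxE/= lerD2l lerN2; apply: le_trans (ler_norm _) _.
by rewrite normrM ler_piMr// normr_nat; case: (_ == _); rewrite /= ?lexx ?ler01.
Qed.

Lemma measurable_left_slope i : measurable_fun H (fun y => g y ord0 i).
Proof.
apply: (@measurable_fun_cvg _ _ _ H
  (fun k y => k.+1%:R * (F y - F (y - k.+1%:R^-1 *: e_ i)))).
  move=> k; apply: measurable_funTS.
  apply: measurable_funM => //; apply: measurable_funB => //.
  exact: (measurableT_comp mF (measurable_shift _)).
by move=> y Hy; exact: Fg.
Qed.

Lemma left_slope_loc_bounded (eps r : R) : 0 < eps -> 0 < r -> exists L : R, forall y, box d.+1 r y ->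
  eps <= height y -> `|F y| <= L /\ forall i, `|g y ord0 i| <= L.
Proof.
move=> e0 r0; have [L HL] := Floc e0 r0; exists L => y yr ye.
have [Fy Fh] := HL y yr ye; split => // i.
have Hy : H y by rewrite /halfspace /=; exact: lt_le_trans ye.
have C := cvg_norm (@Fg y Hy i); refine (cvgr_to_le (C _) _).
near=> k.
rewrite normrM ger0_norm// -ler_pdivlMl// mulrC; apply: Fh.
rewrite invr_gt0 ltr0Sn/=.
near: k; exists (Num.truncn (eps / 2)^-1) => // k /= Nk.
rewrite invf_ple ?posrE ?divr_gt0//; apply: ltW; apply: (lt_le_trans (truncnS_gt _)).
by rewrite ler_nat.
Unshelve. all: by end_near. Qed.

Lemma loc_bounded_integrable (u : 'rV[R]_d.+1 -> R) : measurable_fun H u ->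
  (forall eps r : R, 0 < eps -> 0 < r -> exists L : R, forall y, box d.+1 r y ->
    eps <= height y -> `|u y| <= L) -> loc_integrable H u.
Proof.
move=> mu bu; split => // K cK KH.
have [r r0 Kr] := compact_box cK; have [eps e0 Ke] := compact_height cK KH.
have [L HL] := bu _ _ e0 r0.
have mK := measurable_compact_rV cK.
apply: (@le_integrable _ _ _ _ _ mK _ (fun y => (L * \1_(box d.+1 r) y)%:E)).
- by apply/measurable_EFinP; exact: (measurable_funS (@measurable_halfspace R d) KH mu).
- move=> y Ky; rewrite !abse_EFin lee_fin indicE mem_set ?mulr1; last exact: Kr.
  by apply: le_trans (ler_norm _); apply: HL; [exact: Kr|exact: Ke].
- by apply: integrableS (integrable_cst_box _ r L).
Qed.

(** Apply [Rintegral_left_slope0] to F phi, whose left slope is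
    F phi' + g phi by the Leibniz rule.  The height is bounded below on the
    support of phi, a compact subset of the half-space, so the local bounds
    [Floc] make F phi Lipschitz. *)
Lemma weak_gradient_left_slope : loc_integrable H F /\ weak_gradient H F g.
Proof.
split.
  apply: loc_bounded_integrable; first exact: measurable_funTS.
  by move=> eps r e0 r0; have [L HL] := Floc e0 r0; exists L => y yr ye; have [] := HL y yr ye.
split.
  move=> i; apply: loc_bounded_integrable; first exact: measurable_left_slope.
  move=> eps r e0 r0; have [L HL] := left_slope_loc_bounded e0 r0.
  by exists L => y yr ye; have [_ /(_ i)] := HL y yr ye.
move=> phi tphi i.
set K := closure [set x | phi x != 0].
have cK : compact K := test_compact tphi.
have KH : K `<=` H := test_sub tphi.
have [r r0 Kr] := compact_box cK; have [eps e0 Ke] := compact_height cK KH.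
have [M [M0 HM]] := test_bounded tphi.
have [M' [M'0 HM']] := test_derive_bounded tphi (e_ i).
have Dphi := derive_lipschitz (fun y => @test_derivable R d.+1 H phi tphi y (e_ i)) HM'.
have mphi : measurable_fun setT phi.
  by apply: measurable_continuous_rV; exact: test_continuous tphi.
have mdphi : measurable_fun setT (fun y => 'D_(e_ i) phi y).
  by apply: measurable_continuous_rV; exact: (@test_derive_continuous R d.+1 H phi tphi (e_ i)).
have mH := @measurable_halfspace R d.
have [L HL] := @left_slope_loc_bounded eps r e0 r0.
(* F vanishes off the half-space, but g need not, hence the case split in B *)
pose A y := F y * 'D_(e_ i) phi y.
pose B y := if height y > 0 then g y ord0 i * phi y else 0.
pose G y := F y * phi y.
have KG y : G y != 0 -> K y.
  by move=> Gy; apply: contrapT => /test_supp p0; move: Gy; rewrite /G p0 mulr0 eqxx.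
have intbox (u : 'rV[R]_d.+1 -> R) (C : R) : measurable_fun setT u -> (forall y, ~ K y -> u y = 0) ->
    (forall y, K y -> `|u y| <= C) -> (lebesgueN R d.+1).-integrable setT (EFin \o u).
  move=> mu u0 uC.
  apply: (le_integrable measurableT _ _ (integrable_cst_box d.+1 r C)).
    exact/measurable_EFinP.
  move=> y _; rewrite !abse_EFin lee_fin indicE.
  have [Ky|nK] := pselect (K y); last by rewrite u0// normr0.
  rewrite mem_set ?mulr1; last exact: Kr.
  by apply: le_trans (ler_norm _); exact: uC.
have iG : (lebesgueN R d.+1).-integrable setT (EFin \o G).
  apply: (intbox _ (L * M)); first exact: measurable_funM.
    by move=> y /test_supp p0; rewrite /G p0 mulr0.
  move=> y Ky; rewrite /G normrM ler_pM//.
  by have [] := HL y (Kr _ Ky) (Ke _ Ky).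
have iA : (lebesgueN R d.+1).-integrable setT (EFin \o A).
  apply: (intbox _ (L * M')); first exact: measurable_funM.
    by move=> y /test_derive_supp p0; rewrite /A p0 mulr0.
  move=> y Ky; rewrite /A normrM ler_pM//.
  by have [] := HL y (Kr _ Ky) (Ke _ Ky).
have mB : measurable_fun setT B.
  have -> : B = (fun y => g y ord0 i * phi y) \_ H.
    apply/funext => y; rewrite /B patchE; case: ifPn => h0.
      by rewrite mem_set.
    by rewrite memNset//; apply/negP.
  apply/(measurable_restrictT _ mH); apply: measurable_funM.
    exact: measurable_left_slope.
  exact: measurable_funTS.
have iB : (lebesgueN R d.+1).-integrable setT (EFin \o B).
  apply: (intbox _ (L * M)) => //.
    by move=> y /test_supp p0; rewrite /B p0 mulr0; case: ifP.
  move=> y Ky; rewrite /B ifT; last exact: KH.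
  rewrite normrM ler_pM//.
  by have [_] := HL y (Kr _ Ky) (Ke _ Ky).
have e20 : 0 < eps / 2 by rewrite divr_gt0.
have e40 : 0 < eps / 4 by rewrite divr_gt0.
(* room for y when only its translate y - h e meets the support, h <= eps / 4 *)
have [L2 HL2] := @Floc (eps / 2) (r + eps) e20 (addr_gt0 r0 e0).
have [_ sum0] : (lebesgueN R d.+1).-integrable setT (EFin \o (fun y => A y + B y)) /\
    \int[lebesgueN R d.+1]_y (A y + B y) = 0.
  apply: (@Rintegral_left_slope0 R d.+1 (e_ i) G _ (eps / 4) (`|L2| * M' + `|L2| * M) r) => //.
  - exact: delta_le1.
  - move=> y h /andP[h0 h4].
    have [nn|] := pselect (~ K y /\ ~ K (y - h *: e_ i)).
      rewrite /G (test_supp nn.1) (test_supp nn.2) !mulr0 subrr normr0.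
      by rewrite mulr_ge0 ?(ltW h0)// addr_ge0// mulr_ge0.
    move=> /not_andP nn.
    have {nn}yK : K y \/ K (y - h *: e_ i).
      by case: nn => /contrapT; [left|right].
    have yr : box d.+1 (r + eps) y.
      move=> j; case: yK => [/Kr/(_ j)|/Kr/(_ j)]; first by move/le_trans; apply; rewrite lerDl ltW.
      rewrite !mxE => Hj.
      have -> : y ord0 j = y ord0 j - h * (e_ i) ord0 j + h * (e_ i) ord0 j by rewrite subrK.
      apply: le_trans (ler_normD _ _) _; apply: lerD; first by rewrite mxE.
      rewrite normrM gtr0_norm// -[X in _ <= X]mulr1 ler_pM ?(ltW h0) ?delta_le1//.
      by apply: le_trans h4 _; rewrite ler_pdivrMr// ler_peMr ?ltW// ltr1n.
    have ye : eps / 2 <= height y.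
      case: yK => [/Ke|/Ke] h1; first by apply: le_trans h1; rewrite ler_pdivrMr// ler_peMr ?ltW// ltr1n.
      have h2 : height (y - h *: e_ i) - `|- h| <= height (y - h *: e_ i - (- h) *: e_ i).
        exact: height_shift.
      move: h2; rewrite scaleNr opprK subrK normrN gtr0_norm// => h2; lra.
    have [F1 F2] := HL2 y yr ye.
    have {}F2 : `|F y - F (y - h *: e_ i)| <= L2 * h.
      by apply: F2; rewrite h0/=; lra.
    have -> : G y - G (y - h *: e_ i) = F y * (phi y - phi (y - h *: e_ i)) +
       phi (y - h *: e_ i) * (F y - F (y - h *: e_ i)) by rewrite /G; ring.
    apply: le_trans (ler_normD _ _) _; rewrite !normrM [leRHS]mulrDl.
    apply: lerD.
      rewrite -mulrA; apply: ler_pM => //; first exact: le_trans F1 (ler_norm _).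
      exact: Dphi.
    rewrite [`|L2| * M]mulrC -mulrA; apply: ler_pM => //.
    apply: le_trans F2 _; rewrite ler_wpM2r ?(ltW h0)//; exact: ler_norm.
  - by move=> y /KG/Kr.
  - move=> y; have [Hy|nHy] := pselect (H y); last first.
      have h0 : height y <= 0 by rewrite leNgt; apply/negP.
      rewrite /A /B F0// mul0r ifN ?add0r ?addr0; last by rewrite -leNgt.
      apply: cvg_near_cst; apply: nearW => k; rewrite /G F0// F0 ?mul0r ?subrr ?mulr0//.
      rewrite /halfspace /=; apply/negP; rewrite -leNgt.
      apply: le_trans h0; rewrite /height !mxE/= gerBl mulr_ge0 ?invr_ge0 ?ler0n//.
    rewrite /B ifT//.
    have -> : (fun k => k.+1%:R * (G y - G (y - k.+1%:R^-1 *: e_ i))) =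
      (fun k => F y * (k.+1%:R * (phi y - phi (y - k.+1%:R^-1 *: e_ i))) +
        (k.+1%:R * (F y - F (y - k.+1%:R^-1 *: e_ i))) * phi (y - k.+1%:R^-1 *: e_ i)).
      by apply/funext => k; rewrite /G; ring.
    apply: cvgD.
      apply: cvgM; first exact: cvg_cst.
      exact: (left_slope_derive (@test_derivable R d.+1 H phi tphi y (e_ i))).
    apply: cvgM; first exact: Fg.
    have cy : {for y, continuous phi} by exact: test_continuous tphi y.
    apply: (continuous_cvg _ cy).
    rewrite -[X in _ --> X]subr0; apply: cvgB; first exact: cvg_cst.
    rewrite -[X in _ --> X](scale0r (e_ i)); apply: cvgZr_tmp.
    exact: cvg_harmonic.
have iAH : (lebesgueN R d.+1).-integrable H (EFin \o A) by exact: integrableS iA.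
have iBH : (lebesgueN R d.+1).-integrable H (EFin \o B) by exact: integrableS iB.
apply/eqP; rewrite -subr_eq0 opprK; apply/eqP.
transitivity (\int[lebesgueN R d.+1]_(y in H) A y + \int[lebesgueN R d.+1]_(y in H) B y).
  congr (_ + _); apply: eq_Rintegral => y; rewrite inE => Hy.
  by rewrite /B ifT.
rewrite -RintegralD// Rintegral_mkcond -[RHS]sum0; apply: eq_Rintegral => y _.
rewrite patchE; case: ifPn => //; rewrite notin_setE => nHy.
by rewrite /A /B F0// mul0r ifN ?addr0//; apply/negP.
Qed.

End weak_gradient_left_slope.

(** * Hat functions and interpolation of values on cubes *)
Section ramps.
Context (R : realType).
Implicit Types (s h : R).

Definition ramp s : R := Num.max 0 (Num.min 1 s).

Lemma ramp_ge0 s : 0 <= ramp s. Proof. by rewrite le_max lexx. Qed.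
Lemma ramp_le1 s : ramp s <= 1. Proof. by rewrite ge_max ler01 ge_min lexx. Qed.
Lemma ramp0 s : s <= 0 -> ramp s = 0.
Proof. by move=> s0; apply/max_idPl; rewrite ge_min s0 orbT. Qed.
Lemma ramp1 s : 1 <= s -> ramp s = 1.
Proof. by move=> s1; rewrite /ramp min_l// max_r. Qed.
Lemma ramp_id s : 0 <= s -> s <= 1 -> ramp s = s.
Proof. by move=> s0 s1; rewrite /ramp min_r// max_r. Qed.

Lemma ramp_le s t : s <= t -> ramp s <= ramp t.
Proof.
move=> st; rewrite /ramp ge_max le_max lexx /= le_max; apply/orP; right.
by rewrite le_min !ge_min lexx st orbT.
Qed.

Lemma ramp_lip s t : `|ramp s - ramp t| <= `|s - t|.
Proof.
wlog st : s t / s <= t.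
  by move=> H; have [/H//|/ltW/H] := leP s t; rewrite distrC [leRHS]distrC.
rewrite distrC [leRHS]distrC !ger0_norm ?subr_ge0 ?ramp_le//.
have [s0|s0] := leP s 0; have [t0|t0] := leP t 0; have [s1|s1] := leP s 1; have [t1|t1] := leP t 1;
  rewrite ?(ramp0 s0) ?(ramp0 t0) ?(ramp_id (ltW s0) s1) ?(ramp_id (ltW t0) t1) ?(ramp1 (ltW s1)) ?(ramp1 (ltW t1)); lra.
Qed.

(** One-sided slopes that are exact for small steps.  Piecewise affine
    functions have them at every point, kinks included, so that no exceptional
    set arises. *)
Definition sloped (f : R -> R) (a : R) := \forall h \near 0^'+, f h = a * h.

Lemma sloped0 : sloped (fun=> 0) 0.
Proof. by apply: nearW => h; rewrite mul0r. Qed.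

Lemma slopedD f g a b : sloped f a -> sloped g b -> sloped (fun h => f h + g h) (a + b).
Proof. by apply: filterS2 => h -> ->; rewrite mulrDl. Qed.

Lemma slopedZ f a c : sloped f a -> sloped (fun h => c * f h) (c * a).
Proof. by apply: filterS => h ->; rewrite mulrA. Qed.

Lemma sloped_sum (I : Type) (r : seq I) (f : I -> R -> R) (a : I -> R) :
  (forall i, sloped (f i) (a i)) ->
  sloped (fun h => \sum_(i <- r) f i h) (\sum_(i <- r) a i).
Proof.
move=> H; elim: r => [|i r IH].
  by rewrite big_nil; apply: filterS sloped0 => h <-; rewrite big_nil.
rewrite big_cons; have := slopedD (H i) IH.
by apply: filterS => h <-; rewrite big_cons.
Qed.

(** The condition on [s] is open on the left and closed on the right because
    the step goes to the left. *)
Lemma sloped_ramp s : sloped (fun h => ramp s - ramp (s - h)) ((0 < s <= 1)%R)%:R.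
Proof.
have near_lt (c : R) : 0 < c -> \forall h \near (0 : R)^'+, 0 < h /\ h < c.
  move=> c0; near=> h; split; near: h; [exact: nbhs_right_gt|exact: nbhs_right_lt].
have [s0|s0] := leP s 0.
  near=> h; have [h0 _] : 0 < h /\ h < 1 by near: h; exact: near_lt.
  rewrite !ramp0 ?subr0 ?mul0r//; lra.
have [s1|s1] /= := leP s 1.
  near=> h; have [h0 hs] : 0 < h /\ h < s by near: h; exact: near_lt.
  rewrite !ramp_id ?mul1r; lra.
have s10 : 0 < s - 1 by rewrite subr_gt0.
near=> h; have [h0 hs] : 0 < h /\ h < s - 1 by near: h; exact: near_lt.
rewrite !ramp1 ?subrr ?mul0r//; lra.
Unshelve. all: by end_near. Qed.

Lemma sloped_scale f a (c : R) : 0 < c -> sloped f a -> sloped (fun h => f (c * h)) (a * c).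
Proof.
move=> c0 [/= e e0 He]; exists (e / c) => /=; first by rewrite divr_gt0.
move=> h /=; rewrite sub0r normrN => hc h0; rewrite -mulrA; apply: He => /=.
  by rewrite sub0r normrN normrM gtr0_norm// mulrC -ltr_pdivlMr.
by rewrite mulr_gt0.
Qed.

(** The tent on [-1, 1]. *)
Definition hat s := ramp (s + 1) - ramp s.

Lemma hat_ge0 s : 0 <= hat s.
Proof. by rewrite subr_ge0 ramp_le// lerDl. Qed.

Lemma hat_le1 s : hat s <= 1.
Proof. by rewrite /hat lerBlDr (le_trans (ramp_le1 _))// lerDl ramp_ge0. Qed.

Lemma hat_supp s : hat s != 0 -> -1 < s < 1.
Proof.
move=> hs; apply/andP; split; rewrite ltNge; apply/negP => H; move/eqP: hs; apply.
  by rewrite /hat !ramp0 ?subrr//; lra.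
by rewrite /hat !ramp1 ?subrr//; lra.
Qed.

Lemma hat_lip s t : `|hat s - hat t| <= 2 * `|s - t|.
Proof.
have -> : hat s - hat t = (ramp (s + 1) - ramp (t + 1)) - (ramp s - ramp t) by rewrite /hat; ring.
apply: le_trans (ler_normB _ _) _; rewrite mulr_natl mulr2n lerD ?ramp_lip//.
by apply: le_trans (ramp_lip _ _) _; rewrite opprD addrACA subrr addr0.
Qed.

(** Translates of the tent by integers sum to 1 by telescoping, and three
    consecutive ones are enough for [s] within 1/2 of a unit interval. *)
Lemma hat_sum3 s (n : R) : n - 2^-1 <= s <= n + 1 + 2^-1 ->
  \sum_(a < 3) hat (s - (n - 1 + a%:R) - 2^-1) = 1.
Proof.
move=> /andP[s1 s2]; rewrite !big_ord_recr big_ord0/= /hat.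
rewrite (@ramp1 (s - (n - 1 + 0%:R) - 2^-1 + 1)); last lra.
rewrite (@ramp0 (s - (n - 1 + 2%:R) - 2^-1)); last lra.
have -> : s - (n - 1 + 1%:R) - 2^-1 + 1 = s - (n - 1 + 0%:R) - 2^-1 by ring.
have -> : s - (n - 1 + 2%:R) - 2^-1 + 1 = s - (n - 1 + 1%:R) - 2^-1 by ring.
by ring.
Qed.

Lemma measurable_ramp : measurable_fun setT ramp.
Proof. by apply: measurable_maxr => //; apply: measurable_minr. Qed.

Lemma measurable_hat : measurable_fun setT hat.
Proof.
apply: measurable_funB; last exact: measurable_ramp.
by apply: (measurableT_comp measurable_ramp); exact: measurable_funD.
Qed.

End ramps.

Section windows.
Context (R : realType) (d : nat).
Implicit Types (k : nat) (x : 'rV[R]_d) (m n : 'rV[int]_d) (c : 'rV[int]_d -> R).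

(** The lattice points in the discrete cube of corner [n] and side [K]; sums
    over all of Z^d are reduced to finite sums over such cubes. *)
Definition window K n (e : {ffun 'I_d -> 'I_K}) : 'rV[int]_d :=
  \row_l (n ord0 l + (e l : nat)%:Z).

Lemma window_inj K n : injective (@window K n).
Proof.
move=> e1 e2 /rowP E; apply/ffunP => l; have := E l; rewrite !mxE => /addrI[].
exact: val_inj.
Qed.

Lemma windowP K n m : (forall l, n ord0 l <= m ord0 l < n ord0 l + K.+1%:Z) ->
  exists e : {ffun 'I_d -> 'I_K.+1}, m = window n e.
Proof.
move=> H; exists [ffun l => inord `|m ord0 l - n ord0 l|%N].
apply/rowP => l; rewrite mxE ffunE; have /andP[a b] := H l.
rewrite inordK; last by lia.
rewrite -[m 0 l]/(m ord0 l); lia.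
Qed.

(** Makes the sums over Z^d in [interp] finite ones. *)
Lemma fsum_window K n c : (forall m, c m != 0 -> forall l, n ord0 l <= m ord0 l < n ord0 l + K.+1%:Z) ->
  \sum_(m \in [set: 'rV[int]_d]) c m = \sum_(e : {ffun 'I_d -> 'I_K.+1}) c (window n e).
Proof.
move=> H.
rewrite -(@fsbig_widen _ _ _ _ [set window n e | e in [set: {ffun 'I_d -> 'I_K.+1}]])//; last first.
  move=> m [_ /= nm]; apply/eqP/negPn/negP => /H/windowP[e me]; apply: nm.
  by exists e.
rewrite fsbig_image; last by move=> a b _ _; exact: window_inj.
rewrite [RHS](fsbig_seq _ _ (index_enum_uniq _)); apply: eq_fsbigl.
by apply/seteqP; split => e // _; rewrite /= mem_index_enum.
Qed.

(** The tensor product of tents centred at the centre of the cube [m]; the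
    shift by 1/2 moves the corner to the centre. *)
Definition bump k m x : R := \prod_l hat (2 ^+ k * x ord0 l - (m ord0 l)%:~R - 2^-1).

Definition interp k c x : R := \sum_(m \in [set: 'rV[int]_d]) c m * bump k m x.

Lemma bump_ge0 k m x : 0 <= bump k m x.
Proof. by apply: prodr_ge0 => l _; exact: hat_ge0. Qed.

Lemma bump_supp k m x : bump k m x != 0 ->
  forall l, (m ord0 l)%:~R - 2^-1 < 2 ^+ k * x ord0 l < (m ord0 l)%:~R + 1 + 2^-1.
Proof.
move=> b0 l; have : hat (2 ^+ k * x ord0 l - (m ord0 l)%:~R - 2^-1) != 0.
  by apply/negP => /eqP h0; move: b0; rewrite /bump (bigD1 l)//= h0 mul0r eqxx.
by move/hat_supp => /andP[a b]; apply/andP; split; lra.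
Qed.

Lemma measurable_bump k m : measurable_fun setT (bump k m).
Proof.
apply: measurable_prod => l _.
apply: (measurableT_comp (@measurable_hat R)).
apply: measurable_funB => //; apply: measurable_funB => //.
apply: measurable_funM => //; exact: measurable_coord.
Qed.

(** The region where [interp k] only sees the cube of index [n] and its
    neighbors.  It extends the cube by half its side, so that one index serves
    for a point and for its small translates. *)
Definition near_cell k n x := forall l,
  (n ord0 l)%:~R - 2^-1 <= 2 ^+ k * x ord0 l <= (n ord0 l)%:~R + 1 + 2^-1.

Local Notation pre n := (\row_l (n ord0 l - 1) : 'rV[int]_d).

Lemma near_cell_window k n x m : near_cell k n x -> bump k m x != 0 ->
  forall l, (pre n) ord0 l <= m ord0 l < (pre n) ord0 l + 3%:Z.
Proof.
move=> H /bump_supp b l; rewrite mxE.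
have /andP[a1 a2] := H l; have /andP[b1 b2] := b l.
have c1 : (m ord0 l)%:~R < (n ord0 l + 2)%:~R :> R by rewrite intrD; lra.
have c2 : (n ord0 l - 2)%:~R < (m ord0 l)%:~R :> R by rewrite intrB; lra.
rewrite !ltr_int in c1 c2; lia.
Qed.

Lemma interp_window k n c x : near_cell k n x ->
  interp k c x = \sum_(e : {ffun 'I_d -> 'I_3}) c (window (pre n) e) * bump k (window (pre n) e) x.
Proof.
move=> H; rewrite /interp (@fsum_window 2 (pre n))// => m.
by rewrite mulf_eq0 negb_or => /andP[_]; exact: near_cell_window.
Qed.

(** Distribute the product over l of the sums given by [hat_sum3]. *)
Lemma bump_sum1 k n x : near_cell k n x ->
  \sum_(e : {ffun 'I_d -> 'I_3}) bump k (window (pre n) e) x = 1.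
Proof.
move=> H.
have E (e : {ffun 'I_d -> 'I_3}) : bump k (window (pre n) e) x = \prod_l hat (2 ^+ k * x ord0 l -
   ((n ord0 l)%:~R - 1 + (e l : nat)%:R) - 2^-1).
  by apply: eq_bigr => l _; rewrite !mxE !intrD.
rewrite (eq_bigr _ (fun e _ => E e)) -(bigA_distr_bigA (fun l (a : 'I_3) => hat (2 ^+ k * x ord0 l -
   ((n ord0 l)%:~R - 1 + (a : nat)%:R) - 2^-1))).
by apply: big1 => l _; apply: hat_sum3.
Qed.

Lemma interp_sub k n c x v : near_cell k n x ->
  interp k c x - v = \sum_(e : {ffun 'I_d -> 'I_3}) (c (window (pre n) e) - v) * bump k (window (pre n) e) x.
Proof.
move=> H; rewrite (interp_window c H) -{1}[v]mulr1 -(bump_sum1 H) mulr_sumr -sumrB.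
by apply: eq_bigr => e _; rewrite mulrBl.
Qed.

(** [interp k c x] is a convex combination of the values of [c] on the cube of
    index [n] and on its neighbors. *)
Lemma interp_near k n c x (v A : R) : near_cell k n x ->
  (forall e : {ffun 'I_d -> 'I_3}, `|c (window (pre n) e) - v| <= A) -> `|interp k c x - v| <= A.
Proof.
move=> H HA; rewrite (interp_sub c v H).
apply: le_trans (ler_norm_sum _ _ _) _.
rewrite -[A]mulr1 -(bump_sum1 H) mulr_sumr; apply: ler_sum => e _.
by rewrite normrM (ger0_norm (bump_ge0 _ _ _)) ler_wpM2r ?bump_ge0.
Qed.

Local Notation e_ l := (delta_mx ord0 l : 'rV[R]_d).

Lemma coord_shift x h l j : (x - h *: e_ l) ord0 j = x ord0 j - h * (j == l)%:R.
Proof. by rewrite !mxE eqxx. Qed.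

Lemma bump_shift k m x h l : bump k m x - bump k m (x - h *: e_ l) =
  (\prod_(j | j != l) hat (2 ^+ k * x ord0 j - (m ord0 j)%:~R - 2^-1)) *
  (hat (2 ^+ k * x ord0 l - (m ord0 l)%:~R - 2^-1) -
   hat (2 ^+ k * x ord0 l - (m ord0 l)%:~R - 2^-1 - 2 ^+ k * h)).
Proof.
rewrite /bump (bigD1 l)//= [X in _ - X](bigD1 l)//=.
rewrite mulrBr [hat _ * \prod_(_ | _) _]mulrC; congr (_ - _).
rewrite mulrC; congr (_ * _).
  by apply: eq_bigr => j /negPf jl; rewrite coord_shift jl mulr0 subr0.
by rewrite coord_shift eqxx mulr1; congr hat; ring.
Qed.

Lemma bump_shift_le k m x (h : R) l : 0 <= h -> `|bump k m x - bump k m (x - h *: e_ l)| <=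
  \prod_j (if j == l then 2 * 2 ^+ k * h else hat (2 ^+ k * x ord0 j - (m ord0 j)%:~R - 2^-1)).
Proof.
move=> h0; rewrite bump_shift normrM ger0_norm; last by apply: prodr_ge0 => *; exact: hat_ge0.
rewrite [leRHS](bigD1 l)//= eqxx mulrC.
rewrite [X in _ <= _ * X](eq_bigr (fun j => hat (2 ^+ k * x ord0 j - (m ord0 j)%:~R - 2^-1))); last first.
  by move=> j /negPf ->.
apply: ler_wpM2r; first by apply: prodr_ge0 => *; exact: hat_ge0.
apply: le_trans (hat_lip _ _) _; rewrite subKr ger0_norm ?mulrA//.
by rewrite mulr_ge0 ?exprn_ge0.
Qed.

(** Subtract the constant [v], which interpolation reproduces; then one factor
    of the product is Lipschitz with constant 2 * 2^k and takes three values,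
    and the others sum to 1. *)
Lemma interp_lip k n c x (v A h : R) l : near_cell k n x -> near_cell k n (x - h *: e_ l) ->
  0 <= h -> (forall e : {ffun 'I_d -> 'I_3}, `|c (window (pre n) e) - v| <= A) ->
  `|interp k c x - interp k c (x - h *: e_ l)| <= 6 * 2 ^+ k * A * h.
Proof.
move=> H H' h0 HA.
have -> : interp k c x - interp k c (x - h *: e_ l) =
  (interp k c x - v) - (interp k c (x - h *: e_ l) - v) by ring.
rewrite (interp_sub c v H) (interp_sub c v H') -sumrB.
apply: le_trans (ler_norm_sum _ _ _) _.
apply: (@le_trans _ _ (\sum_(e : {ffun 'I_d -> 'I_3}) A * \prod_j (if j == l then 2 * 2 ^+ k * h
   else hat (2 ^+ k * x ord0 j - ((n ord0 j)%:~R - 1 + (e j : nat)%:R) - 2^-1)))).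
  apply: ler_sum => e _; rewrite -mulrBr normrM; apply: ler_pM => //.
  apply: le_trans (bump_shift_le _ _ _ _ h0) _; apply: ler_prod => j _.
  rewrite !mxE !intrD; case: ifP => _; first by rewrite lexx !mulr_ge0 ?exprn_ge0.
  by rewrite lexx hat_ge0.
rewrite -mulr_sumr.
rewrite -(bigA_distr_bigA (fun j (a : 'I_3) => if j == l then 2 * 2 ^+ k * h
   else hat (2 ^+ k * x ord0 j - ((n ord0 j)%:~R - 1 + (a : nat)%:R) - 2^-1))).
rewrite [\prod_i _](bigD1 l)//= eqxx [X in A * (_ * X)]big1 ?mulr1; last first.
  by move=> j /negPf ->; exact: hat_sum3.
rewrite sumr_const card_ord -mulr_natl le_eqVlt; apply/orP; left; apply/eqP; ring.
Qed.

(** The corner of the window of integer points of [-N, N]^d; on a bounded set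
    one such window works for all points at once, which gives measurability
    and local bounds. *)
Definition low N : 'rV[int]_d := \row_l (- N%:Z).

Definition interpN N k c x : R :=
  \sum_(e : {ffun 'I_d -> 'I_(2 * N).+1}) c (window (low N) e) * bump k (window (low N) e) x.

Lemma interpNE (r : R) k : exists N0, forall N, (N0 <= N)%N -> forall c x, box d r x ->
  interp k c x = interpN N k c x.
Proof.
exists (Num.truncn (2 ^+ k * r + 2)).+1 => N HN c x xr.
have rN : 2 ^+ k * r + 2 < N%:R.
  by apply: (lt_le_trans (truncnS_gt _)); rewrite ler_nat.
rewrite /interp /interpN (@fsum_window (2 * N) (low N))// => m.
rewrite mulf_eq0 negb_or => /andP[_ /bump_supp b] l.
have /andP[b1 b2] := b l; have := xr l; rewrite ler_norml => /andP[x1 x2].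
have k0 : 0 < 2 ^+ k :> R by rewrite exprn_gt0.
have y1 : 2 ^+ k * x ord0 l <= 2 ^+ k * r by rewrite ler_pM2l.
have y2 : - (2 ^+ k * r) <= 2 ^+ k * x ord0 l by rewrite -mulrN ler_pM2l.
have c1 : (m ord0 l)%:~R < (N%:Z)%:~R :> R by rewrite -pmulrn; lra.
have c2 : (- N%:Z)%:~R < (m ord0 l)%:~R :> R by rewrite intrN -pmulrn; lra.
rewrite !ltr_int in c1 c2; rewrite mxE; lia.
Qed.

Lemma measurable_interp k c : measurable_fun setT (interp k c).
Proof.
apply: (@measurable_fun_cvg _ _ _ setT (fun N => interpN N k c)).
  move=> N; apply: measurable_sum => e; apply: measurable_funM => //.
  exact: measurable_bump.
move=> x _; have [N0 HN] := interpNE (\sum_i `|x ord0 i|) k.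
apply: cvg_near_cst; exists N0 => // N /= N0N; rewrite (HN N N0N)// => i.
by rewrite (bigD1 i)//= lerDl sumr_ge0.
Qed.

Lemma box_shift (r b : R) x (h : R) l : 0 <= h <= b -> box d r x -> box d (r + b) (x - h *: e_ l).
Proof.
move=> /andP[h0 hb] xr i; rewrite coord_shift; apply: le_trans (ler_normB _ _) _.
apply: lerD => //; rewrite normrM (ger0_norm h0) normr_nat.
by case: eqP => _; rewrite ?mulr1// mulr0 (le_trans h0).
Qed.

Lemma interp_loc k c (r b : R) : 0 <= b -> exists L : R, forall x, box d r x ->
  `|interp k c x| <= L /\
  forall l (h : R), 0 < h <= b -> `|interp k c x - interp k c (x - h *: e_ l)| <= L * h.
Proof.
move=> b0; have [N0 /(_ N0 (leqnn _)) HN] := interpNE (r + b) k.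
set N := N0 in HN.
pose C := \sum_(e : {ffun 'I_d -> 'I_(2 * N).+1}) `|c (window (low N) e)|.
have C0 : 0 <= C by apply: sumr_ge0.
have k1 : 1 <= 2 ^+ k :> R by rewrite exprn_ege1// ler1n.
exists (2 * 2 ^+ k * C) => x xr.
have xr1 : box d (r + b) x by move=> i; apply: le_trans (xr i) _; rewrite lerDl.
have prod1 (P : pred 'I_d) (f : 'I_d -> R) : \prod_(j | P j) hat (f j) <= 1.
  by apply: prodr_ile1 => j _; rewrite hat_ge0 hat_le1.
split.
  rewrite HN//; apply: (@le_trans _ _ C); last by rewrite ler_peMl//; lra.
  apply: le_trans (ler_norm_sum _ _ _) _; apply: ler_sum => e _.
  rewrite normrM -[leRHS]mulr1 ler_wpM2l// ger0_norm ?bump_ge0//; exact: prod1.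
move=> l h h01; rewrite !HN//; last by apply: box_shift => //; case/andP: h01 => /ltW ->.
case/andP: h01 => h0 h1.
rewrite -sumrB; apply: le_trans (ler_norm_sum _ _ _) _.
rewrite mulrAC mulr_sumr; apply: ler_sum => e _; rewrite -mulrBr normrM mulrC ler_wpM2r//.
rewrite bump_shift normrM -[leRHS]mul1r; apply: ler_pM => //.
  by rewrite ger0_norm ?prod1//; apply: prodr_ge0 => *; exact: hat_ge0.
apply: le_trans (hat_lip _ _) _; rewrite subKr ger0_norm ?mulrA//.
by rewrite mulr_ge0 ?exprn_ge0 ?ltW.
Qed.

Lemma sloped_hat (s : R) (c : R) : 0 < c -> exists a, sloped (fun h => hat s - hat (s - c * h)) a.
Proof.
move=> c0; exists (((0 < s + 1 <= 1)%R)%:R * c + -1 * (((0 < s <= 1)%R)%:R * c)).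
have := slopedD (sloped_scale c0 (sloped_ramp (s + 1)))
  (slopedZ (-1) (sloped_scale c0 (sloped_ramp s))).
apply: filterS => h <-; rewrite /hat (addrAC s (- (c * h)) 1); ring.
Qed.

Lemma interp_sloped k c x l : exists a, sloped (fun h => interp k c x - interp k c (x - h *: e_ l)) a.
Proof.
pose r := \sum_i `|x ord0 i|.
have xr : box d r x by move=> i; rewrite /r (bigD1 i)//= lerDl sumr_ge0.
have [N /(_ N (leqnn _)) HN] := interpNE (r + 1) k.
have k0 : 0 < 2 ^+ k :> R by rewrite exprn_gt0.
have /(_ _)/cid H (e : {ffun 'I_d -> 'I_(2 * N).+1}) := @sloped_hat
  (2 ^+ k * x ord0 l - ((window (low N) e) ord0 l)%:~R - 2^-1) _ k0.
pose P (e : {ffun 'I_d -> 'I_(2 * N).+1}) := c (window (low N) e) *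
  \prod_(j | j != l) hat (2 ^+ k * x ord0 j - ((window (low N) e) ord0 j)%:~R - 2^-1).
exists (\sum_e P e * sval (H e)).
have := sloped_sum (index_enum _) (fun e => slopedZ (P e) (svalP (H e))).
have : \forall h \near (0 : R)^'+, 0 < h /\ h <= 1.
  near=> h; split; near: h; [exact: nbhs_right_gt|exact: nbhs_right_le].
apply: filterS2 => h [h0 h1] <-.
rewrite !HN; last 2 first.
- by apply: box_shift => //; rewrite h1 ltW.
- by move=> i; apply: le_trans (xr i) _; rewrite lerDl.
rewrite -sumrB; apply: eq_bigr => e _.
by rewrite -mulrBr bump_shift mulrA.
Unshelve. all: by end_near. Qed.

Lemma interp_linear k c1 c2 (a b : R) x :
  interp k (fun m => a * c1 m + b * c2 m) x = a * interp k c1 x + b * interp k c2 x.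
Proof.
have [N /(_ N (leqnn _)) HN] := interpNE (\sum_i `|x ord0 i|) k.
have xr : box d (\sum_i `|x ord0 i|) x by move=> i; rewrite (bigD1 i)//= lerDl sumr_ge0.
rewrite !HN// /interpN !mulr_sumr -big_split/=; apply: eq_bigr => e _.
by rewrite mulrDl !mulrA.
Qed.

End windows.

(** * The extension by layers *)
Section profile.
Context (R : realType).
Implicit Types (t : R) (j : nat).

(** The inverse height of layer [j].  The factor 8 keeps the layer so low that
    points of a Whitney neighborhood above x and x itself differ by less than
    half a cube of generation 2^j, as [near_cell] requires. *)
Definition lvl j : R := 2 ^+ (2 ^ j + 3).

Lemma lvl_gt0 j : 0 < lvl j. Proof. by rewrite exprn_gt0. Qed.

Lemma lvlE j : lvl j = 8 * 2 ^+ (2 ^ j).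
Proof. by rewrite /lvl addnC exprD; congr (_ * _); rewrite !exprS expr0; ring. Qed.

Lemma lvl_le i j : (i <= j)%N -> lvl i <= lvl j.
Proof. by move=> ij; rewrite ler_eXn2l ?ltr1n// leq_add2r leq_exp2l. Qed.

Lemma lvl_double j : 2 * lvl j <= lvl j.+1.
Proof.
rewrite -exprS; apply: ler_weXn2l; first by rewrite ler1n.
by rewrite -addSn leq_add2r -[leqLHS]addn1 expnS mul2n -addnn leq_add2l expn_gt0.
Qed.

(** Vanishes for t <= 1 / lvl j and equals 1 for t >= 2 / lvl j, so that
    [layer j] lives on the heights between 1 / lvl j.+1 and 2 / lvl j, and the
    layers telescope. *)
Definition cutoff j t : R := ramp (lvl j * t - 1).
Definition layer j t : R := cutoff j.+1 t - cutoff j t.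

Lemma cutoff0 j t : lvl j * t <= 1 -> cutoff j t = 0.
Proof. by move=> H; rewrite /cutoff ramp0// subr_le0. Qed.

Lemma cutoff1 j t : 2 <= lvl j * t -> cutoff j t = 1.
Proof. by move=> H; rewrite /cutoff ramp1//; lra. Qed.

Lemma layer_ge0 j t : 0 <= layer j t.
Proof.
rewrite subr_ge0; have [t0|t0] := leP 0 t.
  by apply: ramp_le; rewrite lerB// ler_wpM2r// lvl_le.
rewrite !cutoff0//; apply: le_trans ler01; rewrite nmulr_lle0// ltW ?lvl_gt0//.
Qed.

Lemma sum_layer N t : \sum_(j < N) layer j t = cutoff N t - cutoff 0 t.
Proof.
elim: N => [|N IH]; first by rewrite big_ord0 subrr.
by rewrite big_ord_recr/= IH /layer addrC subrKA.
Qed.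

Lemma sum_layer_le1 N t : \sum_(j < N) layer j t <= 1.
Proof. by rewrite sum_layer lerBlDr (le_trans (ramp_le1 _))// lerDl ramp_ge0. Qed.

Lemma layer_lvl j t : layer j t != 0 -> lvl j * t <= 2.
Proof.
move=> H; rewrite leNgt; apply/negP => l2; move/eqP: H; apply.
rewrite /layer !cutoff1 ?subrr//; first exact: ltW.
apply: le_trans (ltW l2) _; rewrite ler_wpM2r ?lvl_le//.
by rewrite -(pmulr_rge0 _ (lvl_gt0 j)); lra.
Qed.

Lemma layer_lvl1 j t : layer j t != 0 -> 1 < lvl j.+1 * t.
Proof.
move=> H; rewrite ltNge; apply/negP => l1; move/eqP: H; apply.
rewrite /layer !cutoff0 ?subrr//.
have [t0|t0] := leP 0 t; first by apply: le_trans l1; rewrite ler_wpM2r ?lvl_le.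
by apply: le_trans ler01; rewrite nmulr_lle0// ltW ?lvl_gt0.
Qed.

Lemma cutoff_top (eps : R) : 0 < eps -> exists N0, forall j, (N0 <= j)%N ->
  forall t, eps <= t -> 2 < lvl j * t.
Proof.
move=> e0; have [N0 HN] := lt_expr22 e0; exists N0 => j Nj t et.
have k0 : 0 < 2 ^+ (2 ^ j) :> R by rewrite exprn_gt0.
have := HN j Nj; rewrite invf_plt ?posrE// => H.
have : 1 < 2 ^+ (2 ^ j) * t.
  apply: (@lt_le_trans _ _ (2 ^+ (2 ^ j) * eps)); last by rewrite ler_wpM2l// ltW.
  by rewrite -ltr_pdivrMr// div1r.
rewrite lvlE; lra.
Qed.

Lemma cutoff_lip j t u : `|cutoff j t - cutoff j u| <= lvl j * `|t - u|.
Proof.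
apply: le_trans (ramp_lip _ _) _.
by rewrite opprB addrA subrK -mulrBr normrM gtr0_norm ?lvl_gt0.
Qed.

Lemma layer_lip j t u : `|layer j t - layer j u| <= 2 * lvl j.+1 * `|t - u|.
Proof.
have -> : layer j t - layer j u = (cutoff j.+1 t - cutoff j.+1 u) - (cutoff j t - cutoff j u) by rewrite /layer; ring.
apply: le_trans (ler_normB _ _) _; rewrite -mulrA mulr_natl mulr2n; apply: lerD.
  exact: cutoff_lip.
by apply: le_trans (cutoff_lip _ _ _) _; rewrite ler_wpM2r// lvl_le.
Qed.

Definition dcutoff j t : R := lvl j * ((0 < lvl j * t - 1 <= 1)%R)%:R.

Lemma cutoff_sloped j t : sloped (fun h => cutoff j t - cutoff j (t - h)) (dcutoff j t).
Proof.
have := sloped_scale (lvl_gt0 j) (sloped_ramp (lvl j * t - 1)).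
rewrite -[X in _ -> sloped _ X]/(lvl j * _) [X in _ -> sloped _ X]mulrC.
apply: filterS => h <-; congr (_ - ramp _); ring.
Qed.

Lemma layer_sloped j t : sloped (fun h => layer j t - layer j (t - h)) (dcutoff j.+1 t - dcutoff j t).
Proof.
have := slopedD (cutoff_sloped j.+1 t) (slopedZ (-1) (cutoff_sloped j t)).
by rewrite mulN1r; apply: filterS => h <-; rewrite /layer; ring.
Qed.

Lemma measurable_layer j : measurable_fun setT (layer j).
Proof.
have ms i : measurable_fun setT (cutoff i).
  apply: (measurableT_comp (@measurable_ramp R)); by apply: measurable_funB => //.
by apply: measurable_funB.
Qed.

Definition step j t : R := (lvl j * t <= 2)%R%:R.

(** The intervals ]1 / lvl j, 2 / lvl j] are disjoint because [lvl] at least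
    doubles; telescoping the indicators of t <= 2 / lvl j shows it without a
    case analysis on pairs. *)
Lemma sum_step N t : 0 < t ->
  \sum_(j < N) ((0 < lvl j * t - 1 <= 1)%R)%:R <= (1 : R).
Proof.
move=> t0; apply: (@le_trans _ _ (\sum_(j < N) (step j t - step j.+1 t))).
  apply: ler_sum => j _; rewrite /step.
  have d := lvl_double j.
  have {}d : 2 * (lvl j * t) <= lvl j.+1 * t by rewrite mulrA ler_pM2r.
  case: (lerP (lvl j * t) 2) => a1; case: (lerP (lvl j.+1 * t) 2) => a2; rewrite /=.
  - rewrite subrr; have -> : (0 < lvl j * t - 1) = false by apply/negbTE; rewrite -leNgt; lra.
    by [].
  - by rewrite subr0; case: (_ && _).
  - by exfalso; have := lvl_gt0 j; lra.
  - have -> : (lvl j * t - 1 <= 1) = false by apply/negbTE; rewrite -ltNge; lra.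
    by rewrite andbF subrr.
suff -> : \sum_(j < N) (step j t - step j.+1 t) = step 0 t - step N t.
  by rewrite /step; case: (lvl 0 * t <= 2); case: (lvl N * t <= 2); rewrite /= ?mulr1n ?mulr0n; lra.
elim: N => [|N IH]; first by rewrite big_ord0 subrr.
by rewrite big_ord_recr/= IH addrA subrK.
Qed.

End profile.

(** Summation by parts; the value -1 of the index stands for the zero
    function, since nothing lies above the first layer. *)
Lemma abel_sum (R : comRingType) (s u : nat -> R) N :
  \sum_(j < N) (s j.+1 - s j) * u j =
  \sum_(j < N) s j * ((if j == 0%N :> nat then 0 else u j.-1) - u j) +
  s N * (if N == 0%N then 0 else u N.-1).
Proof.
elim: N => [|N IH]; first by rewrite !big_ord0 mulr0 addr0.
rewrite !big_ord_recr/= IH; set A := (if N == 0%N then _ else _); ring.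
Qed.

(** Each [B j] in play is at most the l^p norm of all of them, and a
    subconvex combination of them is no larger. *)
Lemma powR_convex_bound (R : realType) (p : R) N (P : pred nat) (th B : nat -> R) (X : R) :
  0 < p -> 0 <= X -> (forall j, 0 <= th j) -> (forall j, 0 <= B j) ->
  (forall j, th j != 0 -> P j) -> \sum_(j < N) th j <= 1 ->
  X <= \sum_(j < N) th j * B j ->
  X `^ p <= \sum_(j < N | P j) B j `^ p.
Proof.
move=> p0 X0 th0 B0 thP th1 XB.
set S := \sum_(_ < _ | _) _.
have S0 : 0 <= S by apply: sumr_ge0 => j _; exact: powR_ge0.
have MS : (S `^ p^-1) `^ p = S by rewrite -powRrM mulVf ?gt_eqF// powRr1.
rewrite -[leRHS]MS; apply: ge0_ler_powR; rewrite ?nnegrE ?powR_ge0//; first exact: ltW.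
apply: le_trans XB _.
apply: (@le_trans _ _ (\sum_(j < N) th j * S `^ p^-1)); last first.
  by rewrite -mulr_suml ler_piMl ?powR_ge0.
apply: ler_sum => j _; have [->|thj] := eqVneq (th j) 0; first by rewrite !mul0r.
rewrite ler_wpM2l//.
have -> : B j = (B j `^ p) `^ p^-1 by rewrite -powRrM mulfV ?gt_eqF// powRr1.
apply: ge0_ler_powR; rewrite ?nnegrE ?powR_ge0//; first by rewrite invr_ge0 ltW.
rewrite /S (bigD1 j) ?thP//= lerDl; apply: sumr_ge0 => i _; exact: powR_ge0.
Qed.

Section extension.
Context (R : realType) (d : nat).
Implicit Types (av : nat -> 'rV[int]_d -> R) (y : 'rV[R]_d.+1) (x : 'rV[R]_d).

(** [av j m] stands for the mean of the function to be extended on the cube of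
    generation 2^j and index [m]; the regularity of the extension holds for
    arbitrary values. *)
Definition extN N av y : R :=
  \sum_(j < N) layer j (height y) * interp (2 ^ j) (av j) (base_pt y).

Definition ext av y : R :=
  if 0 < height y then limn (fun N => extN N av y) else 0.

(** At heights above [eps] only finitely many layers are nonzero. *)
Lemma extE (eps : R) : 0 < eps -> exists N0, forall N, (N0 <= N)%N -> forall av y,
  eps <= height y -> ext av y = extN N av y.
Proof.
move=> e0; have [N0 HN] := cutoff_top e0; exists N0 => N N0N av y ye.
rewrite /ext (lt_le_trans e0 ye); apply: cvg_lim => //.
apply: cvg_near_cst; exists N => // M /= NM.
rewrite /extN -(subnKC NM) big_split_ord/= [X in _ + X]big1 ?addr0// => i _.
apply/eqP; rewrite mulf_eq0; apply/orP; left; apply/negPn/negP => /layer_lvl.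
rewrite leNgt; apply/negP/negPn; apply: HN => //.
by rewrite (leq_trans N0N)// leq_addr.
Qed.

Lemma ext_linear av1 av2 (a b : R) y :
  ext (fun j m => a * av1 j m + b * av2 j m) y = a * ext av1 y + b * ext av2 y.
Proof.
have [y0|y0] := ltP 0 (height y); last by rewrite /ext ltNge y0/= !mulr0 addr0.
have [N /(_ N (leqnn _)) HN] := extE y0.
rewrite !HN// /extN !mulr_sumr -big_split/=; apply: eq_bigr => j _.
by rewrite interp_linear; ring.
Qed.

Lemma measurable_extN N av : measurable_fun setT (extN N av).
Proof.
apply: measurable_sum => j; apply: measurable_funM.
  exact: (measurableT_comp (measurable_layer j) (@measurable_height R d)).
exact: (measurableT_comp (measurable_interp _ _) (@measurable_base_pt R d)).
Qed.

Lemma measurable_ext av : measurable_fun setT (ext av).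
Proof.
have mH := @measurable_halfspace R d.
apply: (@measurable_fun_cvg _ _ _ setT (fun N => extN N av \_ (@halfspace R d))).
  move=> N; apply/(measurable_restrictT _ mH); apply: measurable_funTS.
  exact: measurable_extN.
move=> y _; have [y0|y0] := ltP 0 (height y).
  have [N0 HN] := extE y0; apply: cvg_near_cst; exists N0 => // N /= N0N.
  by rewrite patchE mem_set// (HN N N0N).
apply: cvg_near_cst; apply: nearW => N; rewrite patchE memNset; last first.
  by rewrite /halfspace/=; apply/negP; rewrite -leNgt.
by rewrite /ext ltNge y0.
Qed.

Local Notation e_ i := (delta_mx ord0 i : 'rV[R]_d.+1).

Lemma base_shift y (h : R) l :
  base_pt (y - h *: e_ (lift ord_max l)) = base_pt y - h *: (delta_mx ord0 l : 'rV[R]_d).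
Proof.
apply/rowP => i; rewrite !mxE eqxx; congr (_ - h * _).
by rewrite (inj_eq (@lift_inj _ _)).
Qed.

Lemma height_shift_base y (h : R) l : height (y - h *: e_ (lift ord_max l)) = height y.
Proof. by rewrite /height !mxE (negPf (neq_lift _ _)) andbF mulr0 subr0. Qed.

Lemma base_shift_max y (h : R) : base_pt (y - h *: e_ ord_max) = base_pt y.
Proof.
apply/rowP => i; rewrite !mxE.
by rewrite eq_sym (negPf (neq_lift _ _)) andbF mulr0 subr0.
Qed.

Lemma height_shift_max y (h : R) : height (y - h *: e_ ord_max) = height y - h.
Proof. by rewrite /height !mxE !eqxx mulr1. Qed.

Lemma box_base r y : box d.+1 r y -> box d r (base_pt y).
Proof. by move=> H i; rewrite mxE. Qed.

(** A finite sum of products of bounded Lipschitz functions on the region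
    considered. *)
Lemma ext_loc av (eps r : R) : 0 < eps -> 0 < r -> exists L : R, forall y, box d.+1 r y ->
  eps <= height y -> `|ext av y| <= L /\
  forall (i : 'I_d.+1) (h : R), 0 < h <= eps / 2 -> `|ext av y - ext av (y - h *: e_ i)| <= L * h.
Proof.
move=> e0 r0; have e20 : 0 < eps / 2 by rewrite divr_gt0.
have [N /(_ N (leqnn _)) HN] := extE e20.
have /(_ _)/cid HL j := interp_loc (2 ^ j) (av j) r (ltW e20).
pose L j := sval (HL j).
have L0 j : 0 <= `|L j| by [].
pose C j : R := (1 + 2 * lvl R j.+1) * `|L j|.
have C1 j : `|L j| <= C j.
  by rewrite ler_peMl// lerDl mulr_ge0// ltW// lvl_gt0.
have C2 j : 2 * lvl R j.+1 * `|L j| <= C j by rewrite ler_wpM2r// lerDr.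
exists (\sum_(j < N) C j) => y yr ye.
have ye2 : eps / 2 <= height y by apply: le_trans ye; rewrite ler_pdivrMr// ler_peMr ?ltW// ltr1n.
have tau1 j t : layer j t <= (1 : R).
  by rewrite /layer lerBlDr (le_trans (ramp_le1 _))// lerDl ramp_ge0.
split.
  rewrite HN//; apply: le_trans (ler_norm_sum _ _ _) _; apply: ler_sum => j _.
  rewrite normrM -[leRHS]mul1r; apply: ler_pM => //; first by rewrite ger0_norm ?layer_ge0.
  apply: le_trans (C1 j); have [H _] := svalP (HL j) _ (box_base yr).
  exact: le_trans H (ler_norm _).
move=> i h h12; have /andP[h0 h2] := h12.
have ye3 : eps / 2 <= height (y - h *: e_ i).
  have := height_shift y h i; rewrite gtr0_norm//; lra.
rewrite !HN// /extN -sumrB; apply: le_trans (ler_norm_sum _ _ _) _.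
rewrite mulr_suml; apply: ler_sum => j _.
case: (unliftP ord_max i) => [l|] ->.
  rewrite height_shift_base base_shift -mulrBr normrM -[leRHS]mul1r; apply: ler_pM => //.
    by rewrite ger0_norm ?layer_ge0.
  have [_ /(_ l h h12) H] := svalP (HL j) _ (box_base yr).
  apply: le_trans H _; rewrite ler_wpM2r ?(ltW h0)//.
  exact: le_trans (ler_norm _) (C1 j).
rewrite height_shift_max base_shift_max -mulrBl normrM.
apply: (@le_trans _ _ (2 * lvl R j.+1 * h * `|L j|)); last by rewrite mulrAC ler_wpM2r ?(ltW h0).
apply: ler_pM => //.
  by apply: le_trans (layer_lip _ _ _) _; rewrite subKr gtr0_norm.
have [H _] := svalP (HL j) _ (box_base yr).
exact: le_trans H (ler_norm _).
Qed.

(** For h < height y / 2 the height of the translate stays above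
    height y / 2, where the number of nonzero layers is bounded. *)
Lemma ext_near_step y : 0 < height y -> exists N0, forall N, (N0 <= N)%N -> forall av i,
  ext av y = extN N av y /\ \forall h \near (0 : R)^'+, ext av (y - h *: e_ i) = extN N av (y - h *: e_ i).
Proof.
move=> y0; have y20 : 0 < height y / 2 by rewrite divr_gt0.
have [N0 HN] := extE y20; exists N0 => N N0N av i.
split; first by apply: HN => //; rewrite ler_pdivrMr// ler_peMr ?ltW// ltr1n.
have : \forall h \near (0 : R)^'+, 0 < h /\ h < height y / 2.
  near=> h; split; near: h; [exact: nbhs_right_gt|exact: nbhs_right_lt].
apply: filterS => h [h0 h2]; apply: HN => //.
have := height_shift y h i; rewrite gtr0_norm//; lra.
Unshelve. all: by end_near. Qed.

(** Moving vertically changes the cutoffs and keeps the interpolated values. *)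
Lemma ext_sloped_max av y : 0 < height y -> exists N0, forall N, (N0 <= N)%N ->
  sloped (fun h => ext av y - ext av (y - h *: e_ ord_max))
    (\sum_(j < N) (dcutoff j.+1 (height y) - dcutoff j (height y)) * interp (2 ^ j) (av j) (base_pt y)).
Proof.
move=> y0; have [N0 HN] := ext_near_step y0; exists N0 => N /HN /(_ av ord_max)[E1 E2].
have := sloped_sum (index_enum _) (fun j : 'I_N => slopedZ (interp (2 ^ j) (av j) (base_pt y)) (layer_sloped j (height y))).
rewrite (eq_bigr (fun j : 'I_N => (dcutoff j.+1 (height y) - dcutoff j (height y)) * interp (2 ^ j) (av j) (base_pt y))); last first.
  by move=> j _; rewrite mulrC.
move: E2; apply: filterS2 => h -> <-; rewrite E1 /extN -sumrB; apply: eq_bigr => j _.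
by rewrite height_shift_max base_shift_max -mulrBl mulrC.
Qed.

Lemma ext_sloped av y i : 0 < height y ->
  exists a, sloped (fun h => ext av y - ext av (y - h *: e_ i)) a.
Proof.
move=> y0; have [N /(_ N (leqnn _) av i)[E1 E2]] := ext_near_step y0.
case: (unliftP ord_max i) E2 => [l|] -> E2; last first.
  by have [N1 /(_ N1 (leqnn _)) H] := ext_sloped_max av y0; eexists; exact: H.
have /(_ _)/cid H (j : 'I_N) := interp_sloped (2 ^ j) (av j) (base_pt y) l.
exists (\sum_(j < N) layer j (height y) * sval (H j)).
have := sloped_sum (index_enum _) (fun j : 'I_N => slopedZ (layer j (height y)) (svalP (H j))).
move: E2; apply: filterS2 => h -> <-; rewrite E1 /extN -sumrB; apply: eq_bigr => j _.
by rewrite height_shift_base base_shift -mulrBr.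
Qed.

Definition ext_grad av y : 'rV[R]_d.+1 :=
  \row_i limn (fun k => k.+1%:R * (ext av y - ext av (y - k.+1%:R^-1 *: e_ i))).

Lemma sloped_harmonic (f : R -> R) a : sloped f a ->
  (fun k => k.+1%:R * f (k.+1%:R^-1)) @ \oo --> a.
Proof.
move=> [/= e e0 He]; apply: cvg_near_cst.
exists (Num.truncn e^-1).+1 => // k /= Nk.
rewrite He//= ?sub0r ?normrN.
- by rewrite mulrCA mulfV ?mulr1.
- rewrite gtr0_norm ?invr_gt0// invf_plt ?posrE//; apply: (lt_le_trans (truncnS_gt _)).
  by rewrite ler_nat ltnW.
Qed.

Lemma ext_gradP av y i a : sloped (fun h => ext av y - ext av (y - h *: e_ i)) a ->
  ext_grad av y ord0 i = a.
Proof. by move=> /sloped_harmonic H; rewrite mxE; apply/cvg_lim. Qed.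

Lemma ext_weak_gradient av : loc_integrable (@halfspace R d) (ext av) /\
  weak_gradient (@halfspace R d) (ext av) (ext_grad av).
Proof.
apply: weak_gradient_left_slope.
- exact: measurable_ext.
- by move=> y; rewrite /halfspace /= /ext => /negP/negPf ->.
- by move=> eps r e0 r0; exact: ext_loc.
- move=> y y0 i; have [a Ha] := ext_sloped av i y0.
  by rewrite (ext_gradP Ha); exact: sloped_harmonic Ha.
Qed.

End extension.

(** * Pointwise bounds for the extension *)
Section extension_bounds.
Context (R : realType) (d : nat).
Implicit Types (av : nat -> 'rV[int]_d -> R) (y : 'rV[R]_d.+1) (x : 'rV[R]_d).
Local Notation pre n := (\row_l (n ord0 l - 1) : 'rV[int]_d).
Local Notation e_ i := (delta_mx ord0 i : 'rV[R]_d.+1).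

Lemma sloped_le (f : R -> R) a (B : R) : sloped f a ->
  (\forall h \near (0 : R)^'+, `|f h| <= B * h) -> `|a| <= B.
Proof.
move=> fa fB.
have [h /= [h0 [E1 E2]]] : exists h : R, 0 < h /\ (f h = a * h /\ `|f h| <= B * h).
  have F : \forall h \near (0 : R)^'+, 0 < h /\ (f h = a * h /\ `|f h| <= B * h).
    by near=> h; split; [near: h; exact: nbhs_right_gt|split; near: h].
  exact: filter_ex F.
by move: E2; rewrite E1 normrM (gtr0_norm h0) ler_pM2r.
Unshelve. all: by end_near. Qed.

Lemma near_cell_cell k x : near_cell k (cell k x) x.
Proof. by move=> l; have /cubeP/(_ l)/andP[a b] := cube_cell k x; apply/andP; split; lra. Qed.

Lemma near_cell_close k x x' : (forall l, 2 ^+ k * `|x ord0 l - x' ord0 l| <= 2^-1) ->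
  near_cell k (cell k x) x'.
Proof.
move=> H l; have /cubeP/(_ l)/andP[a b] := cube_cell k x.
have k0 : 0 < 2 ^+ k :> R by rewrite exprn_gt0.
have := H l; rewrite -[X in X * `|_|](gtr0_norm k0) -normrM mulrBr ler_norml => /andP[c1 c2].
by apply/andP; split; lra.
Qed.

Section at_point.
Variables (av : nat -> 'rV[int]_d -> R) (y : 'rV[R]_d.+1) (b : nat -> R).
Let x := base_pt y.
Let t := height y.
Let n j := cell (2 ^ j) x.
Hypothesis t0 : 0 < t.
Hypothesis b0 : forall j, 0 <= b j.
Hypothesis Hb : forall j (e : {ffun 'I_d -> 'I_3}), `|av j (window (pre (n j)) e) - av j (n j)| <= b j.
Hypothesis Hp : forall j, `|av j (n j) - av j.+1 (n j.+1)| <= b j.+1.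

(** A common bound, up to a constant factor, for the value of the j-th layer
    and for its slopes: 2^(2^j) is the inverse side of the cubes, and [b j]
    bounds the differences with the selected neighbors.  The term [b j.-1] is
    the interpolation error of the previous layer, which enters the vertical
    slopes; for j = 0 there is no previous layer and the first summand bounds
    the vertical slope. *)
Definition layer_bound j : R := `|av j (n j)| + 2 ^+ (2 ^ j) * (b j + b j.-1).

Let k1 j : 1 <= 2 ^+ (2 ^ j) :> R. Proof. by rewrite exprn_ege1// ler1n. Qed.

Lemma layer_bound_ge0 j : 0 <= layer_bound j.
Proof. by rewrite addr_ge0// mulr_ge0 ?exprn_ge0// addr_ge0. Qed.

Let u j := interp (2 ^ j) (av j) x.

Let u_near j : `|u j - av j (n j)| <= b j.
Proof. exact: (interp_near (near_cell_cell (2 ^ j) x) (Hb j)). Qed.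

Let u_norm j : `|u j| <= 16 * layer_bound j.
Proof.
have := u_near j; have := k1 j; have := b0 j; have := b0 j.-1; rewrite /layer_bound => c1 c2 c3 c4.
have : `|u j| <= `|av j (n j)| + b j.
  by rewrite -[u j](subrK (av j (n j))) addrC (le_trans (ler_normD _ _))// lerD.
have : 0 <= `|av j (n j)| by [].
have : b j <= 2 ^+ (2 ^ j) * b j by rewrite ler_peMl.
have : 0 <= 2 ^+ (2 ^ j) * b j.-1 by rewrite mulr_ge0// exprn_ge0.
have : 0 <= 2 ^+ (2 ^ j) * b j by rewrite mulr_ge0// exprn_ge0.
by rewrite mulrDr; lra.
Qed.

Lemma ext_le : exists N, `|ext av y| <= \sum_(j < N) layer j t * (16 * layer_bound j).
Proof.
have [N /(_ N (leqnn _)) HN] := (@extE R d _ t0); exists N; rewrite HN//.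
apply: le_trans (ler_norm_sum _ _ _) _; apply: ler_sum => j _.
by rewrite normrM ger0_norm ?layer_ge0// ler_wpM2l ?layer_ge0//; exact: u_norm.
Qed.

Lemma ext_slope_base_le l a : sloped (fun h => ext av y - ext av (y - h *: e_ (lift ord_max l))) a ->
  exists N, `|a| <= \sum_(j < N) layer j t * (16 * layer_bound j).
Proof.
move=> Ha; have [N /(_ N (leqnn _) av (lift ord_max l))[E1 E2]] := ext_near_step t0.
exists N; apply: (sloped_le Ha).
have small : \forall h \near (0 : R)^'+, 0 < h /\ 2 ^+ (2 ^ N) * h < 2^-1.
  have c : 0 < 2^-1 / 2 ^+ (2 ^ N) :> R by rewrite divr_gt0 ?exprn_gt0.
  near=> h; split; near: h; first exact: nbhs_right_gt.
  apply: filterS (nbhs_right_lt c) => h.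
  by rewrite ltr_pdivlMr ?exprn_gt0// mulrC.
move: E2 small; apply: filterS2 => h -> [h0 h2]; rewrite E1 /extN -sumrB.
apply: le_trans (ler_norm_sum _ _ _) _; rewrite mulr_suml; apply: ler_sum => j _.
rewrite height_shift_base base_shift -mulrBr normrM ger0_norm ?layer_ge0// -mulrA.
rewrite ler_wpM2l ?layer_ge0//.
apply: (@le_trans _ _ (6 * 2 ^+ (2 ^ j) * b j * h)).
  apply: (interp_lip (near_cell_cell _ _) _ (ltW h0) (Hb j)).
  apply: near_cell_close => i; rewrite coord_shift subKr normrM gtr0_norm//.
  apply: le_trans (ltW h2); apply: ler_pM; rewrite ?exprn_ge0 ?mulr_ge0 ?(ltW h0)//.
    by apply: ler_weXn2l; rewrite ?ler1n// leq_exp2l// ltnW.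
  by rewrite normr_nat; case: eqP => _; rewrite ?mulr1// mulr0 ltW.
rewrite ler_wpM2r ?(ltW h0)// /layer_bound.
have := b0 j; have := b0 j.-1; have := k1 j => c1 c2 c3.
have : 0 <= `|av j (n j)| by [].
have : 0 <= 2 ^+ (2 ^ j) * b j.-1 by rewrite mulr_ge0// exprn_ge0.
have : 0 <= 2 ^+ (2 ^ j) * b j by rewrite mulr_ge0// exprn_ge0.
by rewrite mulrDr; lra.
Unshelve. all: by end_near. Qed.

Let theta j : R := ((0 < lvl R j * t - 1 <= 1)%R)%:R.

(** After Abel summation each slope of a cutoff multiplies a difference of
    consecutive interpolations, so that the values themselves enter only for
    j = 0. *)
Lemma ext_slope_height_le a : sloped (fun h => ext av y - ext av (y - h *: e_ ord_max)) a ->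
  exists N, `|a| <= \sum_(j < N) theta j * (16 * layer_bound j).
Proof.
move=> Ha; have [N0 HN0] := ext_sloped_max av t0; have [N1 HN1] := cutoff_top t0.
set N := (N0 + N1).+1.
have HN : (N0 <= N)%N by rewrite /N -addnS leq_addr.
have topN : dcutoff N t = 0.
  have := HN1 N _ t (lexx _); rewrite /N -addSn leq_addl => /(_ isT) H.
  rewrite /dcutoff; have -> : (lvl R N * t - 1 <= 1) = false by apply/negbTE; rewrite -ltNge; lra.
  by rewrite andbF mulr0.
exists N.
rewrite -(ext_gradP Ha) (ext_gradP (HN0 N HN)).
rewrite (abel_sum (fun j => dcutoff j t) u N) topN mul0r addr0.
apply: le_trans (ler_norm_sum _ _ _) _; apply: ler_sum => j _.
rewrite /dcutoff -/(theta j) mulrAC mulrC normrM ger0_norm ?ler0n// ler_wpM2l ?ler0n//.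
rewrite normrM gtr0_norm ?lvl_gt0// lvlE.
have Hj := u_near j; have kj := k1 j; have bj := b0 j.
have n1 : 0 <= 2 ^+ (2 ^ j) * b j by rewrite mulr_ge0// exprn_ge0.
have n0 : 0 <= `|av j (n j)| by [].
case: (nat_of_ord j) Hj kj bj n1 n0 => [|i] Hj kj bj n1 n0 /=.
  rewrite sub0r normrN /layer_bound expn0 expr1.
  have : `|u 0| <= `|av 0%N (n 0%N)| + b 0%N.
    by rewrite -[u 0](subrK (av 0%N (n 0%N))) addrC (le_trans (ler_normD _ _))// lerD.
  by rewrite /=; lra.
have : `|u i - u i.+1| <= b i + b i.+1 + b i.+1.
  have -> : u i - u i.+1 = (u i - av i (n i)) + (av i (n i) - av i.+1 (n i.+1)) - (u i.+1 - av i.+1 (n i.+1)) by ring.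
  apply: le_trans (ler_normB _ _) _; apply: lerD => //.
  by apply: le_trans (ler_normD _ _) _; apply: lerD.
move=> H; apply: (@le_trans _ _ (8 * 2 ^+ (2 ^ i.+1) * (b i + b i.+1 + b i.+1))).
  by rewrite ler_wpM2l// mulr_ge0// exprn_ge0.
have n2 : 0 <= 2 ^+ (2 ^ i.+1) * b i by rewrite mulr_ge0// exprn_ge0.
rewrite /layer_bound /= !mulrDr; lra.
Qed.

Variable p : R.
Hypothesis p0 : 0 < p.

(** The layers are a subconvex family, so [powR_convex_bound] applies. *)
Lemma ext_powR_le : exists N, `|ext av y| `^ p <= \sum_(j < N | lvl R j * t <= 2) (16 * layer_bound j) `^ p.
Proof.
have [N HN] := ext_le; exists N.
apply: (@powR_convex_bound _ _ _ (fun j => lvl R j * t <= 2) (fun j => layer j t) (fun j => 16 * layer_bound j)) => //.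
- by move=> j; exact: layer_ge0.
- by move=> j; rewrite mulr_ge0// layer_bound_ge0.
- by move=> j; exact: layer_lvl.
- exact: sum_layer_le1.
Qed.

Lemma ext_grad_powR_le i : exists N, `|ext_grad av y ord0 i| `^ p <= \sum_(j < N | lvl R j * t <= 2) (16 * layer_bound j) `^ p.
Proof.
have [a Ha] := ext_sloped av i t0; rewrite (ext_gradP Ha).
case: (unliftP ord_max i) Ha => [l|] -> Ha.
  have [N HN] := ext_slope_base_le Ha; exists N.
  apply: (@powR_convex_bound _ _ _ (fun j => lvl R j * t <= 2) (fun j => layer j t) (fun j => 16 * layer_bound j)) => //.
  - by move=> j; exact: layer_ge0.
  - by move=> j; rewrite mulr_ge0// layer_bound_ge0.
  - by move=> j; exact: layer_lvl.
  - exact: sum_layer_le1.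
have [N HN] := ext_slope_height_le Ha; exists N.
apply: (@powR_convex_bound _ _ _ (fun j => lvl R j * t <= 2) theta (fun j => 16 * layer_bound j)) => //.
- by move=> j; rewrite mulr_ge0// layer_bound_ge0.
- move=> j; rewrite /theta pnatr_eq0 eqb0 negbK => /andP[_]; lra.
- exact: sum_step.
Qed.

End at_point.

(** When lvl J * height <= 1 the layers sum to 1 and only those of index at
    least J occur; the constant 5/3 is the ratio of the horizontal deviation
    5/4 to the smallest height 3/4 in a Whitney neighborhood of unit size. *)
Lemma ext_near av x y (v A : R) J :
  0 < height y -> (forall l, `|x ord0 l - base_pt y ord0 l| <= 5 / 3 * height y) ->
  lvl R J * height y <= 1 ->
  (forall j, (J <= j)%N -> forall e : {ffun 'I_d -> 'I_3},
    `|av j (window (pre (cell (2 ^ j) x)) e) - v| <= A) ->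
  `|ext av y - v| <= A.
Proof.
move=> t0 xy JT HA; set t := height y.
have [N0 HN0] := (@extE R d _ t0); have [N1 HN1] := cutoff_top t0.
set N := (N0 + N1)%N.
rewrite (HN0 N (leq_addr _ _))// /extN -/t.
have s1 : \sum_(j < N) layer j t = 1.
  rewrite sum_layer cutoff1; last by apply: ltW; apply: HN1 => //; exact: leq_addl.
  by rewrite cutoff0 ?subr0//; apply: le_trans JT; rewrite ler_wpM2r ?(ltW t0)// lvl_le.
have -> : v = \sum_(j < N) layer j t * v by rewrite -mulr_suml s1 mul1r.
rewrite -sumrB; apply: le_trans (ler_norm_sum _ _ _) _.
rewrite -[leRHS]mul1r -s1 mulr_suml; apply: ler_sum => j _.
rewrite -mulrBr normrM ger0_norm ?layer_ge0//.
have [->|tj] := eqVneq (layer j t) 0; first by rewrite !mul0r.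
rewrite ler_wpM2l ?layer_ge0//.
have Jj : (J <= j)%N.
  rewrite leqNgt; apply/negP => jJ; have := layer_lvl1 tj; rewrite ltNge; move/negP; apply.
  by apply: le_trans JT; rewrite ler_wpM2r ?(ltW t0)// lvl_le.
apply: (interp_near _ (HA j Jj)).
apply: near_cell_close => l; have := layer_lvl tj; rewrite lvlE => H1.
have k0 : 0 < 2 ^+ (2 ^ j) :> R by rewrite exprn_gt0.
apply: (@le_trans _ _ (2 ^+ (2 ^ j) * (5 / 3 * t))); first by rewrite ler_pM2l.
rewrite mulrCA; lra.
Qed.

End extension_bounds.

(** * The weighted measure of strips *)
Section growth.
Context (R : realType).

Lemma ln2_le1 : ln 2 <= 1 :> R.
Proof. by have := @le_ln1Dx R 1; rewrite -(natrD _ 1 1); apply; lra. Qed.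

Lemma ln4_ge1 : 1 <= ln 4 :> R.
Proof.
have H : ln (2^-1) <= - 2^-1 :> R.
  have E : 2^-1 = 1 + - 2^-1 :> R by lra.
  rewrite [X in ln X]E.
  by apply: le_ln1Dx; lra.
rewrite lnV ?posrE// in H.
have -> : (4 : R) = 2 * 2 by rewrite -natrM.
rewrite lnM ?posrE//; lra.
Qed.

(** Used on the logarithm of the weight, whose growth from one dyadic height
    to the next is absorbed by a geometric decay. *)
Lemma powR_le_geom (lam r : R) : 0 < lam -> 1 < r ->
  exists2 C : R, 0 < C & forall n : nat, n.+2%:R `^ lam <= C * r ^+ n.
Proof.
move=> lam0 r1; have lr : 0 < ln r by rewrite ln_gt0.
pose e := ln r / lam; have e0 : 0 < e by rewrite divr_gt0.
exists (expR (- lam * ln e) * r ^+ 2); first by rewrite mulr_gt0 ?expR_gt0// exprn_gt0//; lra.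
move=> n; rewrite /powR pnatr_eq0/= -mulrA -exprD add2n.
have -> : r ^+ n.+2 = expR (lam * (e * n.+2%:R)).
  rewrite /e mulrA mulrC expRM_natl; congr (_ ^+ _).
  by rewrite mulrCA mulfV ?gt_eqF// mulr1 lnK// posrE; lra.
rewrite -expRD ler_expR mulNr addrC -mulrBr ler_pM2l//.
have : ln (e * n.+2%:R) < e * n.+2%:R by apply: ln_sublinear; rewrite mulr_gt0.
by rewrite lnM ?posrE//; lra.
Qed.

Lemma nneseries_geom_le (C q : R) (f : nat -> \bar R) : 0 <= C -> 0 <= q < 1 ->
  (forall n, 0 <= f n)%E -> (forall n, f n <= (C * q ^+ n)%:E)%E ->
  (\sum_(0 <= n <oo) f n <= (C / (1 - q))%:E)%E.
Proof.
move=> C0 /andP[q0 q1] f0 fq; apply: lime_le; first exact: is_cvg_nneseries.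
apply: nearW => N.
apply: (@le_trans _ _ (\sum_(0 <= i < N) (C * q ^+ i)%:E)%E); first exact: lee_sum.
rewrite sumEFin lee_fin.
have -> : \sum_(0 <= i < N) C * q ^+ i = series (geometric C q) N by [].
rewrite geometric_seriesE ?lt_eqF//= ler_pM2r ?invr_gt0 ?subr_gt0//.
by rewrite ler_piMr// lerBlDr lerDl exprn_ge0.
Qed.

End growth.

Section weight_estimates.
Context (R : realType) (d : nat) (p lam : R).
Hypothesis p1 : 1 <= p.
Hypothesis lam0 : 0 < lam.
Local Notation mu := (@mu_weight R d (p - 1) lam).

Lemma weight1_le (s b t : R) : 0 < s -> s < t -> t <= b -> b <= 1 ->
  weight1 (p - 1) lam t <= b `^ (p - 1) * ln (4 / s) `^ lam.
Proof.
move=> s0 st tb b1; have t0 : 0 < t by exact: lt_trans st.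
have t1 : t <= 1 by exact: le_trans b1.
rewrite /weight1 t1 gtr0_norm//.
have l0 (z : R) : 0 < z -> z <= 1 -> 0 <= ln (4 / z).
  move=> z0 z1; apply: ln_ge0; rewrite ler_pdivlMr//; lra.
apply: ler_pM; rewrite ?powR_ge0//.
  by apply: ge0_ler_powR; rewrite ?nnegrE ?subr_ge0// ltW// (lt_le_trans t0).
apply: ge0_ler_powR; rewrite ?nnegrE ?l0//; first exact: ltW.
  by apply: le_trans t1; exact: ltW.
by rewrite ler_ln ?posrE ?divr_gt0// ler_pM2l// lef_pV2 ?posrE// ltW.
Qed.

Lemma mu_slab (A : set 'rV[R]_d) (s b : R) : measurable A -> 0 < s -> s < b -> b <= 1 ->
  (mu (cyl A `]s, b]) <=
   ((ln 4 `^ lam)^-1 * (b `^ (p - 1) * ln (4 / s) `^ lam * (b - s)))%:E * lebesgueN R d A)%E.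
Proof.
move=> mA s0 sb b1; set K := b `^ (p - 1) * ln (4 / s) `^ lam.
have mC : measurable (cyl A `]s, b]) by apply: measurable_cyl.
have mH := @measurable_halfspace R d.
rewrite /mu_weight EFinM -muleA lee_wpmul2l//.
  by rewrite lee_fin invr_ge0 powR_ge0.
apply: (@le_trans _ _ (\int[lebesgueN R d.+1]_(y in cyl A `]s, b] `&` (@halfspace R d)) K%:E)%E).
  apply: ge0_le_integral => //; first exact: measurableI.
  - by move=> y _; rewrite lee_fin weight_ge0.
  - apply/measurable_EFinP; apply: measurable_funTS; exact: measurable_weight.
  - move=> y [[_]]; rewrite /= in_itv/= => /andP[sy yb] _.
    by rewrite lee_fin /weight; exact: weight1_le.
rewrite integral_cst//; last exact: measurableI.
rewrite [(K * _)%:E]EFinM -muleA; apply: lee_wpmul2l; first by rewrite lee_fin mulr_ge0 ?powR_ge0.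
apply: (@le_trans _ _ (lebesgueN R d.+1 (cyl A `]s, b]))).
  by apply: le_measure; rewrite ?inE//; exact: measurableI.
rewrite lebesgueN_cyl//= lebesgue_measure_itv/= lte_fin sb -EFinD muleC//.
Qed.

(** Cut the strip into the slabs between a 2^-(n+1) and a 2^-n.  On such a
    slab t^(p-1) dt contributes about (a 2^-n)^p, which decays at least like
    2^-n as p >= 1, while the logarithm grows by a factor at most n + 2; up to
    a constant factor the top slab dominates. *)
Lemma mu_strip : exists2 C : R, 0 < C & forall (A : set 'rV[R]_d) (a : R), measurable A ->
  0 < a -> a <= 1 ->
  (mu (cyl A `]0%R, a]) <= (C * (a `^ p * ln (4 / a) `^ lam))%:E * lebesgueN R d A)%E.
Proof.
have [C C0 HC] := @powR_le_geom R lam (3 / 2) lam0 ltac:(lra).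
pose c : R := (ln 4 `^ lam)^-1.
have c0 : 0 < c by rewrite invr_gt0 powR_gt0// (lt_le_trans ltr01 (ln4_ge1 R)).
exists (c * C / (1 - 3 / 4)); first by rewrite divr_gt0 ?mulr_gt0//; lra.
move=> A a mA a0 a1.
pose q n : R := a * (2 ^+ n)^-1.
have q0 n : 0 < q n by rewrite mulr_gt0// invr_gt0 exprn_gt0.
have q1 n : q n <= 1.
  by apply: le_trans a1; rewrite ler_piMr ?(ltW a0)// invf_le1 ?exprn_gt0// exprn_ege1// ler1n.
have qS n : q n.+1 = q n / 2 by rewrite /q exprS invfM mulrCA mulrC.
have la : 1 <= ln (4 / a).
  apply: le_trans (ln4_ge1 R) _; rewrite ler_ln ?posrE ?divr_gt0// ler_pdivlMr//; lra.
pose F n := cyl A `]q n.+1, q n].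
have mF n : measurable (F n) by apply: measurable_cyl.
have mE : measurable (cyl A `]0%R, a]) by apply: measurable_cyl.
have cov : cyl A `]0%R, a] `<=` \bigcup_n F n.
  move=> y [Ay]; rewrite /= in_itv/= => /andP[y0 ya].
  have : exists n, q n.+1 < height y.
    have [N HN] := @lt_expr2 R (height y / a) (divr_gt0 y0 a0).
    exists N; rewrite /q mulrC -ltr_pdivlMr//; apply: HN; exact: leqnSn.
  move=> /ex_minnP[n Hn Hmin]; exists n => //; split => //=; rewrite in_itv/= Hn/=.
  case: n Hn Hmin => [|n] Hn Hmin; first by rewrite /q expr0 invr1 mulr1.
  by rewrite leNgt; apply/negP => /Hmin; rewrite ltnn.
have := @measure_sigma_subadditive _ _ _ mu _ _ mF mE cov.
move/le_trans; apply.
have bF n : (mu (F n) <= (C * (3 / 4) ^+ n)%:E * ((c * (a `^ p * ln (4 / a) `^ lam))%:E * lebesgueN R d A))%E.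
  apply: le_trans (mu_slab mA (q0 n.+1) _ (q1 n)) _; first by rewrite qS; have := q0 n; lra.
  rewrite muleA -EFinM; apply: lee_wpmul2r => //; rewrite lee_fin -/c.
  rewrite [leRHS]mulrCA ler_pM2l//.
  have -> : q n - q n.+1 = q n / 2 by rewrite qS; lra.
  have -> : q n `^ (p - 1) * ln (4 / q n.+1) `^ lam * (q n / 2) =
      (q n `^ p) * (ln (4 / q n.+1) `^ lam / 2).
    by rewrite -(mulr_powRB1 (ltW (q0 n)) (lt_le_trans ltr01 p1)); ring.
  have b1 : q n `^ p <= a `^ p * (2 ^+ n)^-1.
    rewrite powRM ?invr_ge0 ?exprn_ge0 ?(ltW a0)// ler_pM2l ?powR_gt0//.
    by apply: ge1r_powR => //; rewrite invr_gt0 exprn_gt0//= invf_le1 ?exprn_gt0// exprn_ege1// ler1n.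
  have b2 : ln (4 / q n.+1) `^ lam <= ln (4 / a) `^ lam * (n.+2%:R `^ lam).
    have ln2 : ln (4 / q n.+1) = ln (4 / a) + ln 2 *+ n.+1.
      rewrite -lnXn// -lnM ?posrE ?divr_gt0 ?exprn_gt0//; congr ln.
      by rewrite /q invfM invrK mulrA.
    have ln20 : 0 <= ln 2 :> R by rewrite ln_ge0// ler1n.
    rewrite -powRM ?ler0n//; last by lra.
    apply: ge0_ler_powR; rewrite ?nnegrE.
    - exact: ltW.
    - rewrite ln2 addr_ge0 ?mulrn_wge0//; lra.
    - by rewrite mulr_ge0//; lra.
    rewrite ln2 -[n.+2]addn1 natrD mulrDr mulr1 addrC lerD2r -[ln 2 *+ _]mulr_natr ler_wpM2r//.
    exact: le_trans (ln2_le1 R) la.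
  apply: (@le_trans _ _ ((a `^ p * (2 ^+ n)^-1) * (ln (4 / a) `^ lam * (C * (3 / 2) ^+ n) / 2))).
    apply: ler_pM => //; rewrite ?powR_ge0 ?divr_ge0 ?powR_ge0//.
    rewrite ler_pM2r ?invr_gt0//; apply: le_trans b2 _.
    by rewrite ler_wpM2l ?powR_ge0.
  have -> : (3 / 4 : R) ^+ n = (3 / 2) ^+ n * (2 ^+ n)^-1.
    by rewrite -exprVn -exprMn; congr (_ ^+ _); lra.
  have : 0 <= a `^ p * (2 ^+ n)^-1 * (ln (4 / a) `^ lam * (C * (3 / 2) ^+ n)).
    by rewrite !mulr_ge0 ?powR_ge0 ?invr_ge0 ?exprn_ge0 ?ltW//; lra.
  by move=> H; rewrite mulrA; lra.
have [Afin|] := boolP (lebesgueN R d A \is a fin_num); last first.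
  rewrite ge0_fin_numE ?measure_ge0// -leNgt leye_eq => /eqP ->.
  have la0 : 0 < ln (4 / a) by lra.
  rewrite gt0_muley ?leey// lte_fin; apply: mulr_gt0; first by apply: divr_gt0; [exact: mulr_gt0|lra].
  by apply: mulr_gt0; exact: powR_gt0.
rewrite -(fineK Afin) -!EFinM.
have := @nneseries_geom_le R (C * (c * (a `^ p * ln (4 / a) `^ lam) * fine (lebesgueN R d A))) (3 / 4)
  (fun n => mu (F n)).
move=> H; apply: le_trans (H _ _ _ _) _.
- by rewrite !mulr_ge0 ?powR_ge0 ?fine_ge0 ?(ltW C0) ?(ltW c0).
- by apply/andP; split; lra.
- by move=> n; exact: measure_ge0.
- move=> n; apply: le_trans (bF n) _.
  by rewrite -(fineK Afin) -!EFinM lee_fin mulrAC.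
by rewrite lee_fin le_eqVlt; apply/orP; left; apply/eqP; ring.
Qed.

(** The order of magnitude of the mass of the strip below height 2 / lvl j over
    a set of unit measure; multiplied by the p-th power of the inverse side
    2^(2^j) it leaves the Besov weight of level j. *)
Definition strip_wt (j : nat) : R := ((2 ^+ (2 ^ j)) `^ p)^-1 * (2 ^+ j + 2) `^ lam.

Lemma strip_wt_ge0 j : 0 <= strip_wt j.
Proof. by rewrite mulr_ge0 ?invr_ge0 ?powR_ge0. Qed.

Lemma mu_strip_level : exists2 C : R, 0 < C & forall (A : set 'rV[R]_d) j, measurable A ->
  (mu (cyl A [set t : R | (0 < t)%R && (lvl R j * t <= 2)%R]) <= (C * strip_wt j)%:E * lebesgueN R d A)%E.
Proof.
have [C C0 HC] := mu_strip.
exists (C * 2 `^ lam); first by rewrite mulr_gt0// powR_gt0.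
move=> A j mA; set a : R := 2 / lvl R j.
have l0 := lvl_gt0 R j.
have a0 : 0 < a by rewrite divr_gt0.
have k1 : 1 <= 2 ^+ (2 ^ j) :> R by rewrite exprn_ege1// ler1n.
have aE : a = (2 ^+ (2 ^ j + 2))^-1.
  rewrite /a; have -> : lvl R j = 2 * 2 ^+ (2 ^ j + 2) by rewrite /lvl -exprS -addnS.
  by rewrite invfM mulrA mulfV ?mul1r.
have a1 : a <= 1 by rewrite aE invf_le1 ?exprn_gt0// exprn_ege1// ler1n.
have -> : [set t : R | (0 < t)%R && (lvl R j * t <= 2)%R] = `]0, a]%classic.
  by apply/seteqP; split => t /=; rewrite in_itv/= /a ler_pdivlMr// mulrC.
apply: le_trans (HC A a mA a0 a1) _; apply: lee_wpmul2r; first exact: measure_ge0.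
rewrite lee_fin -mulrA ler_pM2l// /strip_wt mulrCA.
apply: ler_pM; rewrite ?powR_ge0//.
  rewrite -powRN -[X in X `^ (- p)]invrK -[X in _ <= X `^ _]powR_inv1 ?invr_ge0 ?exprn_ge0//.
  rewrite -powRrM mulN1r opprK; apply: ge0_ler_powR; rewrite ?nnegrE ?invr_ge0 ?exprn_ge0 ?(ltW a0) ?(le_trans ler01 p1)//.
  rewrite aE lef_pV2 ?posrE ?exprn_gt0//; apply: ler_weXn2l; rewrite ?ler1n//.
  exact: leq_addr.
rewrite -powRM//.
have ln20 : 0 <= ln 2 :> R by rewrite ln_ge0// ler1n.
have -> : ln (4 / a) = ln 2 *+ (2 ^ j + 4).
  rewrite -lnXn//; congr ln; rewrite aE invrK.
  have -> : (4 : R) = 2 ^+ 2 by rewrite expr2; lra.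
  by rewrite -exprD; congr (_ ^+ _); lia.
apply: ge0_ler_powR; rewrite ?nnegrE; first exact: ltW.
- by rewrite mulrn_wge0.
- by rewrite mulr_ge0// addr_ge0// exprn_ge0.
apply: (@le_trans _ _ (1 *+ (2 ^ j + 4))); first by rewrite lerMn2r (ln2_le1 R) orbT.
rewrite natrD natrX; have : 0 <= 2 ^+ j :> R by rewrite exprn_ge0.
by lra.
Qed.

(** The factor 2^(-p 2^j) decays doubly exponentially, the other one grows
    exponentially. *)
Lemma sum_strip_wt : (\sum_(0 <= j <oo) (strip_wt j)%:E < +oo)%E.
Proof.
have [C C0 HC] := @powR_le_geom R lam (3 / 2) lam0 ltac:(lra).
apply: le_lt_trans (@nneseries_geom_le R C (3 / 4) _ _ _ _ _) (ltry _).
- exact: ltW.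
- by apply/andP; split; lra.
- by move=> n; rewrite lee_fin strip_wt_ge0.
move=> j; rewrite lee_fin /strip_wt.
have k1 : 1 <= 2 ^+ (2 ^ j) :> R by rewrite exprn_ege1// ler1n.
apply: (@le_trans _ _ ((2 ^+ (2 ^ j))^-1 * (C * (3 / 2) ^+ (2 ^ j)))).
  apply: ler_pM; rewrite ?invr_ge0 ?powR_ge0//.
    by rewrite lef_pV2 ?posrE ?powR_gt0 ?exprn_gt0//; exact: le1r_powR.
  by have := HC (2 ^ j)%N; rewrite -addn2 natrD natrX.
rewrite mulrCA ler_pM2l// -exprVn -exprMn.
have -> : 2^-1 * (3 / 2) = 3 / 4 :> R by lra.
by apply: ler_wiXn2l; rewrite ?leq_pow22//; lra.
Qed.

End weight_estimates.

(** * Means over dyadic cubes *)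
Section convexity.
Context (R : realType).

(** The tangent to the convex function s |-> s^p at [a], with the negative
    terms moved across so that all summands are nonnegative. *)
Lemma powR_tangent (p a s : R) : 1 <= p -> 0 <= a -> 0 <= s ->
  a `^ p + p * a `^ (p - 1) * s <= s `^ p + p * a `^ (p - 1) * a.
Proof.
move=> p1 a0 s0; have p0 : 0 < p by exact: lt_le_trans p1.
have Ea : a `^ (p - 1) * a = a `^ p by rewrite mulrC mulr_powRB1.
have [pe|pn] := eqVneq p 1.
  by rewrite pe subrr !powRr0 !powRr1// !mul1r addrC.
have p2 : 0 < p - 1 by rewrite subr_gt0 lt_neqAle eq_sym pn.
pose q := p / (p - 1).
have q0 : 0 < q by rewrite divr_gt0.
have pq : p^-1 + q^-1 = 1 by rewrite /q invf_div -{1}[p^-1]mul1r -mulrDl addrC subrK mulfV ?gt_eqF.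
have := conjugate_powR s0 (powR_ge0 a (p - 1)) p0 q0 pq.
have -> : (a `^ (p - 1)) `^ q = a `^ p by rewrite -powRrM /q mulrCA mulfV ?mulr1 ?gt_eqF.
have -> : a `^ p / q = a `^ p * (p - 1) / p by rewrite /q invf_div mulrA.
move=> H; have : p * (s * a `^ (p - 1)) <= p * (s `^ p / p + a `^ p * (p - 1) / p) by rewrite ler_pM2l.
have -> : p * (s `^ p / p + a `^ p * (p - 1) / p) = s `^ p + a `^ p * (p - 1) by field; lra.
rewrite -!mulrA Ea [a `^ (p - 1) * s]mulrC; lra.
Qed.

Lemma powR_sum3 (p a b c : R) : 0 < p -> 0 <= a -> 0 <= b -> 0 <= c ->
  (a + b + c) `^ p <= 3 `^ p * (a `^ p + b `^ p + c `^ p).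
Proof.
move=> p0 a0 b0 c0; pose M := Num.max a (Num.max b c).
have M0 : 0 <= M by rewrite le_max a0.
apply: (@le_trans _ _ ((3 * M) `^ p)).
  apply: ge0_ler_powR; rewrite ?nnegrE ?addr_ge0 ?mulr_ge0//; first exact: ltW.
  have : a <= M by rewrite le_max lexx.
  have : b <= M by rewrite !le_max lexx orbT.
  have : c <= M by rewrite !le_max lexx !orbT.
  lra.
rewrite powRM// ler_pM2l ?powR_gt0//.
have := powR_ge0 a p; have := powR_ge0 b p; have := powR_ge0 c p.
have : M = a \/ M = b \/ M = c.
  rewrite /M; case: (leP a (Num.max b c)) => _; last by left.
  by right; case: (leP b c) => _; [right|left].
by case=> [|[|]] ->; lra.
Qed.

End convexity.

Section averages.
Context (R : realType) (d : nat).
Local Notation leb := (lebesgueN R d).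
Implicit Types (f : 'rV[R]_d -> R) (Q : set 'rV[R]_d).

Lemma cube_box (k : nat) m : exists r : R, @cube R d k m `<=` box d r.
Proof.
pose z : 'rV[R]_d := \row_l ((2 ^+ k)^-1 * ((m ord0 l)%:~R + 1)).
have zc : cube k m z.
  by apply/cubeP => l; rewrite mxE mulVKf ?expf_neq0// ltrDl ltr01 lexx.
exists (\sum_l `|z ord0 l| + 1) => x xm l.
have := cube_close xm zc l; rewrite ltr_norml => /andP[a b].
have k1 : (2 ^+ k)^-1 <= 1 :> R by rewrite invf_le1 ?exprn_gt0// exprn_ege1// ler1n.
have zl : `|z ord0 l| <= \sum_l `|z ord0 l| by rewrite [leRHS](bigD1 l)//= lerDl sumr_ge0.
move: zl; rewrite !ler_norml => /andP[c1 c2]; apply/andP; split; lra.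
Qed.

Lemma compact_rV_box n (r : R) : compact (box n r).
Proof.
rewrite (_ : box n r = [set v : 'rV[R]_n | forall i, `[- r, r]%classic (v ord0 i)]).
  by apply: (@rV_compact _ n (fun=> `[- r, r]%classic)) => i; exact: segment_compact.
by apply/seteqP; split => v H i; have := H i; rewrite /= in_itv/= ler_norml.
Qed.

Lemma integrable_cube f (k : nat) m : loc_integrable setT f ->
  leb.-integrable (cube k m) (EFin \o f).
Proof.
move=> [_ fK]; have [r kr] := @cube_box k m.
have := fK _ (@compact_rV_box d r) (subsetT _).
by apply: integrableS => //; [exact: measurable_box|exact: measurable_cube].
Qed.

Lemma Rintegral_cube_average f (k : nat) m :
  \int[leb]_(x in cube k m) f x = fine (leb (cube k m)) * average (cube k m) f.
Proof. by rewrite /average mulVKf// gt_eqF// lebesgueN_cube_gt0. Qed.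

Lemma average_linear f g (a b : R) (k : nat) m : loc_integrable setT f -> loc_integrable setT g ->
  average (cube k m) (fun x => a * f x + b * g x) = a * average (cube k m) f + b * average (cube k m) g.
Proof.
move=> lf lg; have mQ := @measurable_cube R d k m.
have If := integrable_cube k m lf; have Ig := integrable_cube k m lg.
rewrite /average RintegralD//; first last.
- by rewrite (_ : EFin \o _ = (fun x => b%:E * (EFin \o g) x)%E)//; exact: integrableZl.
- by rewrite (_ : EFin \o _ = (fun x => a%:E * (EFin \o f) x)%E)//; exact: integrableZl.
by rewrite !RintegralZl//; ring.
Qed.

Lemma average_ae f g (k : nat) m : loc_integrable setT f -> loc_integrable setT g ->
  {ae leb, forall x, f x = g x} -> average (cube k m) f = average (cube k m) g.
Proof.
move=> [mf _] [mg _] fg; rewrite /average; congr (_ * fine _).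
apply: ae_eq_integral => //; first exact: measurable_cube.
- by apply/measurable_EFinP; exact: measurable_funTS.
- by apply/measurable_EFinP; exact: measurable_funTS.
- by apply: filterS fg => x -> _.
Qed.

(** Integrate the tangent inequality at a = |mean of f|. *)
Lemma jensen_cube f (p : R) (k : nat) m : 1 <= p -> loc_integrable setT f ->
  ((`|average (cube k m) f| `^ p)%:E * leb (cube k m) <=
   \int[leb]_(x in cube k m) (`|f x| `^ p)%:E)%E.
Proof.
move=> p1 lf; have mQ := @measurable_cube R d k m.
have If := integrable_cube k m lf.
have [mf _] := lf.
set a := `|average _ f|; set M := fine (leb (cube k m)).
have M0 : 0 < M by exact: lebesgueN_cube_gt0.
have ME : leb (cube k m) = M%:E by rewrite /M lebesgueN_cube.
have a0 : 0 <= a by exact: normr_ge0.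
pose c := p * a `^ (p - 1).
have c0 : 0 <= c by rewrite mulr_ge0 ?powR_ge0// (le_trans ler01).
have mfQ : measurable_fun (cube k m) f by exact: measurable_funTS.
have mnf : measurable_fun (cube k m) (fun x => `|f x|) by exact: measurableT_comp.
have mpf : measurable_fun (cube k m) (fun x => `|f x| `^ p).
  exact: (measurableT_comp (measurable_powR p)).
have aM : ((a * M)%:E <= \int[leb]_(x in cube k m) `|f x|%:E)%E.
  have -> : a * M = `|\int[leb]_(x in cube k m) f x|.
    by rewrite Rintegral_cube_average normrM (gtr0_norm M0) mulrC.
  have Inf := integrable_norm If.
  rewrite -[leRHS]fineK ?lee_fin; first exact: le_normr_Rintegral.
  exact: integrable_fin_num.
have key : (\int[leb]_(x in cube k m) ((a `^ p)%:E + (c * `|f x|)%:E) <=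
   \int[leb]_(x in cube k m) ((`|f x| `^ p)%:E + (c * a)%:E))%E.
  apply: ge0_le_integral => //.
  - move=> x _; rewrite -EFinD lee_fin; apply: addr_ge0; first exact: powR_ge0.
    by apply: mulr_ge0; [exact: c0|exact: normr_ge0].
  - apply: emeasurable_funD => //; apply/measurable_EFinP; exact: measurable_funM.
  - apply: emeasurable_funD => //; exact/measurable_EFinP.
  - by move=> x _; rewrite -!EFinD lee_fin; exact: powR_tangent.
move: key; rewrite !ge0_integralD//; first last.
- by apply/measurable_EFinP; exact: measurable_funM.
- by move=> x _; rewrite lee_fin mulr_ge0.
- by move=> x _; rewrite lee_fin powR_ge0.
- by move=> x _; rewrite lee_fin mulr_ge0.
- exact/measurable_EFinP.
rewrite !integral_cst// !ME.
under eq_integral do rewrite EFinM.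
rewrite ge0_integralZl//; last exact/measurable_EFinP.
move=> key.
have caM : (((c * a) * M)%:E <= c%:E * \int[leb]_(x in cube k m) `|f x|%:E)%E.
  by rewrite -mulrA EFinM; apply: lee_wpmul2l; rewrite ?lee_fin.
have : ((a `^ p)%:E * M%:E + (c * a * M)%:E <= \int[leb]_(x in cube k m) (`|f x| `^ p)%:E + (c * a)%:E * M%:E)%E.
  by apply: le_trans key; apply: leeD.
by rewrite -EFinM leeD2rE.
Qed.

(** Sum [jensen_cube] over the cubes of one generation. *)
Lemma sum_average_le f (p : R) (k : nat) : 1 <= p -> loc_integrable setT f ->
  (\int[leb]_x (`|average (cube k (cell k x)) f| `^ p)%:E <= \int[leb]_x (`|f x| `^ p)%:E)%E.
Proof.
move=> p1 lf; have [mf _] := lf.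
have mc m : measurable (@cell R d k @^-1` [set m]) by rewrite -cubeE; exact: measurable_cube.
rewrite (@ge0_integral_step _ _ _ leb _ _ mc setT (fun m => (`|average (cube k m) f| `^ p)%:E) measurableT)//.
rewrite [leRHS](ge0_integral_fibres leb mc)//.
- apply: le_esum => m _; rewrite !setTI -cubeE; exact: jensen_cube.
- apply/measurable_EFinP; apply: (measurableT_comp (measurable_powR p)).
  exact: measurableT_comp.
Qed.

(** A point of the closed cube is reached by moving slightly from it towards
    the corner of largest coordinates, which belongs to the half-open cube. *)
Lemma closure_cube (k : nat) (m : 'rV[int]_d) (z : 'rV[R]_d) :
  (forall l, (m ord0 l)%:~R <= 2 ^+ k * z ord0 l <= (m ord0 l)%:~R + 1) -> closure (cube k m) z.
Proof.
move=> H B /nbhs_ballP[e /= e0 eB].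
(* a step that is both below e and at most 1, so as to stay in the cube *)
pose dl := e / (1 + e); have dl0 : 0 < dl by rewrite divr_gt0// addr_gt0.
have dle : dl < e by rewrite ltr_pdivrMr ?addr_gt0// mulrDr mulr1 ltrDl mulr_gt0.
have dl1 : dl <= 1 by rewrite ler_pdivrMr ?addr_gt0// mul1r lerDr.
have k0 : 0 < 2 ^+ k :> R by rewrite exprn_gt0.
have k1 : (2 ^+ k)^-1 <= 1 :> R by rewrite invf_le1 ?exprn_gt0// exprn_ege1// ler1n.
pose c l : R := (2 ^+ k)^-1 * ((m ord0 l)%:~R + 1).
pose w : 'rV[R]_d := \row_l (z ord0 l + dl * (c l - z ord0 l)).
exists w; split.
  apply/cubeP => l; rewrite mxE; have /andP[h1 h2] := H l.
  have -> : 2 ^+ k * (z ord0 l + dl * (c l - z ord0 l)) =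
     (1 - dl) * (2 ^+ k * z ord0 l) + dl * ((m ord0 l)%:~R + 1).
    by rewrite /c; field; rewrite expf_neq0.
  set u := 2 ^+ k * z ord0 l in h1 h2 *.
  have : 0 <= (1 - dl) * (u - (m ord0 l)%:~R) by rewrite mulr_ge0 ?subr_ge0.
  have : 0 <= (1 - dl) * ((m ord0 l)%:~R + 1 - u) by rewrite mulr_ge0 ?subr_ge0.
  rewrite !mulrBr !mulrDr !mulrBl !mul1r !mulr1 => q1 q2; apply/andP; split; lra.
apply: eB; apply: ball_rV => // l; rewrite mxE opprD addNKr normrN normrM gtr0_norm//.
apply: le_lt_trans dle; rewrite ler_piMr ?(ltW dl0)//.
apply: le_trans k1; rewrite -[leRHS]mulr1 ler_pdivlMl// -[X in X * _](gtr0_norm k0) -normrM /c.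
have /andP[h1 h2] := H l.
have -> : 2 ^+ k * ((2 ^+ k)^-1 * ((m ord0 l)%:~R + 1) - z ord0 l) = (m ord0 l)%:~R + 1 - 2 ^+ k * z ord0 l.
  by rewrite mulrBr mulVKf ?expf_neq0.
by rewrite ler_norml; apply/andP; split; lra.
Qed.

Local Notation pre n := (\row_l (n ord0 l - 1) : 'rV[int]_d).

(** Cubes of one generation whose indices differ by at most 1 in each
    coordinate have a common vertex, given by the larger of the two
    indices. *)
Lemma selected_window j n (e : {ffun 'I_d -> 'I_3}) :
  selected_neighbor j (@cube R d (2 ^ j)%N n) (cube (2 ^ j)%N (window (pre n) e)).
Proof.
split; first by left; exists (window (pre n) e).
set m := window (pre n) e.
pose z : 'rV[R]_d := \row_l ((2 ^+ (2 ^ j))^-1 * (Num.max (n ord0 l) (m ord0 l))%:~R).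
have zE l : 2 ^+ (2 ^ j) * z ord0 l = (Num.max (n ord0 l) (m ord0 l))%:~R.
  by rewrite mxE mulVKf ?expf_neq0.
have mE l : m ord0 l = n ord0 l - 1 + (e l : nat)%:Z by rewrite !mxE.
exists z; split; apply: closure_cube => l; rewrite zE; have := mE l; have := ltn_ord (e l).
  move=> e3 me; rewrite -(intrD _ _ 1) !ler_int; apply/andP; split; lia.
move=> e3 me; rewrite -(intrD _ _ 1) !ler_int; apply/andP; split; lia.
Qed.

(** The two cubes even intersect, in [x]. *)
Lemma selected_parent j (x : 'rV[R]_d) :
  @selected_neighbor R d j.+1 (cube (2 ^ j.+1)%N (cell (2 ^ j.+1) x)) (cube (2 ^ j)%N (cell (2 ^ j) x)).
Proof.
split; first by right; exists (cell (2 ^ j) x).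
by exists x; split; apply: subset_closure; exact: cube_cell.
Qed.

End averages.

(** * The energy bounds the integrals of the layers *)
Section integral_affine3.
Local Open Scope ereal_scope.
Context dT (T : measurableType dT) (R : realType) (mu : {measure set T -> \bar R}).

Lemma integral_affine3 (D : set T) : measurable D -> forall A B C : T -> \bar R,
  measurable_fun setT A -> measurable_fun setT B -> measurable_fun setT C ->
  (forall x, 0 <= A x) -> (forall x, 0 <= B x) -> (forall x, 0 <= C x) ->
  forall c k : R, (0 <= c)%R -> (0 <= k)%R ->
  measurable_fun D (fun x => c%:E * (A x + (k%:E * B x + k%:E * C x))) /\
  \int[mu]_(x in D) (c%:E * (A x + (k%:E * B x + k%:E * C x))) =
  c%:E * (\int[mu]_(x in D) A x + (k%:E * \int[mu]_(x in D) B x + k%:E * \int[mu]_(x in D) C x)).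
Proof.
move=> mD A B C /(measurable_funTS) mA /(measurable_funTS) mB /(measurable_funTS) mC A0 B0 C0 c k c0 k0.
have mkB : measurable_fun D (fun x => k%:E * B x) by exact: measurable_funeM.
have mkC : measurable_fun D (fun x => k%:E * C x) by exact: measurable_funeM.
have kB0 x : 0 <= k%:E * B x by rewrite mule_ge0.
have kC0 x : 0 <= k%:E * C x by rewrite mule_ge0.
have mBC : measurable_fun D (fun x => k%:E * B x + k%:E * C x) by exact: emeasurable_funD.
have mABC : measurable_fun D (fun x => A x + (k%:E * B x + k%:E * C x)) by exact: emeasurable_funD.
split; first exact: measurable_funeM.
rewrite ge0_integralZl//; last by move=> x _; rewrite !adde_ge0.
rewrite ge0_integralD//; last by move=> x _; rewrite adde_ge0.
by rewrite ge0_integralD// !ge0_integralZl.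
Qed.

Lemma ge0_mule3r_le (c X Y Z : \bar R) : 0 <= X -> 0 <= Y -> 0 <= Z ->
  c * X + (c * Y + c * Z) <= c * (X + Y + Z).
Proof. by move=> X0 Y0 Z0; rewrite !ge0_muleDr ?adde_ge0// addeA. Qed.

End integral_affine3.

Section energy.
Context (R : realType) (d : nat) (p lam : R).
Hypothesis p1 : 1 <= p.
Hypothesis lam0 : 0 < lam.
Local Notation leb := (lebesgueN R d).
Local Notation mu := (@mu_weight R d (p - 1) lam).
Local Notation pre n := (\row_l (n ord0 l - 1) : 'rV[int]_d).
Implicit Types (f : 'rV[R]_d -> R).

Let p0 : 0 < p. Proof. exact: lt_le_trans p1. Qed.

Definition dyadic_mean f (j : nat) (m : 'rV[int]_d) : R := average (cube (2 ^ j)%N m) f.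

(** Together with [level_energy] this rewrites the double sum over cubes in the
    Besov energy as an integral over R^d ([besov_energyE]). *)
Definition neighbor_sum f (j : nat) (m : 'rV[int]_d) : \bar R :=
  (\esum_(Q' in selected_neighbor j (@cube R d (2 ^ j)%N m))
     (`| dyadic_mean f j m - average Q' f | `^ p)%:E)%E.

Lemma neighbor_sum_ge0 f j m : (0 <= neighbor_sum f j m)%E.
Proof. by apply: esum_ge0 => Q _; rewrite lee_fin powR_ge0. Qed.

Definition level_energy f j : \bar R := (\int[leb]_x neighbor_sum f j (cell (2 ^ j) x))%E.

Lemma level_energy_ge0 f j : (0 <= level_energy f j)%E.
Proof. by apply: integral_ge0 => x _; exact: neighbor_sum_ge0. Qed.

Lemma mfibre (k : nat) m : measurable (@cell R d k @^-1` [set m]).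
Proof. by rewrite -cubeE; exact: measurable_cube. Qed.

Lemma level_energyE f j : level_energy f j = (\esum_(m in setT) (neighbor_sum f j m * leb (cube (2 ^ j)%N m)))%E.
Proof.
rewrite /level_energy (@ge0_integral_step _ _ _ leb _ _ (@mfibre (2 ^ j)) setT (neighbor_sum f j) measurableT) //.
  by apply: eq_esum => m _; rewrite setTI -cubeE.
by move=> m; exact: neighbor_sum_ge0.
Qed.

Definition level_weight (j : nat) : R := (2 ^+ j + 2) `^ lam.

Lemma level_weight_gt0 j : 0 < level_weight j.
Proof. by rewrite powR_gt0// ltr_wpDl ?exprn_ge0. Qed.

(** Comparing a level with its parent costs a constant factor; for j = 0 both
    are the same. *)
Lemma level_weight_double j : level_weight j <= 2 `^ lam * level_weight j.-1.
Proof.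
have k0 n : 0 <= 2 ^+ n :> R by rewrite exprn_ge0.
rewrite -powRM//.
apply: ge0_ler_powR; rewrite ?nnegrE ?mulr_ge0 ?addr_ge0//; first exact: ltW.
by case: j => [|i] /=; [have := k0 0%N|have := k0 i; rewrite exprS]; lra.
Qed.

Lemma strip_wt_level j : strip_wt p lam j * (2 ^+ (2 ^ j)) `^ p = level_weight j.
Proof.
rewrite /strip_wt -/(level_weight j) mulrAC mulVf ?mul1r// gt_eqF// powR_gt0// exprn_gt0//.
Qed.

Lemma besov_energyE f : besov_energy p lam f = (\sum_(0 <= j <oo) ((level_weight j)%:E * level_energy f j))%E.
Proof.
apply: eq_eseriesr => j _; congr (_ * _)%E; rewrite level_energyE.
rewrite /dyadic esum_image; last by move=> a b _ _; exact: cube_inj.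
by apply: eq_esum => m _; rewrite muleC.
Qed.

Definition strip j : set 'rV[R]_d.+1 := cyl setT [set t : R | (0 < t) && (lvl R j * t <= 2)].

Lemma measurable_strip_itv j : measurable [set t : R | (0 < t) && (lvl R j * t <= 2)].
Proof.
rewrite (_ : [set t | _] = `]0, 2 / lvl R j]%classic)//.
by apply/seteqP; split => t /=; rewrite in_itv/= ler_pdivlMr ?lvl_gt0// mulrC.
Qed.

Lemma measurable_strip j : measurable (strip j).
Proof. by apply: measurable_cyl => //; exact: measurable_strip_itv. Qed.

Lemma measurable_cell_base dT (T : measurableType dT) (k : nat) (c : 'rV[int]_d -> T) :
  measurable_fun setT (fun y : 'rV[R]_d.+1 => c (cell k (base_pt y))).
Proof. exact: (measurableT_comp (@measurable_fun_cell R d dT T k c) (@measurable_base_pt R d)). Qed.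

Section one_function.
Variable f : 'rV[R]_d -> R.
Hypothesis fin_energy : (besov_energy p lam f < +oo)%E.

Lemma level_energy_le j : ((level_weight j)%:E * level_energy f j <= besov_energy p lam f)%E.
Proof.
rewrite besov_energyE.
have H n : (0 <= (level_weight n)%:E * level_energy f n)%E
  by rewrite mule_ge0 ?level_energy_ge0// lee_fin ltW// level_weight_gt0.
apply: le_trans (nneseries_lim_ge j.+1 _) => //.
rewrite big_nat_recr//= leeDr//; exact: sume_ge0.
Qed.

(** An infinite sum on one cube, a set of positive measure, would make the
    energy infinite. *)
Lemma neighbor_sum_lty j m : (neighbor_sum f j m < +oo)%E.
Proof.
rewrite ltey; apply/negP => /eqP noo.
have : (level_energy f j = +oo)%E.
  apply/eqP; rewrite -leye_eq level_energyE; apply: esum_ge; exists [set m].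
    by split => //; exact: finite_set1.
  by rewrite fsbig_set1 noo lebesgueN_cube gt0_mulye// lte_fin exprn_gt0// invr_gt0 exprn_gt0.
move=> E; have := level_energy_le j; rewrite E gt0_muley ?lte_fin ?level_weight_gt0//.
by rewrite leye_eq => /eqP H; move: fin_energy; rewrite H.
Qed.

(** The l^p norm of the differences with the selected neighbors, which
    bounds each of them. *)
Definition gap j m : R := fine (neighbor_sum f j m) `^ p^-1.

Lemma gap_ge0 j m : 0 <= gap j m. Proof. exact: powR_ge0. Qed.

Lemma gap_powR j m : (gap j m `^ p)%:E = neighbor_sum f j m.
Proof.
rewrite /gap -powRrM mulVf ?gt_eqF// powRr1 ?fine_ge0 ?neighbor_sum_ge0// fineK//.
by rewrite ge0_fin_numE ?neighbor_sum_ge0// neighbor_sum_lty.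
Qed.

Lemma gap_le j m Q' : selected_neighbor j (@cube R d (2 ^ j)%N m) Q' ->
  `|dyadic_mean f j m - average Q' f| <= gap j m.
Proof.
move=> sQ; set X := `|_|; have X0 : 0 <= X by exact: normr_ge0.
have H : ((X `^ p)%:E <= (gap j m `^ p)%:E)%E.
  rewrite gap_powR; apply: esum_ge; exists [set Q'].
    by split; [exact: finite_set1|move=> _ ->].
  by rewrite fsbig_set1.
rewrite lee_fin in H.
have E (z : R) : 0 <= z -> z = (z `^ p) `^ p^-1.
  by move=> z0; rewrite -powRrM mulfV ?gt_eqF// powRr1.
rewrite (E _ X0) (E _ (gap_ge0 j m)).
by apply: ge0_ler_powR; rewrite ?nnegrE ?powR_ge0// invr_ge0 ltW.
Qed.

Definition gaps (x : 'rV[R]_d) (j : nat) : R := gap j (cell (2 ^ j) x).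

Lemma gaps_window x j (e : {ffun 'I_d -> 'I_3}) :
  `|dyadic_mean f j (window (pre (cell (2 ^ j) x)) e) - dyadic_mean f j (cell (2 ^ j) x)| <= gaps x j.
Proof. by rewrite distrC; apply: gap_le; exact: selected_window. Qed.

Lemma gaps_parent x j :
  `|dyadic_mean f j (cell (2 ^ j) x) - dyadic_mean f j.+1 (cell (2 ^ j.+1) x)| <= gaps x j.+1.
Proof. by rewrite distrC; apply: gap_le; exact: selected_parent. Qed.

(** The j-th term in the pointwise bounds [ext_powR_le] and
    [ext_grad_powR_le]. *)
Definition major (y : 'rV[R]_d.+1) j : R := (16 * layer_bound (dyadic_mean f) y (gaps (base_pt y)) j) `^ p.

Lemma measurable_major j : measurable_fun setT (major ^~ j).
Proof.
apply: (measurableT_comp (measurable_powR p)); apply: measurable_funM => //.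
apply: measurable_funD.
  exact: (measurable_cell_base (2 ^ j) (fun m => `|dyadic_mean f j m|)).
apply: measurable_funM => //; apply: measurable_funD.
  exact: (measurable_cell_base (2 ^ j) (gap j)).
exact: (measurable_cell_base (2 ^ j.-1) (gap j.-1)).
Qed.

Lemma major_le y j : ((major y j)%:E <= (48 `^ p)%:E *
  ((`|dyadic_mean f j (cell (2 ^ j) (base_pt y))| `^ p)%:E +
   (((2 ^+ (2 ^ j)) `^ p)%:E * neighbor_sum f j (cell (2 ^ j) (base_pt y)) +
    ((2 ^+ (2 ^ j)) `^ p)%:E * neighbor_sum f j.-1 (cell (2 ^ j.-1) (base_pt y)))))%E.
Proof.
have k0 : 0 <= 2 ^+ (2 ^ j) :> R by rewrite exprn_ge0.
rewrite -(gap_powR j) -(gap_powR j.-1).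
rewrite -!EFinM lee_fin /major.
have o0 : 0 <= layer_bound (dyadic_mean f) y (gaps (base_pt y)) j by apply: layer_bound_ge0 => i; exact: gap_ge0.
rewrite powRM//.
have -> : 48 `^ p = 16 `^ p * 3 `^ p by rewrite -powRM// -natrM.
rewrite -mulrA ler_pM2l ?powR_gt0//.
have := gap_ge0 j.-1 (cell (2 ^ j.-1) (base_pt y)).
have := gap_ge0 j (cell (2 ^ j) (base_pt y)).
have := normr_ge0 (dyadic_mean f j (cell (2 ^ j) (base_pt y))).
rewrite /layer_bound /gaps.
move: (gap j.-1 _) (gap j _) (`|_|) (2 ^+ (2 ^ j)) k0 => g2 g1 a K k0 a0 g10 g20.
rewrite mulrDr (addrA a) -(powRM p k0 g10) -(powRM p k0 g20) (addrA (a `^ p)).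
by apply: powR_sum3; rewrite ?mulr_ge0.
Qed.

End one_function.

(** A function of the cell of the base point is constant on cylinders over
    cubes, whose masses are compared by [mu_strip_level]. *)
Lemma strip_integral : exists2 C : R, 0 < C & forall (k j : nat) (c : 'rV[int]_d -> \bar R),
  (forall m, 0 <= c m)%E ->
  (\int[mu]_(y in strip j) c (cell k (base_pt y)) <=
   (C * strip_wt p lam j)%:E * \int[leb]_x c (cell k x))%E.
Proof.
have [C C0 HC] := @mu_strip_level R d p lam p1 lam0; exists C => // k j c c0.
set K := C * _; have K0 : 0 <= K by rewrite mulr_ge0 ?strip_wt_ge0 ?ltW.
pose pi := fun y : 'rV[R]_d.+1 => @cell R d k (base_pt y).
have mpi m : measurable (pi @^-1` [set m]).
  have := measurable_base_pt measurableT (mfibre k m); rewrite setTI; exact.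
rewrite (@ge0_integral_step _ _ _ mu _ pi mpi (strip j) c (measurable_strip j))//.
apply: (@le_trans _ _ (\esum_(m in setT) ((K%:E * c m) * leb (setT `&` @cell R d k @^-1` [set m])))%E).
  apply: le_esum => m _; rewrite setTI [(K%:E * _)%E]muleC -muleA; apply: lee_wpmul2l => //.
  rewrite (_ : _ `&` _ = cyl (@cell R d k @^-1` [set m]) [set t : R | (0 < t) && (lvl R j * t <= 2)]).
    by apply: HC; exact: mfibre.
  by apply/seteqP; split => y /=; rewrite /strip /cyl /pi/=; tauto.
rewrite -(@ge0_integral_step _ _ _ leb _ _ (@mfibre k) setT (fun m => K%:E * c m)%E measurableT)//.
  rewrite ge0_integralZl//.
  exact: (@measurable_fun_cell R d _ _ k c).
by move=> m; rewrite mule_ge0.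
Qed.

(** Each layer contributes strip_wt j * |f|_p^p by Jensen's inequality, and
    the energies of levels j and j - 1; the first are summable over j, the
    others sum to at most a multiple of the Besov energy. *)
Lemma major_integral : exists2 C : R, 0 < C & forall f, loc_integrable setT f ->
  (besov_energy p lam f < +oo)%E ->
  (\sum_(0 <= j <oo) \int[mu]_(y in strip j) (major f y j)%:E <=
   C%:E * (\int[leb]_x (`|f x| `^ p)%:E + besov_energy p lam f))%E.
Proof.
have [C C0 HC] := strip_integral.
have wfin : (\sum_(0 <= j <oo) (strip_wt p lam j)%:E)%E \is a fin_num.
  rewrite ge0_fin_numE; last by apply: nneseries_ge0 => j _ _; rewrite lee_fin strip_wt_ge0.
  exact: sum_strip_wt.
set W := fine (\sum_(0 <= j <oo) (strip_wt p lam j)%:E)%E.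
have W0 : 0 <= W by apply: fine_ge0; apply: nneseries_ge0 => j _ _; rewrite lee_fin strip_wt_ge0.
have WE : (\sum_(0 <= j <oo) (strip_wt p lam j)%:E)%E = W%:E by rewrite fineK.
pose D := 48 `^ p * C; have D0 : 0 < D by rewrite mulr_gt0// powR_gt0.
have DE : D = 48 `^ p * C by []; clearbody D.
have q0 : 0 < 2 `^ lam :> R by rewrite powR_gt0.
exists (D * (W + 1 + 2 * 2 `^ lam)); first by rewrite mulr_gt0//; lra.
move=> f lf En.
set N := (\int[leb]_x _)%E; set E := besov_energy _ _ _.
have N0 : (0 <= N)%E by apply: integral_ge0 => x _; rewrite lee_fin powR_ge0.
have E0 : (0 <= E)%E.
  rewrite /E besov_energyE; apply: nneseries_ge0 => j _ _.
  by rewrite mule_ge0 ?level_energy_ge0// lee_fin ltW// level_weight_gt0.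
have avN j : (\int[leb]_x (`|dyadic_mean f j (cell (2 ^ j) x)| `^ p)%:E <= N)%E by exact: sum_average_le.
clearbody N.
have bj j : (\int[mu]_(y in strip j) (major f y j)%:E <=
   D%:E * ((strip_wt p lam j)%:E * N + (level_weight j)%:E * level_energy f j + (level_weight j)%:E * level_energy f j.-1))%E.
  set k := (2 ^+ (2 ^ j)) `^ p; have k0 : 0 <= k by exact: powR_ge0.
  have m1 := @measurable_cell_base _ _ (2 ^ j) (fun m => (`|dyadic_mean f j m| `^ p)%:E).
  have m2 := @measurable_cell_base _ _ (2 ^ j) (neighbor_sum f j).
  have m3 := @measurable_cell_base _ _ (2 ^ j.-1) (neighbor_sum f j.-1).
  have mj : measurable_fun (strip j) (fun y => (major f y j)%:E).
    by apply/measurable_EFinP; apply: measurable_funTS; exact: measurable_major.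
  have HI := @integral_affine3 _ _ _ mu _ (measurable_strip j) _ _ _ m1 m2 m3
    (fun y => powR_ge0 _ _) (fun y => neighbor_sum_ge0 _ _ _) (fun y => neighbor_sum_ge0 _ _ _) (48 `^ p) k (powR_ge0 _ _) k0.
  case: HI => mG EG.
  apply: (@le_trans _ _ ((48 `^ p)%:E *
     (\int[mu]_(y in strip j) (`|dyadic_mean f j (cell (2 ^ j) (base_pt y))| `^ p)%:E +
      (k%:E * \int[mu]_(y in strip j) neighbor_sum f j (cell (2 ^ j) (base_pt y)) +
       k%:E * \int[mu]_(y in strip j) neighbor_sum f j.-1 (cell (2 ^ j.-1) (base_pt y)))))%E).
    rewrite -EG; apply: ge0_le_integral => //.
    - exact: measurable_strip.
    - by move=> y _; rewrite lee_fin powR_ge0.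
    - by move=> y _; exact: major_le.
  move=> {EG mG}.
  rewrite DE EFinM -muleA; apply: lee_wpmul2l; first by rewrite lee_fin powR_ge0.
  have h1 := HC (2 ^ j)%N j (fun m => (`|dyadic_mean f j m| `^ p)%:E) (fun m => powR_ge0 _ _).
  have h2 := HC (2 ^ j)%N j (neighbor_sum f j) (@neighbor_sum_ge0 f j).
  have h3 := HC (2 ^ j.-1)%N j (neighbor_sum f j.-1) (@neighbor_sum_ge0 f j.-1).
  have kk (X Y : \bar R) : (0 <= Y)%E -> (X <= (C * strip_wt p lam j)%:E * Y)%E ->
      (k%:E * X <= C%:E * ((level_weight j)%:E * Y))%E.
    move=> Y0 XY; apply: (@le_trans _ _ (k%:E * ((C * strip_wt p lam j)%:E * Y))%E).
      by apply: lee_wpmul2l; rewrite ?lee_fin.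
    rewrite !muleA -!EFinM -strip_wt_level -/k.
    by have -> : k * (C * strip_wt p lam j) = C * (strip_wt p lam j * k) by ring.
  have hA : (\int[mu]_(y in strip j) (`|dyadic_mean f j (cell (2 ^ j) (base_pt y))| `^ p)%:E <=
      C%:E * ((strip_wt p lam j)%:E * N))%E.
    apply: le_trans h1 _; rewrite EFinM -muleA; apply: lee_wpmul2l; first by rewrite lee_fin ltW.
    apply: lee_wpmul2l; first by rewrite lee_fin strip_wt_ge0.
    exact: avN.
  have hB := kk _ _ (level_energy_ge0 f j) h2; have hC := kk _ _ (level_energy_ge0 f j.-1) h3.
  apply: le_trans (leeD hA (leeD hB hC)) _.
  have wN0 : (0 <= (strip_wt p lam j)%:E * N)%E by rewrite mule_ge0// lee_fin strip_wt_ge0.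
  have e10 : (0 <= (level_weight j)%:E * level_energy f j)%E
    by rewrite mule_ge0 ?level_energy_ge0// lee_fin ltW// level_weight_gt0.
  have e20 : (0 <= (level_weight j)%:E * level_energy f j.-1)%E
    by rewrite mule_ge0 ?level_energy_ge0// lee_fin ltW// level_weight_gt0.
  exact: (@ge0_mule3r_le R C%:E _ _ _ wN0 e10 e20).
have g0 j : (0 <= (level_weight j)%:E * level_energy f j)%E
  by rewrite mule_ge0 ?level_energy_ge0// lee_fin ltW// level_weight_gt0.
have g1 j : (0 <= (level_weight j)%:E * level_energy f j.-1)%E
  by rewrite mule_ge0 ?level_energy_ge0// lee_fin ltW// level_weight_gt0.
have g2 j : (0 <= (strip_wt p lam j)%:E * N)%E by rewrite mule_ge0// lee_fin strip_wt_ge0.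
apply: (@le_trans _ _ (\sum_(0 <= j <oo) (D%:E * ((strip_wt p lam j)%:E * N + (level_weight j)%:E * level_energy f j + (level_weight j)%:E * level_energy f j.-1)))%E).
  apply: lee_nneseries => // j _ _; apply: integral_ge0 => y _; by rewrite lee_fin powR_ge0.
rewrite nneseriesZl; last by move=> j _; rewrite !adde_ge0.
rewrite EFinM -muleA; apply: lee_wpmul2l; first by rewrite lee_fin ltW.
rewrite nneseriesD//; last by move=> j _ _; rewrite adde_ge0.
rewrite nneseriesD//.
have s1 : (\sum_(0 <= j <oo) ((strip_wt p lam j)%:E * N) = W%:E * N)%E.
  have [Nf|] := boolP (N \is a fin_num).
    rewrite -(fineK Nf); under eq_eseriesr do rewrite muleC.
    by rewrite nneseriesZl ?WE 1?muleC// => j _; rewrite lee_fin strip_wt_ge0.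
  rewrite ge0_fin_numE// -leNgt leye_eq => /eqP NE.
  have wt0 : 0 < strip_wt p lam 0.
    by rewrite mulr_gt0 ?invr_gt0 ?powR_gt0 ?exprn_gt0// ltr_wpDl ?exprn_ge0.
  have W1 : 0 < W.
    rewrite -lte_fin -WE; apply: lt_le_trans (nneseries_lim_ge 1 _); first by rewrite big_nat1.
    by move=> j _ _; rewrite lee_fin strip_wt_ge0.
  rewrite NE gt0_muley ?lte_fin//; apply/eqP; rewrite -leye_eq.
  apply: le_trans (nneseries_lim_ge 1 _); last by move=> j _ _; rewrite mule_ge0 ?leey// lee_fin strip_wt_ge0.
  by rewrite big_nat1 gt0_muley ?leey// lte_fin.
have s3 : (\sum_(0 <= j <oo) ((level_weight j)%:E * level_energy f j.-1) <= (2 * 2 `^ lam)%:E * E)%E.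
  apply: (@le_trans _ _ (\sum_(0 <= j <oo) ((2 `^ lam)%:E * ((level_weight j.-1)%:E * level_energy f j.-1)))%E).
    apply: lee_nneseries => // j _; rewrite muleA -EFinM; apply: lee_wpmul2r; first exact: level_energy_ge0.
    by rewrite lee_fin level_weight_double.
  rewrite nneseriesZl; last by move=> j _; exact: g0.
  rewrite [(2 * _)%:E]EFinM [(2%:E * _)%E]muleC -muleA; apply: lee_wpmul2l; first by rewrite lee_fin ltW.
  apply: lime_le; first by apply: is_cvg_nneseries => j _ _; exact: g0.
  apply: nearW => -[|n]; first by rewrite big_geq// mule_ge0.
  rewrite big_nat_recl//=.
  have -> : (2%:E * E = E + E)%E by rewrite mule_natl mule2n.
  apply: leeD; first by rewrite /E; exact: level_energy_le.
  by rewrite /E besov_energyE; apply: nneseries_lim_ge.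
apply: (@le_trans _ _ (W%:E * N + E + (2 * 2 `^ lam)%:E * E)%E).
  apply: leeD s3; apply: leeD; first by rewrite s1.
  by rewrite /E besov_energyE.
clearbody E.
have -> : (W%:E * N + E + (2 * 2 `^ lam)%:E * E = W%:E * N + (1 + 2 * 2 `^ lam)%:E * E)%E.
  by rewrite -addeA EFinD ge0_muleDl ?mul1e// lee_fin// mulr_ge0// ltW.
rewrite ge0_muleDr//; apply: leeD; apply: lee_wpmul2r => //; rewrite lee_fin; lra.
Qed.

End energy.

(** * Boundedness of the extension *)
Section norm_bound.
Context (R : realType) (d : nat) (p lam : R).
Hypothesis p1 : 1 <= p.
Hypothesis lam0 : 0 < lam.
Local Notation leb := (lebesgueN R d).
Local Notation mu := (@mu_weight R d (p - 1) lam).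
Local Notation H := (@halfspace R d).
Implicit Types (f : 'rV[R]_d -> R).

Let p0 : 0 < p. Proof. exact: lt_le_trans p1. Qed.

Lemma besov_energy_fin f : besov p lam f -> (besov_energy p lam f < +oo)%E.
Proof.
move=> [_ bf]; apply: (@lty_poweRy _ _ p^-1); first by rewrite invr_neq0// gt_eqF.
by apply: le_lt_trans bf; rewrite leeDr// Lnorm_ge0.
Qed.

Lemma besov_energy_ge0 f : (0 <= besov_energy p lam f)%E.
Proof.
rewrite besov_energyE; apply: nneseries_ge0 => j _ _.
by rewrite mule_ge0 ?level_energy_ge0// lee_fin ltW// level_weight_gt0.
Qed.

Lemma besov_norm_ge0 f : (0 <= besov_norm p lam f)%E.
Proof. by rewrite adde_ge0 ?Lnorm_ge0 ?poweR_ge0. Qed.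

Lemma ge0_lee_poweR (x y : \bar R) (r : R) : 0 <= r -> (0 <= x)%E -> (x <= y)%E -> (x `^ r <= y `^ r)%E.
Proof. by move=> r0 x0 xy; apply: gt0_ler_poweR => //; rewrite in_itv/= leey ?x0 ?(le_trans x0 xy). Qed.

(** The factor 2 only comes from bounding each summand by the p-th power of the
    sum. *)
Lemma besov_norm_powR f :
  (\int[leb]_x (`|f x| `^ p)%:E + besov_energy p lam f <= 2%:E * besov_norm p lam f `^ p)%E.
Proof.
have -> : (\int[leb]_x (`|f x| `^ p)%:E = 'N[leb]_p%:E[EFin \o f] `^ p)%E.
  by rewrite powR_Lnorm ?gt_eqF.
have -> : (2%:E * besov_norm p lam f `^ p = besov_norm p lam f `^ p + besov_norm p lam f `^ p)%E.
  by rewrite mule_natl mule2n.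
have e0 := besov_energy_ge0 f.
apply: leeD.
  by apply: ge0_lee_poweR; rewrite ?Lnorm_ge0 ?(ltW p0)// leeDl// poweR_ge0.
rewrite -[leLHS]poweRe1// -(mulVf (lt0r_neq0 p0)) poweRrM.
by apply: ge0_lee_poweR; rewrite ?poweR_ge0 ?(ltW p0)// leeDr// Lnorm_ge0.
Qed.

(** The common majorant of the p-th powers of the extension and of its partial
    derivatives. *)
Definition stack f (y : 'rV[R]_d.+1) : \bar R :=
  (\sum_(0 <= j <oo) ((fun y => (major p f y j)%:E) \_ (@strip R d j)) y)%E.

Let strip_major_ge0 f j y : (0 <= ((fun y => (major p f y j)%:E) \_ (@strip R d j)) y)%E.
Proof. by rewrite patchE; case: ifP => // _; rewrite lee_fin powR_ge0. Qed.

Let measurable_strip_major f j :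
  measurable_fun setT ((fun y => (major p f y j)%:E) \_ (@strip R d j)).
Proof.
apply/(measurable_restrictT _ (measurable_strip j)); apply: measurable_funTS.
by apply/measurable_EFinP; exact: measurable_major.
Qed.

Lemma measurable_stack f : measurable_fun setT (stack f).
Proof. by apply: ge0_emeasurable_sum => // j y _ _; exact: strip_major_ge0. Qed.

Lemma stack_ge0 f y : (0 <= stack f y)%E.
Proof. by apply: nneseries_ge0 => j _ _; exact: strip_major_ge0. Qed.

Lemma integral_stack f : (\int[mu]_y stack f y =
  \sum_(0 <= j <oo) \int[mu]_(y in @strip R d j) (major p f y j)%:E)%E.
Proof.
rewrite integral_nneseries//.
by apply: eq_eseriesr => j _; rewrite -integral_mkcond.
Qed.

Lemma le_stack f y (z : R) N : 0 < height y ->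
  `|z| `^ p <= \sum_(j < N | lvl R j * height y <= 2)
     (16 * layer_bound (dyadic_mean f) y (gaps p f (base_pt y)) j) `^ p ->
  ((`|z| `^ p)%:E <= stack f y)%E.
Proof.
move=> y0; rewrite -lee_fin => /le_trans; apply.
apply: le_trans (nneseries_lim_ge N _); last by move=> j _ _; exact: strip_major_ge0.
rewrite big_mkord big_mkcond/= -sumEFin le_eqVlt; apply/orP; left; apply/eqP.
apply: eq_bigr => j _; rewrite patchE.
have -> : (y \in @strip R d j) = (lvl R j * height y <= 2).
  apply/idP/idP; rewrite inE /strip /cyl/= -/(height y) y0/=; first by case.
  by move=> ->.
by case: ifP.
Qed.

Lemma enorm_le (v : 'rV[R]_d.+1) : exists i, enorm v <= d.+1%:R * `|v ord0 i|.
Proof.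
have [i _ Hi] : exists2 i : 'I_d.+1, true & forall j, `|v ord0 j| <= `|v ord0 i|.
  by case: (@arg_maxP _ _ _ ord0 xpredT (fun i => `|v ord0 i|) isT) => i _ Hi; exists i => // j; exact: Hi.
exists i; have r0 : 0 <= d.+1%:R * `|v ord0 i| by rewrite mulr_ge0.
rewrite -(ger0_norm r0) -sqrtr_sqr ler_sqrt ?sqr_ge0//.
apply: (@le_trans _ _ (\sum_(j < d.+1) `|v ord0 i| ^+ 2)).
  by apply: ler_sum => j _; rewrite -(real_normK (num_real (v ord0 j))) lerXn2r ?nnegrE.
rewrite sumr_const card_ord -[leLHS]mulr_natl exprMn ler_wpM2r ?sqr_ge0//.
by rewrite -natrX ler_nat expnS expn1 leq_pmulr.
Qed.

Lemma weighted_Lp_norm_le (h : 'rV[R]_d.+1 -> R) f (c : R) : 0 <= c ->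
  measurable_fun H h ->
  (forall y, H y -> ((`|h y| `^ p)%:E <= (c `^ p)%:E * stack f y)%E) ->
  (weighted_Lp_norm p (p - 1) lam h <= c%:E * (\int[mu]_y stack f y) `^ p^-1)%E.
Proof.
move=> c0 mh hle.
have pi0 : 0 <= p^-1 by rewrite invr_ge0 ltW.
have I0 : (0 <= \int[mu]_y stack f y)%E by apply: integral_ge0 => y _; exact: stack_ge0.
have -> : (c%:E * (\int[mu]_y stack f y) `^ p^-1 = (\int[mu]_y ((c `^ p)%:E * stack f y)) `^ p^-1)%E.
  rewrite ge0_integralZl ?lee_fin ?powR_ge0//; last 2 first.
  - exact: measurable_stack.
  - by move=> y _; exact: stack_ge0.
  by rewrite poweRM ?lee_fin ?powR_ge0// poweR_EFin -powRrM mulfV ?gt_eqF// powRr1.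
rewrite /weighted_Lp_norm unlock /Lnorm; apply: ge0_lee_poweR => //.
  by apply: integral_ge0 => y _; exact: poweR_ge0.
apply: ge0_le_integral => //.
- by move=> y _; exact: poweR_ge0.
- rewrite (_ : (fun x => _) = (fun y => (`|(h \_ H) y| `^ p)%:E))//.
  apply/measurable_EFinP; apply: (measurableT_comp (measurable_powR p)).
  apply: measurableT_comp => //; apply/(measurable_restrictT _ (@measurable_halfspace R d)).
  exact: mh.
- by apply: measurable_funeM; exact: measurable_stack.
- move=> y _ /=; rewrite patchE; case: ifPn => [/set_mem Hy|_]; first exact: hle.
  by rewrite normr0 powR0 ?gt_eqF// mule_ge0 ?lee_fin ?powR_ge0 ?stack_ge0.
Qed.

(** Both Lp norms are bounded by the (1/p)-th power of the integral of
    [stack], and that integral by the p-th power of the Besov norm; the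
    infimum in the Sobolev norm is bounded by its value at [ext_grad]. *)
Lemma ext_norm_le : exists2 C : R, 0 < C & forall f, besov p lam f ->
  (sobolev_norm p (p - 1) lam (ext (dyadic_mean f)) <= C%:E * besov_norm p lam f)%E.
Proof.
have [C C0 HC] := @major_integral R d p lam p1 lam0.
have ip0 : 0 <= p^-1 by rewrite invr_ge0 ltW.
exists ((1 + d.+1%:R) * (C * 2) `^ p^-1).
  by rewrite mulr_gt0 ?powR_gt0 ?mulr_gt0// ltr_pwDl.
move=> f bf; have En := besov_energy_fin bf; have [lf _] := bf.
have [[mF _] wg] := ext_weak_gradient (dyadic_mean f).
have [lg _] := wg.
apply: le_trans.
  by apply: ereal_inf_lbound; exists (ext_grad (dyadic_mean f)).
have gp0 x j : 0 <= gaps p f x j by exact: gap_ge0.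
have I0 : (0 <= \int[mu]_y stack f y)%E by apply: integral_ge0 => y _; exact: stack_ge0.
have N1 : (weighted_Lp_norm p (p - 1) lam (ext (dyadic_mean f)) <= 1%:E * (\int[mu]_y stack f y) `^ p^-1)%E.
  apply: weighted_Lp_norm_le => // y Hy; rewrite powR1 mul1e.
  have [N HN] := ext_powR_le Hy (gp0 (base_pt y)) (gaps_window p1 En (base_pt y)) p0.
  exact: le_stack HN.
have N2 : (weighted_Lp_norm p (p - 1) lam (fun y => enorm (ext_grad (dyadic_mean f) y)) <= (d.+1%:R)%:E * (\int[mu]_y stack f y) `^ p^-1)%E.
  apply: weighted_Lp_norm_le => //.
    apply: (measurableT_comp (continuous_measurable_fun (@sqrt_continuous R))).
    apply: measurable_sum => i; apply: measurable_funX; exact: (lg i).1.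
  move=> y Hy; have [i Hi] := enorm_le (ext_grad (dyadic_mean f) y).
  apply: (@le_trans _ _ ((d.+1%:R * `|ext_grad (dyadic_mean f) y ord0 i|) `^ p)%:E).
    by rewrite lee_fin ger0_norm ?sqrtr_ge0// ge0_ler_powR ?nnegrE ?sqrtr_ge0 ?mulr_ge0// ltW.
  rewrite powRM// EFinM; apply: lee_wpmul2l; first by rewrite lee_fin powR_ge0.
  have [N HN] := ext_grad_powR_le Hy (gp0 (base_pt y)) (gaps_window p1 En (base_pt y)) (gaps_parent p1 En (base_pt y)) p0 i.
  exact: le_stack HN.
apply: le_trans (leeD N1 N2) _.
rewrite -ge0_muleDl ?lee_fin//.
rewrite -EFinD EFinM -muleA; apply: lee_wpmul2l; first by rewrite lee_fin addr_ge0.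
have -> : (((C * 2) `^ p^-1)%:E * besov_norm p lam f = ((C * 2)%:E * besov_norm p lam f `^ p) `^ p^-1)%E.
  rewrite poweRM ?poweR_ge0 ?lee_fin ?mulr_ge0 ?(ltW C0)//.
  by rewrite -poweRrM mulfV ?gt_eqF// poweRe1 ?besov_norm_ge0.
apply: ge0_lee_poweR => //; rewrite integral_stack; apply: le_trans (HC f lf En) _.
by rewrite EFinM -muleA; apply: lee_wpmul2l; rewrite ?lee_fin ?(ltW C0)//; exact: besov_norm_powR.
Qed.

End norm_bound.

(** * Nested cubes and conditional means *)
Section nested_cubes.
Context (R : realType) (d : nat).
Local Notation leb := (lebesgueN R d).
Implicit Types (f u : 'rV[R]_d -> R) (x : 'rV[R]_d).

(** The end points of the coarse cube are multiples of the fine side, so a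
    fine cube cannot cross them. *)
Lemma cell_nested (i j : nat) x x' : (i <= j)%N -> cell j x = cell j x' -> cell i x = cell i x'.
Proof.
move=> ij E; apply: cube_cellE; apply/cubeP => l.
have /cubeP/(_ l)/andP[a b] := cube_cell i x.
have /cubeP/(_ l)/andP[a1 b1] := cube_cell j x.
have /cubeP/(_ l)/andP[a2 b2] := cube_cell j x'.
move: a2 b2 a1 b1 a b; rewrite -E; move: (cell j x ord0 l) (cell i x ord0 l) => M m.
have -> : 2 ^+ j = (2 ^ (j - i))%N%:R * 2 ^+ i :> R by rewrite natrX -exprD subnK.
set N := (2 ^ (j - i))%N; have N0 : 0 < N%:R :> R by rewrite ltr0n expn_gt0.
rewrite -!mulrA; move: (2 ^+ i * x ord0 l) (2 ^+ i * x' ord0 l) => z z' a2 b2 a1 b1 a b.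
have h1 : N%:Z * m <= M.
  rewrite -ltzD1 -(ltr_int R) intrM intrD; apply: lt_le_trans b1.
  by rewrite ltr_pM2l.
have h2 : M + 1 <= N%:Z * (m + 1).
  rewrite lezD1 -(ltr_int R) intrM intrD; apply: lt_le_trans a1 _.
  by rewrite ler_pM2l.
rewrite -(ler_int R) intrM in h1; rewrite -(ler_int R) intrM !intrD in h2.
rewrite -(ltr_pM2l N0) -(ler_pM2l N0); apply/andP; split.
  exact: le_lt_trans h1 a2.
exact: le_trans b2 h2.
Qed.

Lemma cube_subset (i j : nat) x : (i <= j)%N -> cube j (cell j x) `<=` @cube R d i (cell i x).
Proof.
move=> ij z /cube_cellE E; rewrite (cell_nested ij E); exact: cube_cell.
Qed.

Lemma cube_setI (i j : nat) m n : (i <= j)%N ->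
  @cube R d i m `&` cube j n = cube j n \/ @cube R d i m `&` cube j n = set0.
Proof.
move=> ij; have [E|/set0P[x [mx nx]]] := eqVneq (@cube R d i m `&` cube j n) set0; first by right.
by left; rewrite setIidr// (cube_cellE mx) (cube_cellE nx); exact: cube_subset.
Qed.

Lemma setI_closed_dycubes : setI_closed (@dycubes R d).
Proof.
move=> A B [->|[i [m _ <-]]]; first by rewrite set0I; left.
case=> [->|[j [n _ <-]]]; first by rewrite setI0; left.
have [ij|ji] := leqP i j.
  have := cube_setI m n (leq_pexp2l (isT : (0 < 2)%N) ij) => -[->|->]; last by left.
  by right; exists j; exists n.
have := cube_setI n m (leq_pexp2l (isT : (0 < 2)%N) (ltnW ji)); rewrite setIC => -[->|->]; last by left.
by right; exists i; exists m.
Qed.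

Lemma average_ge0 (k : nat) m u : (forall x, 0 <= u x) -> 0 <= average (@cube R d k m) u.
Proof. by move=> u0; rewrite mulr_ge0 ?invr_ge0 ?fine_ge0 ?integral_ge0// => x _; rewrite lee_fin. Qed.

Lemma ge0_integral_step_average (i k : nat) m u : (i <= k)%N -> loc_integrable setT u ->
  (forall x, 0 <= u x) ->
  (\int[leb]_(x in cube i m) (average (cube k (cell k x)) u)%:E = \int[leb]_(x in cube i m) (u x)%:E)%E.
Proof.
move=> ik lu u0; have [mu _] := lu.
have mc n : measurable (@cell R d k @^-1` [set n]) by rewrite -cubeE; exact: measurable_cube.
rewrite (@ge0_integral_step _ _ _ leb _ _ mc (cube i m) (fun n => (average (cube k n) u)%:E) (measurable_cube i m)); last first.
  by move=> n; rewrite lee_fin average_ge0.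
rewrite [RHS](ge0_integral_fibres leb mc) //; last 3 first.
- exact: measurable_cube.
- by apply/measurable_EFinP; exact: measurable_funTS.
- by move=> x _; rewrite lee_fin.
apply: eq_esum => n _; rewrite -cubeE.
have [->|->] := cube_setI m n ik; last by rewrite measure0 mule0 integral_set0.
have Iu := integrable_cube k n lu.
rewrite -[RHS]fineK; last exact: (integrable_fin_num (measurable_cube k n) Iu).
have := Rintegral_cube_average u k n; rewrite /Rintegral /= => ->.
have E : leb (cube k n) = (fine (leb (cube k n)))%:E by rewrite lebesgueN_cube.
by rewrite [X in (_ * X)%E = _]E -EFinM; congr (_%:E); exact: mulrC.
Qed.

Lemma loc_integrable_le f u : loc_integrable setT f -> measurable_fun setT u ->
  (forall x, `|u x| <= `|f x|) -> loc_integrable setT u.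
Proof.
move=> [mf If] mu uf; split => // K cK _; apply: le_integrable (If K cK (subsetT _)) => //.
- exact: measurable_compact_rV.
- by apply/measurable_EFinP; exact: measurable_funTS.
- by move=> x _ /=; rewrite lee_fin.
Qed.

(** Replacing [f] by its means on finer cubes keeps the integral over a cube.
    The nonnegative case is countable additivity; split [f] into its positive
    and negative parts. *)
Lemma integral_step_average (i k : nat) m f : (i <= k)%N -> loc_integrable setT f ->
  (\int[leb]_(x in cube i m) (average (cube k (cell k x)) f)%:E = \int[leb]_(x in cube i m) (f x)%:E)%E.
Proof.
move=> ik lf; have [mf _] := lf.
pose fp x := Num.max (f x) 0; pose fn x := Num.max (- f x) 0.
have fp0 x : 0 <= fp x by rewrite le_max lexx orbT.
have fn0 x : 0 <= fn x by rewrite le_max lexx orbT.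
have fE x : f x = 1 * fp x + (-1) * fn x.
  by rewrite /fp /fn; case: (lerP (f x) 0); case: (lerP (- f x) 0); lra.
have lp : loc_integrable setT fp.
  apply: (loc_integrable_le lf); first by apply: measurable_maxr.
  by move=> x; rewrite ger0_norm// ge_max normr_ge0 ler_norm.
have ln : loc_integrable setT fn.
  apply: (loc_integrable_le lf); first by apply: measurable_maxr => //; exact: measurableT_comp.
  by move=> x; rewrite ger0_norm// ge_max normr_ge0 -normrN ler_norm.
have mQ := @measurable_cube R d i m.
have Ep := ge0_integral_step_average m ik lp fp0.
have En := ge0_integral_step_average m ik ln fn0.
have mst (u : 'rV[R]_d -> R) : measurable_fun (cube i m) (fun x => (average (cube k (cell k x)) u)%:E).
  apply/measurable_EFinP; apply: measurable_funTS.
  exact: (@measurable_fun_cell R d _ _ k (fun n => average (cube k n) u)).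
have Ist (u : 'rV[R]_d -> R) : loc_integrable setT u -> (forall x, 0 <= u x) ->
    leb.-integrable (cube i m) (EFin \o fun x => average (cube k (cell k x)) u).
  move=> lu u0; apply/integrableP; split; first exact: mst.
  have /integrableP[_] := integrable_cube i m lu; congr (_ < _)%E.
  under eq_integral do rewrite /= ger0_norm//.
  rewrite -(ge0_integral_step_average m ik lu u0); apply: eq_integral => x _.
  by rewrite /= ger0_norm// average_ge0.
transitivity (\int[leb]_(x in cube i m) ((average (cube k (cell k x)) fp)%:E - (average (cube k (cell k x)) fn)%:E))%E.
  apply: eq_integral => x _; rewrite -EFinB; congr (_%:E).
  rewrite [X in average _ X](_ : f = fun z => 1 * fp z + (-1) * fn z); last by apply/funext.
  by rewrite average_linear// mul1r mulN1r.
rewrite integralB//; [|exact: Ist|exact: Ist].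
rewrite Ep En -integralB//; [|exact: (integrable_cube i m lp)|exact: (integrable_cube i m ln)].
by apply: eq_integral => x _; rewrite fE mul1r mulN1r.
Qed.

End nested_cubes.

(** * Whitney neighborhoods and the values of the trace *)
Section whitney_geometry.
Context (R : realType) (d : nat).
Local Notation leb := (lebesgueN R d.+1).
Implicit Types (x : 'rV[R]_d) (y w : 'rV[R]_d.+1) (Q : set 'rV[R]_d).

Lemma exprzNn (k : nat) : (2 : R) ^ (- (k%:Z)) = (2 ^+ k)^-1.
Proof. by rewrite -exprnN. Qed.

Lemma exprzNn1 (k : nat) : (2 : R) ^ (- (k%:Z) + 1) = 2 * (2 ^+ k)^-1.
Proof. by rewrite addrC expfzDr ?pnatr_eq0// exprzNn expr1z. Qed.

Lemma enorm_ge0 n (v : 'rV[R]_n) : 0 <= enorm v. Proof. exact: sqrtr_ge0. Qed.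

Lemma le_coord_enorm n (v : 'rV[R]_n) i : `|v ord0 i| <= enorm v.
Proof.
rewrite -sqrtr_sqr ler_sqrt ?sumr_ge0 ?sqr_ge0//; last by move=> j _; exact: sqr_ge0.
by rewrite (bigD1 i)//= lerDl sumr_ge0// => j _; exact: sqr_ge0.
Qed.

Lemma enorm0 n : enorm (0 : 'rV[R]_n) = 0.
Proof. by rewrite /enorm big1 ?sqrtr0// => i _; rewrite mxE expr0n. Qed.

Lemma dist_lt n (y : 'rV[R]_n) (A : set 'rV[R]_n) (c : R) : A !=set0 ->
  dist y A < c <-> exists2 w, A w & enorm (y - w) < c.
Proof.
move=> [a Aa].
have lb : lbound [set enorm (y - w) | w in A] 0 by move=> _ [w _ <-]; exact: enorm_ge0.
have hi : has_inf [set enorm (y - w) | w in A].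
  by split; [exists (enorm (y - a)); exists a|exists 0].
split.
  by move=> /(inf_lt hi.1)[_ [w Aw <-] wc]; exists w.
move=> [w Aw wc]; apply: le_lt_trans wc; apply: ge_inf; first by exists 0.
by exists w.
Qed.

Lemma open_enorm n (w : 'rV[R]_n) (c : R) : open [set y : 'rV[R]_n | enorm (y - w) < c].
Proof.
have ce : continuous (fun y : 'rV[R]_n => enorm (y - w)).
  move=> y; apply: (@continuous_comp _ _ _ (fun y : 'rV[R]_n => \sum_i (y - w) ord0 i ^+ 2) Num.sqrt); last exact: sqrt_continuous.
  apply: (@cvg_big R^o _ +%R 0 xpredT (@add_continuous R^o)); first exact: nbhs_filter.
  move=> i _.
  rewrite (_ : (fun z => _) = (fun z : 'rV[R]_n => (z ord0 i - w ord0 i) ^+ 2)); last first.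
    by apply/funext => z; rewrite !mxE.
  rewrite !mxE; apply: (@cvg_comp _ _ _ (fun z : 'rV[R]_n => z ord0 i - w ord0 i) (fun t => t ^+ 2)); last exact: exprn_continuous.
  have Fy : Filter (nbhs y) by exact: nbhs_filter.
  by apply: (@cvgB _ _ _ (nbhs y)); [exact: (@coord_rV_continuous R n i y)|exact: cvg_cst].
have := @open_comp _ _ (fun y : 'rV[R]_n => enorm (y - w)) [set t | t < c]; apply.
  by move=> y _; exact: ce.
exact: open_lt.
Qed.

Variables (k : nat) (m : 'rV[int]_d).
Local Notation Q := (@cube R d k m).
Local Notation W := (whitney k Q).
Local Notation D := (whitney_nbhd k Q).

Lemma whitney_cyl : W = cyl Q `](2 ^+ k)^-1, 2 * (2 ^+ k)^-1].
Proof. by apply/seteqP; split => y; rewrite /whitney /cyl /= in_itv/= exprzNn exprzNn1. Qed.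

Lemma lebesgueN_whitney : leb W = (((2 ^+ k)^-1) ^+ d * (2 ^+ k)^-1)%:E.
Proof.
rewrite whitney_cyl lebesgueN_cyl//; last exact: measurable_cube.
rewrite lebesgueN_cube lebesgue_measure_itv/= lte_fin.
have -> : (2 ^+ k)^-1 < 2 * (2 ^+ k)^-1 :> R.
  by rewrite ltr_pMl ?invr_gt0 ?exprn_gt0// ltr1n.
by rewrite -EFinB -EFinM mulr_natl mulr2n addrK.
Qed.

Lemma whitney_neq0 : W !=set0.
Proof.
apply/set0P/negP => /eqP W0; have := lebesgueN_whitney; rewrite W0 measure0 => -[] /esym/eqP.
by rewrite -exprSr expf_eq0/= invr_eq0 expf_eq0/= pnatr_eq0 andbF.
Qed.

(** The infimum in the distance is below a bound when one of the distances is;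
    this exhibits the neighborhood as an open set. *)
Lemma whitney_nbhdE : D = @halfspace R d `&` \bigcup_(w in W) [set y | enorm (y - w) < 4^-1 * (2 ^+ k)^-1].
Proof.
rewrite /whitney_nbhd exprzNn.
apply/seteqP; split => y /= [y0].
  by move=> /(dist_lt _ _ whitney_neq0)[w Ww H]; split => //; exists w.
by move=> [w Ww H]; split => //; apply/(dist_lt _ _ whitney_neq0); exists w.
Qed.

Lemma measurable_whitney_nbhd : measurable D.
Proof.
rewrite whitney_nbhdE; apply: measurableI; first exact: measurable_halfspace.
by apply: measurable_open_rV; apply: bigcup_open => w _; exact: open_enorm.
Qed.

Lemma whitney_sub_nbhd : W `<=` D.
Proof.
move=> w Ww; rewrite whitney_nbhdE; split.
  by case: Ww => _ /andP[+ _]; apply: lt_trans; rewrite exprzNn invr_gt0 exprn_gt0.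
by exists w => //=; rewrite subrr enorm0 mulr_gt0 ?invr_gt0 ?exprn_gt0.
Qed.

Lemma whitney_nbhd_near x y : Q x -> D y ->
  3 / 4 * (2 ^+ k)^-1 <= height y <= 9 / 4 * (2 ^+ k)^-1 /\
  forall l, `|x ord0 l - base_pt y ord0 l| <= 5 / 4 * (2 ^+ k)^-1.
Proof.
move=> Qx; rewrite whitney_nbhdE => -[_ [w [Qw]]]; rewrite exprzNn exprzNn1 /= => hw yw.
have H i : `|y ord0 i - w ord0 i| < 4^-1 * (2 ^+ k)^-1.
  by apply: le_lt_trans yw; have := le_coord_enorm (y - w) i; rewrite !mxE.
move: (2 ^+ k)^-1 (cube_close Qx Qw) hw H => e C /andP[h1 h2] H; split.
  by have := H ord_max; rewrite -/(height y) -/(height w) ltr_norml => /andP[a b]; apply/andP; split; lra.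
move=> l; have := H (lift ord_max l); have := C l.
by rewrite !mxE !ltr_norml ler_norml => /andP[a b] /andP[a' b']; apply/andP; split; lra.
Qed.

Lemma whitney_nbhd_measure : (0 < leb D)%E /\ (leb D < +oo)%E.
Proof.
split.
  apply: (@lt_le_trans _ _ (leb W)).
    by rewrite lebesgueN_whitney lte_fin -exprSr exprn_gt0// invr_gt0 exprn_gt0.
  apply: le_measure; rewrite ?inE; [|exact: measurable_whitney_nbhd|exact: whitney_sub_nbhd].
  by rewrite whitney_cyl; apply: measurable_cyl => //; exact: measurable_cube.
have [r Qr] := @cube_box R d k m.
have [w [Qw _]] := whitney_neq0; set x := base_pt w in Qw.
have e1 : (2 ^+ k)^-1 <= 1 :> R by rewrite invf_le1 ?exprn_gt0// exprn_ege1// ler1n.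
apply: (@le_lt_trans _ _ (leb (box d.+1 (`|r| + 3)))); last exact: lebesgueN_box.
apply: le_measure; rewrite ?inE; [exact: measurable_whitney_nbhd|exact: measurable_box|].
move=> y Dy i; have [/andP[h1 h2] hb] := whitney_nbhd_near Qw Dy.
have e0 : 0 < (2 ^+ k)^-1 :> R by rewrite invr_gt0 exprn_gt0.
have rr := ler_norm r; have r0 := normr_ge0 r.
case: (unliftP ord_max i) => [l|] ->.
  have := hb l; have := Qr _ Qw l; rewrite !mxE !ler_norml => /andP[a b] /andP[a' b'].
  by apply/andP; split; lra.
by rewrite -/(height y) ler_norml; apply/andP; split; lra.
Qed.

End whitney_geometry.

Section trace_values.
Context (R : realType) (d : nat).
Implicit Types (F : 'rV[R]_d.+1 -> R) (x : 'rV[R]_d).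

Lemma average_near n (D : set 'rV[R]_n) (F : 'rV[R]_n -> R) (v A : R) : measurable D ->
  (0 < lebesgueN R n D)%E -> (lebesgueN R n D < +oo)%E -> measurable_fun D F ->
  (forall y, D y -> `|F y - v| <= A) -> `|average D F - v| <= A.
Proof.
move=> mD D0 Doo mF FA; set L := fine (lebesgueN R n D).
have Lf : lebesgueN R n D \is a fin_num by rewrite ge0_fin_numE.
have L0 : 0 < L by rewrite fine_gt0// D0.
have Icst (c : R) : (lebesgueN R n).-integrable D (EFin \o cst c)
    by apply: (measurable_bounded_integrable mD Doo) => //; exists `|c|; split; [exact: num_real|move=> M cM y Dy /=; exact: ltW].
have IF : (lebesgueN R n).-integrable D (EFin \o F).
  apply: (measurable_bounded_integrable mD Doo mF).
  exists (`|v| + A); split; first exact: num_real.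
  move=> M MvA y Dy /=; apply/ltW; apply: le_lt_trans MvA.
  rewrite -[F y](subrK v) addrC; apply: le_trans (ler_normD _ _) _.
  by rewrite lerD// FA.
have Ec (c : R) : \int[lebesgueN R n]_(x in D) (cst c x) = c * L by rewrite Rintegral_cst.
have h1 : (v - A) * L <= \int[lebesgueN R n]_(x in D) F x.
  rewrite -Ec; apply: le_Rintegral => // y Dy /=.
  by have := FA y Dy; rewrite ler_norml => /andP[]; lra.
have h2 : \int[lebesgueN R n]_(x in D) F x <= (v + A) * L.
  rewrite -Ec; apply: le_Rintegral => // y Dy /=.
  by have := FA y Dy; rewrite ler_norml => /andP[]; lra.
rewrite ler_norml /average -/L mulrC; apply/andP; split.
  by rewrite lerBrDl ler_pdivlMr//; lra.
by rewrite lerBlDr ler_pdivrMr//; lra.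
Qed.

(** The cubes of one generation are disjoint, so a single one counts at [x]. *)
Lemma trace_approxE F (k : nat) x :
  trace_approx F k x = average (whitney_nbhd k (@cube R d k (cell k x))) F.
Proof.
rewrite /trace_approx -(@fsbig_widen _ _ _ _ [set @cube R d k (cell k x)])/=.
- by rewrite fsbig_set1 indicE mem_set ?mulr1//; exact: cube_cell.
- by move=> _ ->; exists (cell k x).
- move=> _ [[m _ <-] ne] /=; rewrite indicE memNset ?mulr0// => /cube_cellE E.
  by apply: ne; rewrite /= E.
Qed.

Lemma trace_approx_cvg F x (v : R) : measurable_fun (@halfspace R d) F ->
  (forall e : R, 0 < e -> exists K, forall k, (K <= k)%N -> forall y,
     whitney_nbhd k (@cube R d k (cell k x)) y -> `|F y - v| <= e) ->
  (fun k => trace_approx F k x) @ \oo --> v.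
Proof.
move=> mF H; apply/cvgrPdist_le => e e0; have [K HK] := H _ e0.
exists K => // k /= Kk; rewrite distrC trace_approxE.
have [D0 Doo] := whitney_nbhd_measure R k (cell k x).
apply: average_near => //; [exact: measurable_whitney_nbhd| |exact: HK].
by apply: measurable_funS mF; [exact: measurable_halfspace|move=> y []].
Qed.

End trace_values.

(** * Convergence of the means at points of finite local energy *)
Section geometric_sequences.
Context (R : realType).

(** Telescoping against the tail of a geometric series. *)
Lemma geometric_increments (a : nat -> R) (G q : R) : 0 <= G -> 0 <= q < 1 ->
  (forall j, `|a j - a j.+1| <= G * q ^+ j.+1) ->
  [/\ forall n k, `|a n - a (n + k)%N| <= G * q / (1 - q) * q ^+ n,
      cvgn a & forall n, `|a n - limn a| <= G * q / (1 - q) * q ^+ n].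
Proof.
move=> G0 /andP[q0 q1] Ha; have q1' : 0 < 1 - q by rewrite subr_gt0.
set K := G * q / (1 - q); have KE : K * (1 - q) = G * q by rewrite mulfVK// gt_eqF.
have K0 : 0 <= K by rewrite divr_ge0 ?mulr_ge0// ltW.
clearbody K.
have H n k : `|a n - a (n + k)%N| <= K * q ^+ n * (1 - q ^+ k).
  elim: k => [|k IH]; first by rewrite addn0 subrr normr0 expr0 subrr mulr0.
  rewrite addnS -[a n](subrK (a (n + k)%N)) -addrA.
  apply: le_trans (ler_normD _ _) _; apply: le_trans (lerD IH (Ha _)) _.
  rewrite [q ^+ (n + k).+1]exprS exprD mulrA -KE [q ^+ k.+1]exprS.
  by rewrite le_eqVlt; apply/orP; left; apply/eqP; ring.
have H1 n k : `|a n - a (n + k)%N| <= K * q ^+ n.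
  apply: le_trans (H n k) _; rewrite ler_piMr ?mulr_ge0 ?exprn_ge0//.
  by rewrite lerBlDr lerDl exprn_ge0.
have qc : (fun n => K * q ^+ n) @ \oo --> (0 : R).
  rewrite -[X in _ --> X](mulr0 K); apply: cvgMr; apply: cvg_expr.
  by rewrite ger0_norm.
have ca : cvgn a.
  apply/cauchy_cvgP; apply: cauchy_exP => e e0.
  have /cvgrPdist_lt/(_ _ e0)[N _ HN] := qc.
  exists (a N); exists N => // m /= nm; rewrite /ball /= -(subnKC nm).
  apply: le_lt_trans (H1 _ _) _; have := HN N (leqnn N).
  by rewrite /= sub0r normrN ger0_norm ?mulr_ge0 ?exprn_ge0.
split => // n; apply/ler_addgt0Pr => e e0.
have /cvgrPdist_le/(_ _ e0)[m _ Hm] := ca.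
have := Hm (n + m)%N (leq_addl _ _) => /= hm.
rewrite -[a n](subrK (a (n + m)%N)) -addrA; apply: le_trans (ler_normD _ _) _.
by apply: lerD => //; rewrite distrC.
Qed.

Lemma powR_le_inj (p a b : R) : 0 < p -> 0 <= a -> 0 <= b -> a `^ p <= b `^ p -> a <= b.
Proof.
move=> p0 a0 b0 ab; rewrite leNgt; apply/negP => ba; move: ab; rewrite leNgt; move/negP; apply.
by apply: gt0_ltr_powR; rewrite ?nnegrE.
Qed.

(** The rate at which the gaps must decay for (2^j)^lam gap^p to stay
    bounded. *)
Definition decay (p lam : R) : R := 2 `^ (- (lam / p)).

Lemma decay01 (p lam : R) : 0 < p -> 0 < lam -> 0 <= decay p lam < 1.
Proof.
move=> p0 lam0; rewrite /decay powR_ge0 powRN invf_lt1 ?powR_gt0//.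
have E : (1 : R) `^ (lam / p) = 1 by rewrite powR1.
rewrite /= -[ltLHS]E; apply: gt0_ltr_powR; rewrite ?nnegrE ?divr_gt0//.
by rewrite ltr1n.
Qed.

Lemma decay_powR (p lam : R) j : 0 < p -> (decay p lam ^+ j) `^ p = ((2 ^+ j) `^ lam)^-1.
Proof.
move=> p0; have -> : decay p lam ^+ j = decay p lam `^ j%:R by rewrite powR_mulrn ?powR_ge0.
have -> : 2 ^+ j = 2 `^ j%:R :> R by rewrite powR_mulrn.
rewrite /decay -(powRrM _ j%:R p) -(powRrM _ _ (j%:R * p)) -powRrM -powRN.
by congr (_ `^ _); field; rewrite gt_eqF.
Qed.

End geometric_sequences.

Section local_limits.
Context (R : realType) (d : nat) (p lam : R).
Hypothesis p1 : 1 <= p.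
Hypothesis lam0 : 0 < lam.
Local Notation leb := (lebesgueN R d).
Local Notation pre n := (\row_l (n ord0 l - 1) : 'rV[int]_d).
Variable f : 'rV[R]_d -> R.
Hypothesis fin_energy : (besov_energy p lam f < +oo)%E.
Implicit Type x : 'rV[R]_d.

Let p0 : 0 < p. Proof. exact: lt_le_trans p1. Qed.

(** The density whose integral over R^d is the Besov energy. *)
Definition local_energy x : \bar R :=
  (\sum_(0 <= j <oo) ((level_weight lam j)%:E * neighbor_sum p f j (cell (2 ^ j) x)))%E.

Let term_ge0 j x : (0 <= (level_weight lam j)%:E * neighbor_sum p f j (cell (2 ^ j) x))%E.
Proof. by rewrite mule_ge0 ?neighbor_sum_ge0// lee_fin ltW// level_weight_gt0. Qed.

Lemma local_energy_ge0 x : (0 <= local_energy x)%E.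
Proof. by apply: nneseries_ge0 => j _ _; exact: term_ge0. Qed.

Let measurable_neighbor_sum j : measurable_fun setT (fun x => neighbor_sum p f j (@cell R d (2 ^ j) x)).
Proof. exact: (@measurable_fun_cell R d _ _ (2 ^ j) (neighbor_sum p f j)). Qed.

Let measurable_term j :
  measurable_fun setT (fun x => (level_weight lam j)%:E * neighbor_sum p f j (@cell R d (2 ^ j) x))%E.
Proof. by apply: measurable_funeM; exact: measurable_neighbor_sum. Qed.

Lemma measurable_local_energy : measurable_fun setT local_energy.
Proof. by apply: ge0_emeasurable_sum => // j x _ _; exact: term_ge0. Qed.

Lemma integral_local_energy : (\int[leb]_x local_energy x = besov_energy p lam f)%E.
Proof.
rewrite (integral_nneseries leb measurableT measurable_term); last by move=> j x _; exact: term_ge0.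
rewrite besov_energyE; apply: eq_eseriesr => j _.
rewrite (ge0_integralZl_EFin leb measurableT)//.
- by move=> x _; exact: neighbor_sum_ge0.
- by rewrite ltW// level_weight_gt0.
Qed.

Lemma local_energy_integrable : leb.-integrable setT local_energy.
Proof.
apply/integrableP; split; first exact: measurable_local_energy.
under eq_integral do rewrite gee0_abs ?local_energy_ge0//.
by rewrite integral_local_energy.
Qed.

Lemma local_energy_ae : {ae leb, forall x, local_energy x < +oo}%E.
Proof.
have := integrable_ae measurableT local_energy_integrable.
apply: filterS => x /(_ I); rewrite ge0_fin_numE//; exact: local_energy_ge0.
Qed.

Local Notation q := (decay p lam).

Let q01 : 0 <= q < 1. Proof. exact: decay01. Qed.

Lemma gaps_decay x j : (local_energy x < +oo)%E ->
  gaps p f x j <= fine (local_energy x) `^ p^-1 * q ^+ j.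
Proof.
move=> xoo; have L0 := local_energy_ge0 x.
have Lf : local_energy x \is a fin_num by rewrite ge0_fin_numE.
set L := fine _; have l0 : 0 <= L by exact: fine_ge0.
have [q0 q1] := andP q01.
apply: (powR_le_inj p0); rewrite ?gap_ge0 ?mulr_ge0 ?powR_ge0 ?exprn_ge0//.
rewrite powRM ?powR_ge0 ?exprn_ge0// -powRrM mulVf ?gt_eqF// powRr1//.
rewrite decay_powR// ler_pdivlMr ?powR_gt0 ?exprn_gt0// mulrC.
apply: (@le_trans _ _ (level_weight lam j * gaps p f x j `^ p)).
  rewrite ler_wpM2r ?powR_ge0//; apply: ge0_ler_powR; rewrite ?nnegrE ?addr_ge0 ?exprn_ge0 ?(ltW lam0)//.
  by rewrite lerDl.
rewrite -lee_fin fineK// EFinM (gap_powR p1 fin_energy).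
apply: le_trans (nneseries_lim_ge j.+1 _); last by move=> i _ _; exact: term_ge0.
by rewrite big_nat_recr//= leeDr// sume_ge0.
Qed.

Definition local_limit x : R := limn (fun j => dyadic_mean f j (cell (2 ^ j) x)).

Lemma dyadic_mean_cvg x : (local_energy x < +oo)%E ->
  let G := fine (local_energy x) `^ p^-1 in
  [/\ forall n k, `|dyadic_mean f n (cell (2 ^ n) x) - dyadic_mean f (n + k) (cell (2 ^ (n + k)) x)| <= G * q / (1 - q) * q ^+ n,
      cvgn (fun j => dyadic_mean f j (cell (2 ^ j) x)) &
      forall n, `|dyadic_mean f n (cell (2 ^ n) x) - local_limit x| <= G * q / (1 - q) * q ^+ n].
Proof.
move=> xoo G; apply: geometric_increments q01 _; first exact: powR_ge0.
move=> j; apply: le_trans (gaps_parent p1 fin_energy x j) _; exact: gaps_decay.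
Qed.

(** Above [x] and close to the boundary, the extension only sees means on the
    cubes of [x] of large generation and on their neighbors, all close to the
    limit. *)
Lemma ext_cvg x (e : R) : (local_energy x < +oo)%E -> 0 < e -> exists K, forall k, (K <= k)%N ->
  forall y, whitney_nbhd k (@cube R d k (cell k x)) y -> `|ext (dyadic_mean f) y - local_limit x| <= e.
Proof.
move=> xoo e0; have [_ _ HL] := dyadic_mean_cvg xoo; have [q0 q1] := andP q01.
set G := fine (local_energy x) `^ p^-1 in HL; have G0 : 0 <= G by exact: powR_ge0.
set M := G + G * q / (1 - q).
have M0 : 0 <= M by rewrite addr_ge0// mulr_ge0 ?mulr_ge0// invr_ge0 subr_ge0 ltW.
have qc : (fun n => M * q ^+ n) @ \oo --> (0 : R).
  rewrite -[X in _ --> X](mulr0 M); apply: cvgMr; apply: cvg_expr.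
  by rewrite ger0_norm.
have /cvgrPdist_lt/(_ _ e0)[J _ HJ] := qc.
have {}HJ j : (J <= j)%N -> M * q ^+ j <= e.
  move=> Jj; have := HJ j Jj; rewrite /= sub0r normrN ger0_norm ?mulr_ge0 ?exprn_ge0//; exact: ltW.
exists (2 ^ J + 5)%N => k Kk y Dy.
have [/andP[h1 h2] hb] := whitney_nbhd_near (cube_cell k x) Dy.
have k0 : 0 < (2 ^+ k)^-1 :> R by rewrite invr_gt0 exprn_gt0.
apply: (@ext_near R d (dyadic_mean f) x y (local_limit x) e J).
- by apply: lt_le_trans h1; rewrite mulr_gt0.
- by move=> l; apply: le_trans (hb l) _; lra.
- apply: (@le_trans _ _ (lvl R J * (4 * (2 ^+ k)^-1))).
    rewrite ler_wpM2l//; first by apply: ltW; exact: lvl_gt0.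
    by apply: le_trans h2 _; lra.
  rewrite mulrA ler_pdivrMr ?exprn_gt0// mul1r /lvl.
  have -> : 4 = 2 ^+ 2 :> R by rewrite -natrX.
  by rewrite -exprD -addnA ler_eXn2l ?ltr1n// (leq_trans _ Kk)// leq_add2l.
- move=> j Jj w; apply: le_trans (HJ j Jj).
  rewrite -[dyadic_mean f j _](subrK (dyadic_mean f j (cell (2 ^ j) x))) -addrA.
  apply: le_trans (ler_normD _ _) _; rewrite /M mulrDl; apply: lerD; last exact: HL.
  by apply: le_trans (gaps_window p1 fin_energy x j w) _; exact: gaps_decay.
Qed.

Lemma ext_trace x : (local_energy x < +oo)%E ->
  (fun k => trace_approx (ext (dyadic_mean f)) k x) @ \oo --> local_limit x.
Proof.
move=> xoo; have [[mF _] _] := ext_weak_gradient (dyadic_mean f).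
by apply: trace_approx_cvg => // e; exact: ext_cvg.
Qed.

End local_limits.

(** * The limit of the means is the function *)
Lemma addeI_fin (R : realType) (x y z : \bar R) : x \is a fin_num -> (x + y = x + z)%E -> y = z.
Proof. by move=> xf H; have := congr1 (fun t => t - x)%E H; rewrite ![(x + _)%E]addeC !addeK. Qed.

Section equal_integrals.
Context (R : realType) (d : nat).
Local Notation leb := (lebesgueN R d).

(** Dynkin's lemma for the pi-system of dyadic cubes, inside one cube where
    both functions are integrable. *)
Lemma eq_integral_cubes (u v : 'rV[R]_d -> \bar R) m0 :
  leb.-integrable (@cube R d (2 ^ 0)%N m0) u -> leb.-integrable (@cube R d (2 ^ 0)%N m0) v ->
  (forall j m, @cube R d (2 ^ j)%N m `<=` cube (2 ^ 0)%N m0 ->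
     \int[leb]_(x in cube (2 ^ j)%N m) u x = \int[leb]_(x in cube (2 ^ j)%N m) v x)%E ->
  ae_eq leb (cube (2 ^ 0)%N m0) u v.
Proof.
set Q0 := @cube R d (2 ^ 0)%N m0 => Iu Iv uv.
have mQ0 : measurable Q0 by exact: measurable_cube.
have IS w A : leb.-integrable Q0 w -> measurable A -> leb.-integrable (Q0 `&` A) w.
  by move=> Iw mA; apply: integrableS Iw => //; exact: measurableI.
apply: (integral_ae_eq mQ0 Iu (measurable_int _ Iv)) => E EQ0 mE.
rewrite -(setIidr EQ0).
have mS : <<s @dycubes R d >> E by rewrite -measurable_dycubes.
have meas (S : set 'rV[R]_d) : <<s @dycubes R d >> S -> measurable S by rewrite -measurable_dycubes.
apply: (@dynkin_induction _ 'rV[R]_d (@dycubes R d)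
  (fun A => \int[leb]_(x in Q0 `&` A) u x = \int[leb]_(x in Q0 `&` A) v x)%E
  (@measurable_dycubes R d) (@setI_closed_dycubes R d)) mS.
- by rewrite setIT; exact: uv.
- move=> _ [->|[j [m _ <-]]]; first by rewrite setI0 !integral_set0.
  have := @cube_setI R d _ _ m0 m (leq_pexp2l (isT : (0 < 2)%N) (leq0n j)) => -[] E1.
    by rewrite /Q0 E1; apply: uv => x mx; rewrite -E1 in mx; case: mx.
  by rewrite /Q0 E1 !integral_set0.
- move=> A mA EA.
  have dec w : leb.-integrable Q0 w ->
      (\int[leb]_(x in Q0) w x = \int[leb]_(x in Q0 `&` A) w x + \int[leb]_(x in Q0 `&` ~` A) w x)%E.
    move=> Iw; rewrite -integral_setU.
    + by rewrite -setIUr setUv setIT.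
    + exact: measurableI.
    + by apply: measurableI => //; exact: measurableC.
    + by rewrite -setIUr setUv setIT; exact: measurable_int Iw.
    + by apply/disj_setPS => x [[_ a] [_ b]].
  have fA w : leb.-integrable Q0 w -> (\int[leb]_(x in Q0 `&` A) w x)%E \is a fin_num.
    by move=> Iw; apply: integrable_fin_num; [exact: measurableI|exact: IS].
  have : (\int[leb]_(x in Q0) u x = \int[leb]_(x in Q0) v x)%E by exact: uv.
  rewrite (dec u Iu) (dec v Iv) EA => H.
  exact: (addeI_fin (fA v Iv)) H.
- move=> F mF tF HF; rewrite setI_bigcupr.
  have tQ : trivIset setT (fun k => Q0 `&` F k) by exact: trivIset_setIl.
  have mQ k : measurable (Q0 `&` F k) by exact: measurableI.
  have IU w : leb.-integrable Q0 w -> leb.-integrable (\bigcup_k (Q0 `&` F k)) w.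
    by rewrite -setI_bigcupr => Iw; apply: IS => //; exact: bigcupT_measurable.
  rewrite (integral_bigcup tQ mQ (IU u Iu)) (integral_bigcup tQ mQ (IU v Iv)).
  by apply: eq_eseriesr => k _; exact: HF.
Qed.

Lemma ae_cubes (P : 'rV[R]_d -> Prop) (k : nat) :
  (forall m, {ae leb, forall x, @cube R d k m x -> P x}) -> {ae leb, forall x, P x}.
Proof.
move=> H.
have : {ae leb, forall x, forall n, if unpickle n is Some m then @cube R d k m x -> P x else True}.
  apply: (@ae_foralln _ _ _ leb (fun n x => if unpickle n is Some m then @cube R d k m x -> P x else True)) => n.
  by case: (unpickle n) => [m|]; [exact: H|exact: aeW].
by apply: filterS => x /(_ (pickle (cell k x))); rewrite pickleK; apply; exact: cube_cell.
Qed.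

End equal_integrals.

Section recovery.
Context (R : realType) (d : nat) (p lam : R).
Hypothesis p1 : 1 <= p.
Hypothesis lam0 : 0 < lam.
Local Notation leb := (lebesgueN R d).
Variable f : 'rV[R]_d -> R.
Hypothesis lf : loc_integrable setT f.
Hypothesis fin_energy : (besov_energy p lam f < +oo)%E.
Implicit Type x : 'rV[R]_d.
Local Notation q := (decay p lam).
Local Notation S := [set x | local_energy p lam f x < +oo]%E.

Let p0 : 0 < p. Proof. exact: lt_le_trans p1. Qed.

Let measurable_S : measurable S.
Proof.
rewrite (_ : S = setT `&` local_energy p lam f @^-1` [set` Interval (BInfty (\bar R) true) (BLeft (+oo : \bar R)%E)]).
  by apply: measurable_local_energy => //; exact: emeasurable_itv.
by rewrite setTI; apply/seteqP; split => x /=; rewrite in_itv.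
Qed.

Let measurable_dyadic_mean j : measurable_fun setT (fun x => dyadic_mean f j (@cell R d (2 ^ j) x)).
Proof. exact: (@measurable_fun_cell R d _ _ (2 ^ j) (dyadic_mean f j)). Qed.

(** The limit is cut off where it may not exist, so as to be measurable. *)
Let lim_S : 'rV[R]_d -> R := local_limit f \_ S.

Let measurable_lim_S : measurable_fun setT lim_S.
Proof.
apply: (@measurable_fun_cvg _ _ _ setT (fun j => (fun x => dyadic_mean f j (cell (2 ^ j) x)) \_ S)).
  by move=> j; apply/(measurable_restrictT _ measurable_S); exact: measurable_funTS.
move=> x _; rewrite /lim_S patchE; case: ifPn => [xS|xS].
  under eq_cvg do rewrite patchE xS.
  by have [_ + _] := dyadic_mean_cvg p1 lam0 fin_energy (set_mem xS).
by under eq_cvg do rewrite patchE (negbTE xS); exact: cvg_cst.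
Qed.

Lemma powR_inv_le1D (L : R) : 0 <= L -> L `^ p^-1 <= 1 + L.
Proof.
move=> L0; have ip : 0 < p^-1 by rewrite invr_gt0.
apply: (@le_trans _ _ ((1 + L) `^ p^-1)).
  by apply: ge0_ler_powR; rewrite ?nnegrE ?addr_ge0 ?(ltW ip)// lerDr.
rewrite -[leRHS]powRr1 ?addr_ge0//; apply: ler_powR; first by rewrite lerDl.
by rewrite invf_le1.
Qed.

(** By [dyadic_mean_cvg] the means of generation at least 2^i differ from the
    one of generation 2^i, which is constant on the cube, by at most a constant
    times the power 1/p of the local energy.  This provides an integrable
    majorant, and the integrals of the means do not change with the
    generation. *)
Let lim_S_integral i m : leb.-integrable (cube (2 ^ i)%N m) (EFin \o lim_S) /\
  (\int[leb]_(x in cube (2 ^ i)%N m) (lim_S x)%:E = \int[leb]_(x in cube (2 ^ i)%N m) (f x)%:E)%E.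
Proof.
set Q := cube _ m; have mQ : measurable Q by exact: measurable_cube.
have [q0 q1] := andP (decay01 p0 lam0).
set C := q / (1 - q) * q ^+ i.
have C0 : 0 <= C by rewrite mulr_ge0 ?exprn_ge0// divr_ge0// subr_ge0 ltW.
pose g x := ((`|dyadic_mean f i m| + C)%:E + C%:E * local_energy p lam f x)%E.
have Qoo : (leb Q < +oo)%E by rewrite /Q lebesgueN_cube ltry.
have Ig : leb.-integrable Q g.
  apply: integrableD => //.
    apply: (measurable_bounded_integrable mQ Qoo) => //; exists `|(`|dyadic_mean f i m| + C)|.
    by split; [exact: num_real|move=> M cM y Dy /=; exact: ltW].
  apply: integrableZl => //; apply: integrableS (local_energy_integrable fin_energy) => //.
have dom : {ae leb, forall x, forall n : nat, Q x ->
    (`|(dyadic_mean f (i + n) (cell (2 ^ (i + n)) x))%:E| <= g x)%E}.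
  apply: filterS (local_energy_ae fin_energy) => x xoo n Qx.
  have [H _ _] := dyadic_mean_cvg p1 lam0 fin_energy xoo.
  have L0 := local_energy_ge0 p lam f x.
  have Lf : local_energy p lam f x \is a fin_num by rewrite ge0_fin_numE.
  rewrite /g -(fineK Lf) -EFinM -EFinD lee_fin.
  have := H i n; rewrite -(cube_cellE Qx) => Hn.
  set L := fine _ in Hn *; have l0 : 0 <= L by exact: fine_ge0.
  have : `|dyadic_mean f (i + n) (cell (2 ^ (i + n)) x)| <= `|dyadic_mean f i m| + L `^ p^-1 * C.
    rewrite -[X in `|X|](subrK (dyadic_mean f i m)) addrC; apply: le_trans (ler_normD _ _) _.
    by rewrite lerD2l distrC (le_trans Hn)// /C !mulrA.
  move=> /le_trans; apply; rewrite -addrA lerD2l -[X in X + _]mulr1 -mulrDr mulrC.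
  by rewrite ler_wpM2l// powR_inv_le1D.
have cv : {ae leb, forall x, Q x ->
    (dyadic_mean f (i + n) (cell (2 ^ (i + n)) x))%:E @[n --> \oo] --> (EFin \o lim_S) x}.
  apply: filterS (local_energy_ae fin_energy) => x xoo Qx.
  have [_ H _] := dyadic_mean_cvg p1 lam0 fin_energy xoo.
  apply: cvg_EFin; first by exact: nearW.
  rewrite /= /lim_S patchE mem_set//.
  have := H; rewrite -(cvg_shiftn i) => H'.
  by under eq_cvg do rewrite /= addnC.
have mfn n : measurable_fun Q (fun x => (dyadic_mean f (i + n) (cell (2 ^ (i + n)) x))%:E).
  by apply/measurable_EFinP; apply: measurable_funTS; exact: measurable_dyadic_mean.
have mlim : measurable_fun Q (EFin \o lim_S).
  by apply/measurable_EFinP; apply: measurable_funTS.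
have [I1 _ H] := dominated_convergence mQ mfn mlim cv Ig dom.
split => //; have E : [sequence (\int[leb]_(x in Q) (dyadic_mean f (i + n) (cell (2 ^ (i + n)) x))%:E)%E]_n =
    cst (\int[leb]_(x in Q) (f x)%:E)%E.
  by apply/funext => n /=; apply: integral_step_average => //; rewrite leq_pexp2l// leq_addr.
by rewrite E in H; have := cvg_lim (@ereal_hausdorff R) H; rewrite lim_cst// => ->.
Qed.

(** The two functions have the same integral over all dyadic cubes of the
    generations 2^j, hence over all Borel subsets of the cubes of generation
    2^0. *)
Lemma local_limit_ae : {ae leb, forall x, local_limit f x = f x}.
Proof.
have H : {ae leb, forall x, lim_S x = f x}.
  apply: (@ae_cubes R d _ (2 ^ 0)%N) => m.
  have [I0 _] := lim_S_integral 0 m.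
  have := @eq_integral_cubes R d (EFin \o lim_S) (EFin \o f) m I0 (integrable_cube _ _ lf).
  have HH : forall j m', @cube R d (2 ^ j)%N m' `<=` cube (2 ^ 0)%N m ->
     (\int[leb]_(x in cube (2 ^ j)%N m') (lim_S x)%:E = \int[leb]_(x in cube (2 ^ j)%N m') (f x)%:E)%E.
    by move=> j m' _; have [_] := lim_S_integral j m'.
  by move=> /(_ HH); apply: filterS => x /[apply] -[].
move: H (local_energy_ae fin_energy); apply: filterS2 => x + xoo.
by rewrite /lim_S patchE mem_set.
Qed.

Lemma extension_trace : has_trace (ext (dyadic_mean f)) /\
  {ae leb, forall x, trace (ext (dyadic_mean f)) x = f x}.
Proof.
split.
  rewrite /has_trace; move: (local_energy_ae fin_energy); apply: filterS => x xoo.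
  by apply/cvg_ex; exists (local_limit f x); exact: (ext_trace p1 lam0 fin_energy xoo).
move: local_limit_ae (local_energy_ae fin_energy); apply: filterS2 => x <- xoo.
by apply: cvg_lim => //; exact: (ext_trace p1 lam0 fin_energy xoo).
Qed.

End recovery.

Theorem theorem1p4 (R : realType) (d : nat) (p lam : R) :
  (1 <= d)%N -> Gamma p lam -> 0 < lam ->
  exists E : ('rV[R]_d -> R) -> ('rV[R]_d.+1 -> R),
  [/\ forall f, besov p lam f -> sobolev p (p - 1) lam (E f),
      forall f g, besov p lam f -> besov p lam g ->
        {ae lebesgueN R d, forall x, f x = g x} ->
        {ae lebesgueN R d.+1, forall y, halfspace y -> E f y = E g y},
      forall (a b : R) f g, besov p lam f -> besov p lam g ->
        {ae lebesgueN R d.+1, forall y, halfspace y ->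
          E (fun x => a * f x + b * g x) y = a * E f y + b * E g y},
      exists C : R, forall f, besov p lam f ->
        (sobolev_norm p (p - 1) lam (E f) <= C%:E * besov_norm p lam f)%E
    & forall f, besov p lam f ->
        has_trace (E f) /\ {ae lebesgueN R d, forall x, trace (E f) x = f x}].
Proof.
move=> _ Gpl lam0.
have p1 : 1 <= p by case: Gpl => [[/ltW]|[->]].
have [C C0 HC] := @ext_norm_le R d p lam p1 lam0.
exists (fun f => ext (dyadic_mean f)); split.
- move=> f bf; have [lF wF] := ext_weak_gradient (dyadic_mean f).
  split => //; first by exists (ext_grad (dyadic_mean f)).
  by apply: le_lt_trans (HC f bf) _; rewrite lte_mul_pinfty ?lee_fin ?(ltW C0)//; case: bf.
- move=> f g [lf _] [lg _] fg; apply: aeW => y _; congr (ext _ y).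
  by apply/funext => j; apply/funext => m; exact: average_ae.
- move=> a b f g [lf _] [lg _]; apply: aeW => y _; rewrite -ext_linear; congr (ext _ y).
  by apply/funext => j; apply/funext => m; exact: average_linear.
- by exists C.
- by move=> f bf; apply: (extension_trace p1 lam0 bf.1); exact: besov_energy_fin.
Qed.
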